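(* Consider the two-player system $x(t+1)=Ax(t)+Bu(t)+v(t)$, $y(t)=Cx(t)+w(t)$, $t=0,\dots,N-1$, with information structure $\mathcal F_1(t)=\{y_1(0:t),u_1(0:t-1),y_2(0:t),u_2(0:t-1)\}$, $\mathcal F_2(t)=\{y_1(0:t-1),u_1(0:t-1),y_2(0:t),u_2(0:t-1)\}$ and cost $\mathbb E[\sum_{t=0}^{N-1}(x(t)'Qx(t)+u(t)'Ru(t))+x(N)'Sx(N)]$. Let the optimal control law be written $u^*(t)=F^*(t)y(t)-(F^*(t)C+H(t))\hat x(t)$ with $F^*(t)=\begin{bmatrix}F^*_{11}(t)&F^*_{12}(t)\\0&F^*_{22}(t)\end{bmatrix}$ and $H(t)$ the classical LQR gain. Then the optimal gain matrix $F^*(t)$ is given by the recursion $$F^*(t)=-\big(R+B'M^*(t+1)B\big)^{-1}\Big(\Psi^*(t)\big(CT(t)C'+W\big)^{-1}+B'M^*(t+1)\mathcal K(t)\Big),$$ $$M^*(t)=Q+H(t)'RH(t)+(A-BH(t))'M^*(t+1)(A-BH(t)),\qquad M^*(N)=S,$$ where $\Psi^*(t)=\begin{bmatrix}0&0\\\Psi^*_{21}(t)&0\end{bmatrix}$ is the (Lagrange multiplier) matrix associated with the constraint $F_{21}(t)=0$.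
   Context: Prime denotes transpose; $z(0:t)=(z(0),\dots,z(t))$. $x$ is the state, $u=(u_1,u_2)$ the inputs of the two players, $y=(y_1,y_2)$ their observations; $A,B,C$ are arbitrary matrices of compatible sizes. $Q,R,S$ are positive definite. $v(t),w(t)$ are zero-mean Gaussian with covariances $V,W$, independent across time, independent of each other and of $x(0)$; $x(0)$ is zero-mean Gaussian with known covariance. Admissible laws are $u_i(t)=f_i(\mathcal F_i(t),t)$. $\mathcal H(t)=\{y(0:t-1),u(0:t-1)\}$, $\hat x(t)=\mathbb E[x(t)\mid\mathcal H(t)]$, $T(t)=\mathbb E[(x(t)-\hat x(t))(x(t)-\hat x(t))']$, $\mathcal K(t)=AT(t)C'(CT(t)C'+W)^{-1}$ (the inverse is taken to exist), so that $\hat x(t+1)=A\hat x(t)+Bu(t)+\mathcal K(t)(y(t)-C\hat x(t))$. The classical LQR gain, with sign convention $u=-H(t)x$, is $H(t)=(B'P(t+1)B+R)^{-1}B'P(t+1)A$, where $P(N)=S$ and $P(t)=Q+A'P(t+1)A-A'P(t+1)BH(t)$. *)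

(* Defs.v *)
From HB Require Import structures.
From mathcomp Require Import all_boot all_order all_algebra.
From mathcomp Require Import all_classical all_reals all_analysis.
Import Order.TTheory GRing.Theory Num.Theory.
Import numFieldNormedType.Exports.

Set Implicit Arguments.
Unset Strict Implicit.
Unset Printing Implicit Defensive.

Local Open Scope classical_set_scope.
Local Open Scope ring_scope.

Definition quad {R : realType} {k : nat} (Q : 'M[R]_k) (x : 'cV[R]_k) : R :=
  (x^T *m Q *m x) 0 0.

Definition posdef {R : realType} {k : nat} (Q : 'M[R]_k) : Prop :=
  Q^T = Q /\ forall x : 'cV[R]_k, x != 0 -> 0 < quad Q x.

(* sigma(X), the sigma-algebra generated by a set X of real functions. *)
Definition sigma_gen {R : realType} {U : Type} (X : set (U -> R)) :
    set (set U) :=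
  <<s [set E | exists2 g, X g & exists2 D, measurable D & E = g @^-1` D] >>.

Definition sigma_measurable {R : realType} {U : Type} (X : set (U -> R))
    (g : U -> R) : Prop :=
  forall D, measurable D -> sigma_gen X (g @^-1` D).

Definition coords {R : realType} {U : Type} {k : nat} (X : U -> 'cV[R]_k) :
    set (U -> R) :=
  [set g | exists i, g = fun w => X w i 0].

Section random_vectors.
Context {d : measure_display} {T : measurableType d} {R : realType}.
Variable P : probability T R.

(* The library's normal_prob m 0 is a uniform law, hence the case s = 0. *)
Definition gaussian_rv (X : T -> R) : Prop :=
  measurable_fun setT X /\
  exists m s : R, forall D, measurable D ->
    P (X @^-1` D) = if s == 0 then \d_m D else normal_prob m s D.

Definition gaussian_rvec {k : nat} (X : T -> 'cV[R]_k) : Prop :=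
  forall a : 'cV[R]_k, gaussian_rv (fun w => (a^T *m X w) 0 0).

Definition centered_gaussian {k : nat} (X : T -> 'cV[R]_k) (V : 'M[R]_k) :
    Prop :=
  [/\ gaussian_rvec X,
      forall i, ('E_P[fun w => X w i ord0] = 0)%E
    & forall i j,
        covariance P (fun w => X w i 0) (fun w => X w j 0) = (V i j)%:E].

Definition mutually_independent {I : finType} (F : I -> set (set T)) : Prop :=
  forall (J : {set I}) (E : I -> set T), (forall i, i \in J -> F i (E i)) ->
    P (\bigcap_(i in [set` J]) E i) = (\prod_(i in J) P (E i))%E.

Definition independent_noise (N : nat) {n p : nat} (x0 : T -> 'cV[R]_n)
    (v : nat -> T -> 'cV[R]_n) (w : nat -> T -> 'cV[R]_p) : Prop :=
  mutually_independent (fun i : option ('I_N + 'I_N) =>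
    match i with
    | None => sigma_gen (coords x0)
    | Some (inl t) => sigma_gen (coords (v t))
    | Some (inr t) => sigma_gen (coords (w t))
    end).

(* Y is a version of E[X | sigma(G)], for G a set of random variables. *)
Definition is_condexp (G : set (T -> R)) (X Y : T -> R) : Prop :=
  [/\ P.-integrable setT (EFin \o X), P.-integrable setT (EFin \o Y),
      sigma_measurable G Y
    & forall E, sigma_gen G E ->
        (\int[P]_(w in E) (Y w)%:E = \int[P]_(w in E) (X w)%:E)%E].

Definition error_cov {k : nat} (x xh : T -> 'cV[R]_k) : 'M[R]_k :=
  \matrix_(i, j) fine ('E_P[fun w =>
    ((x w - xh w) i 0 * (x w - xh w) j 0)%R])%E.

End random_vectors.

(* Trajectories (y, u) of the observations and of the inputs. *)
Definition signals (R : realType) (m p : nat) : Type :=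
  ((nat -> 'cV[R]_p) * (nat -> 'cV[R]_m))%type.

(* A law gives u(t) as a function of the whole trajectory; the information
   structure is imposed below by measurability with respect to the observed
   coordinates, which in particular makes u(t) depend on these only. *)
Definition law (R : realType) (m p : nat) : Type :=
  nat -> signals R m p -> 'cV[R]_m.

Section information.
Context {R : realType} {m1 m2 p1 p2 : nat}.
Let m := (m1 + m2)%N.
Let p := (p1 + p2)%N.

(* H(t) = {y(0:t-1), u(0:t-1)} *)
Definition info_common (t : nat) : set (signals R m p -> R) :=
  [set g | exists s (k : 'I_p), (s < t)%N /\ g = fun h : signals R m p => h.1 s k 0] `|`
  [set g | exists s (k : 'I_m), (s < t)%N /\ g = fun h : signals R m p => h.2 s k 0].

(* F_1(t) = H(t), y_1(t), y_2(t) *)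
Definition info1 (t : nat) : set (signals R m p -> R) :=
  info_common t `|` [set g | exists k : 'I_p, g = fun h : signals R m p => h.1 t k 0].

(* F_2(t) = H(t), y_2(t) *)
Definition info2 (t : nat) : set (signals R m p -> R) :=
  info_common t `|`
  [set g | exists k : 'I_p2, g = fun h : signals R m p => dsubmx (h.1 t) k 0].

Definition admissible (N : nat) (f : law R m p) : Prop :=
  forall t, (t < N)%N ->
    (forall k, sigma_measurable (info1 t) (fun h : signals R m p => usubmx (f t h) k 0)) /\
    (forall k, sigma_measurable (info2 t) (fun h : signals R m p => dsubmx (f t h) k 0)).

(* Laws for which both players may use F_1(t). *)
Definition centralized (N : nat) (f : law R m p) : Prop :=
  forall t, (t < N)%N -> forall k,
    sigma_measurable (info1 t) (fun h : signals R m p => f t h k 0).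

(* H(t) as random variables: the coordinates evaluated along (y, u). *)
Definition history {U : Type} (y : nat -> U -> 'cV[R]_p)
    (u : nat -> U -> 'cV[R]_m) (t : nat) : set (U -> R) :=
  [set g | exists2 c, info_common t c &
             g = fun w => c (fun s => y s w, fun s => u s w)].

End information.

Section control.
Context {d : measure_display} {T : measurableType d} {R : realType}.
Variable P : probability T R.
Context {n m1 m2 p1 p2 : nat}.
Let m := (m1 + m2)%N.
Let p := (p1 + p2)%N.
Variable N : nat.
Variables (A : 'M[R]_n) (B : 'M[R]_(n, m)) (C : 'M[R]_(p, n)).
Variables (Q S : 'M[R]_n) (Ru : 'M[R]_m).
Variables (x0 : T -> 'cV[R]_n) (v : nat -> T -> 'cV[R]_n)
          (w : nat -> T -> 'cV[R]_p).
Implicit Types (f g : law R m p).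
Implicit Types (x xh : nat -> T -> 'cV[R]_n) (y : nat -> T -> 'cV[R]_p)
               (u : nat -> T -> 'cV[R]_m).

Definition closed_loop f x y u : Prop :=
  (forall z, x 0%N z = x0 z) /\
  forall t, (t < N)%N -> forall z,
    [/\ y t z = C *m x t z + w t z,
        u t z = f t (fun s => y s z, fun s => u s z)
      & x t.+1 z = A *m x t z + B *m u t z + v t z].

Definition cost x u : \bar R :=
  ('E_P[fun z => (\sum_(t < N) (quad Q (x t z) + quad Ru (u t z))
                  + quad S (x N z))%R])%E.

Definition optimal f : Prop :=
  admissible N f /\
  forall g x y u x' y' u', admissible N g ->
    closed_loop f x y u -> closed_loop g x' y' u' ->
    (cost x u <= cost x' u')%E.

(* xh(t) = E[x(t) | H(t)] *)
Definition estimate x y u xh : Prop :=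
  forall t, (t < N)%N -> forall i,
    is_condexp P (history y u t) (fun z => x t z i 0) (fun z => xh t z i 0).

Definition gain_form (H : nat -> 'M[R]_(m, n)) (F : nat -> 'M[R]_(m, p))
    y u xh : Prop :=
  forall t, (t < N)%N ->
    {ae P, forall z, u t z = F t *m y t z - (F t *m C + H t) *m xh t z}.

(* The cost of the law u = F y - (F C + H) xh, as a function of the gains
   F(0), ..., F(N-1). The block F_21 is not constrained here. *)
Definition gain_cost (H : nat -> 'M[R]_(m, n)) (F : nat -> 'M[R]_(m, p)) : R :=
  fine (xget 0%E [set c | exists f x y u xh,
    [/\ centralized N f, closed_loop f x y u, estimate x y u xh,
        gain_form H F y u xh & c = cost x u]]).

(* The Lagrangian of: minimize gain_cost subject to F_21(t) = 0 for t < N.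
   The factor 2 is the normalization of the multiplier under which
   stationarity reads (R + B'M(t+1)B) F Sigma + B'M(t+1)K Sigma + Psi = 0,
   with Sigma = C T(t) C' + W. *)
Definition lagrangian (H : nat -> 'M[R]_(m, n)) (Psi21 : nat -> 'M[R]_(m2, p1))
    (F : nat -> 'M[R]_(m, p)) : R :=
  gain_cost H F + 2 * \sum_(t < N) \tr ((Psi21 t)^T *m dlsubmx (F t)).

Definition lagrange_multiplier (H : nat -> 'M[R]_(m, n))
    (F : nat -> 'M[R]_(m, p)) (Psi21 : nat -> 'M[R]_(m2, p1)) : Prop :=
  forall D : nat -> 'M[R]_(m, p),
    is_derive (0 : R) (1 : R)
      (fun s : R => lagrangian H Psi21 (fun t => F t + s *: D t) : R) (0 : R).

Definition lqr (Pm : nat -> 'M[R]_n) (H : nat -> 'M[R]_(m, n)) : Prop :=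
  Pm N = S /\
  forall t, (t < N)%N ->
    H t = invmx (B^T *m Pm t.+1 *m B + Ru) *m B^T *m Pm t.+1 *m A /\
    Pm t = Q + A^T *m Pm t.+1 *m A - A^T *m Pm t.+1 *m B *m H t.

End control.

Definition innovation_cov {R : realType} {n p : nat} (C : 'M[R]_(p, n))
    (W : 'M[R]_p) (Tt : 'M[R]_n) : 'M[R]_p := C *m Tt *m C^T + W.

Definition kalman_gain {R : realType} {n p : nat} (A : 'M[R]_n)
    (C : 'M[R]_(p, n)) (W : 'M[R]_p) (Tt : 'M[R]_n) : 'M[R]_(n, p) :=
  A *m Tt *m C^T *m invmx (innovation_cov C W Tt).

(* Main.v *)
(** Subtracting from the state the error of the Kalman filter, which is the same process for every law, leaves a process computable from the past signals. The filter error is uncorrelated with the past innovations, of which the whole history is a (possibly nonlinear) function, and is jointly Gaussian with them, so it integrates to 0 over every event of the history: what is left is the conditional expectation of the state. Under the gain form the prediction and the input are then linear in the innovations, and telescoping with M turns the cost into a constant plus the decoupled sum over t of tr (R F(t) Sigma(t) F(t)') + tr (M(t+1) (B F(t) + K(t)) Sigma(t) (B F(t) + K(t))'), where Sigma(t) is the covariance of the innovation. Every sequence of gains is realized by running the filter inside the law, so optimality makes the gradient of this sum vanish outside its 21 block, and the multiplier is minus that block. *)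

Require Import Defs.
From HB Require Import structures.
From mathcomp Require Import all_boot all_order all_algebra.
From mathcomp Require Import all_classical all_reals all_analysis.
From mathcomp Require Import measurable_realfun.
From mathcomp Require Import ring lra.
Import Order.TTheory GRing.Theory Num.Theory.
Import numFieldNormedType.Exports.

Set Implicit Arguments.
Unset Strict Implicit.
Unset Printing Implicit Defensive.

Local Open Scope classical_set_scope.
Local Open Scope ring_scope.

(** * Gaussian characteristic functions *)

(** The laws are arbitrary measurable functions, so the signals of a loop need be neither Gaussian
    nor integrable; only the filter error and the innovations, fixed linear images of the noises,
    are open to second-moment computations. The orthogonality of the error has to be carried from
    these linear variables to a whole generated sigma-algebra. Joint normality is therefore
    expressed by the expectation of [cos (g + th)] for every linear combination [g], the free phase
    [th] standing for the imaginary part of a characteristic function. It passes to events by a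
    one-dimensional Fourier inversion, adding one half-space at a time, and then by a pi-lambda
    argument. A second obstacle is that [gain_cost] picks a value among the costs of all loops in
    gain form: its formula requires a loop for each sequence of gains and also the almost sure
    agreement of all such loops. Optimality is compared only with realized gains whose 21 blocks
    vanish. Along any line of gains the cost is a polynomial of degree two, so stationarity and the
    multiplier condition are statements on its linear coefficient. *)

Section integration.
Context {d : measure_display} {T : measurableType d} {R : realType}.
Variable mu : {measure set T -> \bar R}.
Implicit Types f g h : T -> R.

Lemma le_integrableR f g : measurable_fun setT f ->
  (forall x, `|f x| <= g x) -> mu.-integrable setT (EFin \o g) ->
  mu.-integrable setT (EFin \o f).
Proof.
move=> mf fg ig; apply: (le_integrable _ _ _ ig) => //.
  exact/measurable_EFinP.
move=> x _ /=; rewrite lee_fin; apply: le_trans (fg x) _.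
exact: ler_norm.
Qed.

Lemma integrable_mulbdd f h (M : R) : mu.-integrable setT (EFin \o f) ->
  measurable_fun setT h -> (forall x, `|h x| <= M) ->
  mu.-integrable setT (EFin \o (fun x => f x * h x)).
Proof.
move=> intf mh hM.
apply: (@le_integrableR _ (fun x => `|M| * `|f x|)).
- apply: measurable_funM => //; apply/measurable_EFinP.
  exact: measurable_int intf.
- move=> x; rewrite normrM mulrC ler_wpM2r//.
  exact: le_trans (hM x) (ler_norm _).
- rewrite (_ : _ \o _ = (fun x => `|M|%:E * (EFin \o (Num.Def.normr \o f)) x)%E).
    apply: integrableZl => //; exact: (@integrable_norm _ _ _ mu setT).
  by apply/funext => x /=; rewrite EFinM.
Qed.

Lemma dominated_cvgR (f_ : nat -> T -> R) f g :
  (forall n, measurable_fun setT (f_ n)) ->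
  (forall x, f_ n x @[n --> \oo] --> f x) ->
  mu.-integrable setT (EFin \o g) -> (forall n x, `|f_ n x| <= g x) ->
  (\int[mu]_x f_ n x) @[n --> \oo] --> \int[mu]_x f x.
Proof.
move=> mf_ f_f ig fg.
have mf : measurable_fun setT f.
  by apply: (@measurable_fun_cvg _ _ _ setT f_) => // x _.
have gf x : `|f x| <= g x.
  have := f_f x => /(@cvg_norm _ R^o) h.
  apply: (cvgr_to_le h).
  by apply: nearW => n; exact: fg.
have intf := le_integrableR mf gf ig.
have h := @dominated_cvg _ _ _ mu setT measurableT (fun n x => (f_ n x)%:E)
  (EFin \o f) (EFin \o g) (fun n => proj2 (measurable_EFinP _ _) (mf_ n)) .
apply: fine_cvg; rewrite fineK ?integrable_fin_num//; apply: h => //.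
- by move=> x _; apply: cvg_EFin; [exact: nearW|exact: f_f].
- by move=> n x _; rewrite lee_fin; exact: fg.
Qed.

End integration.

Lemma is_derive_continuous {R : realType} (f : R -> R) (x a : R) :
  is_derive x (1:R) (f : R -> R^o) a -> {for x, continuous f}.
Proof.
by move=> [h _]; apply: differentiable_continuous; exact/derivable1_diffP.
Qed.

Section ftc_line.
Context {R : realType}.
Notation mu := (@lebesgue_measure R).

(** The integral over [[-n, n]] is [F n - F (- n)] and tends to 0, while dominated convergence by
    [|f|] removes the truncation. The lemma plays the part of integration by parts over the whole
    line. *)
Lemma integral_deriv_vanish (F f : R -> R) :
  (forall x : R, is_derive x (1:R) (F : R -> R^o) (f x)) -> continuous f ->
  mu.-integrable setT (EFin \o f) ->
  F n%:R @[n --> \oo] --> (0:R) -> F (- n%:R) @[n --> \oo] --> (0:R) ->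
  \int[mu]_x f x = 0.
Proof.
move=> dF cf intf F0 F1.
have dc : (\int[mu]_x (f x * \1_`[- n%:R, n%:R] x)) @[n --> \oo] --> \int[mu]_x f x.
  apply: (@dominated_cvgR _ _ _ mu _ _ (fun x => `|f x|)).
  - move=> n; apply: measurable_funM; last exact: measurable_indic.
    exact: continuous_measurable_fun.
  - move=> x; apply: cvg_near_cst.
    exists (Num.truncn `|x|).+1 => // n /= xn.
    rewrite indicE mem_set ?mulr1//= in_itv/= -ler_norml.
    apply: le_trans (ltW (truncnS_gt _)) _.
    by rewrite ler_nat.
  - exact: (@integrable_norm _ _ _ mu setT).
  - move=> n x; rewrite normrM ler_piMr// indicE.
    by case: (_ \in _); rewrite ?normr1 ?normr0.
have FF : (F n%:R - F (- n%:R)) @[n --> \oo] --> (0:R).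
  by rewrite -[X in _ --> X](subr0 0); exact: cvgB.
apply: (cvg_unique _ dc) => //.
apply: cvg_trans FF; apply: near_eq_cvg.
exists 1%N => // n /= n0.
have nn : - n%:R < n%:R :> R by rewrite gtrN// ltr0n.
have FC x : {for x, continuous F} by exact: is_derive_continuous (dF x).
rewrite (_ : (fun x => f x * \1_`[- n%:R, n%:R] x) = f \_ `[- n%:R, n%:R]); last first.
  by apply/funext => x; rewrite patchE indicE; case: (_ \in _); rewrite ?mulr1 ?mulr0.
rewrite -Rintegral_mkcond /Rintegral (@continuous_FTC2 _ _ F _ _ nn)//.
- exact: continuous_subspaceT.
- split.
  + by move=> x _.
  + apply: cvg_at_right_filter; exact: FC.
  + apply: cvg_at_left_filter; exact: FC.
- by move=> x _; rewrite derive1E derive_val.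
Qed.

End ftc_line.

Section normal_cf.
Context {R : realType}.
Notation mu := (@lebesgue_measure R).
Implicit Types m s b th x : R.

Lemma is_derive_normal_fun m s x : s != 0 ->
  is_derive x (1:R) (normal_fun m s : R -> R^o) (- (x - m) / s ^+ 2 * normal_fun m s x).
Proof.
move=> s0; pose q := fun x : R => - (x - m) ^+ 2 / (s ^+ 2 *+ 2).
have dq : is_derive x (1:R) (q : R -> R^o) (- (x - m) / s ^+ 2).
  rewrite /q; apply: is_derive_eq.
  by rewrite /GRing.scale /=; field.
rewrite mulrC.
exact: (is_derive1_comp (is_derive_expR (q x)) dq).
Qed.

Lemma integrable_normal_fun m s : s != 0 ->
  mu.-integrable setT (EFin \o normal_fun m s).
Proof.
move=> s0.
have pk := normal_peak_gt0 s0.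
rewrite (_ : _ \o _ = (fun x => (normal_peak s)^-1%:E * (normal_pdf m s x)%:E)%E).
  by apply: integrableZl => //; exact: integrable_normal_pdf.
apply/funext => x /=; rewrite normal_pdfE// -EFinM mulKf//.
exact: lt0r_neq0.
Qed.

(** Three quarters of the exponent are split off; what is left is the kernel of deviation [2 * s],
    still integrable. The split-off factor absorbs polynomial growth, for moments and for tails
    alike. *)
Lemma normal_fun_tail m s x : s != 0 ->
  normal_fun m s x = expR (- ((x - m) ^+ 2 * 3 / (8 * s ^+ 2))) * normal_fun m (2 * s) x.
Proof.
move=> s0; rewrite /normal_fun -expRD; congr expR.
by field.
Qed.

Lemma normal_fun_moment m s x : s != 0 ->
  `|x - m| * normal_fun m s x <= `|s| * normal_fun m (2 * s) x.
Proof.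
move=> s0; rewrite (normal_fun_tail _ _ s0) mulrA ler_wpM2r ?expR_ge0//.
rewrite expRN ler_pdivrMr ?expR_gt0//.
set t := _ / _.
apply: (@le_trans _ _ (`|s| * (1 + t))); last first.
  by rewrite ler_wpM2l// expR_ge1Dx.
have sp : 0 < `|s| by rewrite normr_gt0.
(* With [a = |x - m|] and [c = |s|], the bound [expR t >= 1 + t] leaves
   [8 c ^ 2 - 8 a c + 3 a ^ 2 >= 0], whose discriminant is negative. *)
rewrite /t -(real_normK (num_real (x - m))) -(real_normK (num_real s)).
move: `|x - m| `|s| sp => a c sp.
have -> : c * (1 + a ^+ 2 * 3 / (8 * c ^+ 2)) = (8 * c ^+ 2 + 3 * a ^+ 2) / (8 * c).
  by field; rewrite gt_eqF.
rewrite ler_pdivlMr ?mulr_gt0// -subr_ge0.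
have -> : 8 * c ^+ 2 + 3 * a ^+ 2 - a * (8 * c) = 3 * (a - 4 / 3 * c) ^+ 2 + 8 / 3 * c ^+ 2.
  by field.
by rewrite addr_ge0// mulr_ge0// sqr_ge0.
Qed.

Lemma integrable_normal_moment m s : s != 0 ->
  mu.-integrable setT (EFin \o (fun x => `|x - m| * normal_fun m s x)).
Proof.
move=> s0.
apply: (@le_integrableR _ _ _ mu _ (fun x => `|s| * normal_fun m (2 * s) x)).
- apply: measurable_funM; last exact: measurable_normal_fun.
  by apply: measurableT_comp => //; exact: measurable_funB.
- move=> x; rewrite ger0_norm; first exact: normal_fun_moment.
  by rewrite mulr_ge0// expR_ge0.
- rewrite (_ : _ \o _ = (fun x => `|s|%:E * (EFin \o normal_fun m (2 * s)) x)%E).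
    apply: integrableZl => //; apply: integrable_normal_fun.
    by rewrite mulf_neq0.
  by apply/funext => x /=; rewrite EFinM.
Qed.

Lemma cvg_normal_fun m s (u : nat -> R) : s != 0 ->
  (u n - m) ^+ 2 @[n --> \oo] --> +oo ->
  normal_fun m s (u n) @[n --> \oo] --> (0:R).
Proof.
move=> s0 uoo.
rewrite /normal_fun.
have h : ((u n - m) ^+ 2 / (s ^+ 2 *+ 2)) @[n --> \oo] --> +oo.
  apply: (cvg_comp _ (fun r => r * (s ^+ 2 *+ 2)^-1) uoo).
  apply: gt0_cvgMly; last exact: cvg_id.
  by rewrite invr_gt0 pmulrn_lgt0// exprn_even_gt0.
under eq_fun do rewrite mulNr.
exact: (cvg_comp (fun n => (u n - m) ^+ 2 / (s ^+ 2 *+ 2)) (fun x => expR (- x)) h (@cvgr_expR R)).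
Qed.

Lemma cvg_sqr_natD (c : R) : (n%:R + c) ^+ 2 @[n --> \oo] --> +oo.
Proof.
have h : (n%:R + c) @[n --> \oo] --> +oo.
  apply: (cvg_comp _ (fun x : R => x + c) cvgr_idn).
  exact: cvg_addrr.
exact: (cvg_comp _ (fun x : R => x ^+ 2) h cvgr_expr2).
Qed.

Let cospdf m s th b x := cos (b * (x - m) + th) * normal_fun m s x.

Let is_derive_lin m b th x :
  is_derive x (1:R) ((fun x => b * (x - m) + th) : R -> R^o) b.
Proof. by apply: is_derive_eq; rewrite /GRing.scale /=; ring. Qed.

Let is_derive_linb m x th b :
  is_derive b (1:R) ((fun b => b * (x - m) + th) : R -> R^o) (x - m).
Proof. by apply: is_derive_eq; rewrite /GRing.scale /=; ring. Qed.

Let is_derive_cospdf m s th x b :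
  is_derive b (1:R) ((fun b => cospdf m s th b x) : R -> R^o)
   (- (sin (b * (x - m) + th) * (x - m) * normal_fun m s x)).
Proof.
have h := @is_derive1_comp R cos (fun b => b * (x - m) + th) _ _ _ (is_derive_cos (b * (x - m) + th)) (is_derive_linb m x th b).
rewrite /cospdf (_ : (fun b => _) = (fun b => (cos \o (fun b => b * (x - m) + th)) b * (cst (normal_fun m s x) b))) //.
have h2 := is_derive_cst (normal_fun m s x : R^o) b (1:R).
apply: is_derive_eq (is_deriveM h h2) _.
by rewrite /GRing.scale /=; ring.
Qed.

Let continuous_normal_fun m s : s != 0 -> continuous (normal_fun m s).
Proof.
by move=> s0 x; exact: is_derive_continuous (is_derive_normal_fun m x s0).
Qed.

Let integrable_cospdf m s th b : s != 0 -> mu.-integrable setT (EFin \o cospdf m s th b).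
Proof.
move=> s0; apply: (@le_integrableR _ _ _ mu _ (normal_fun m s)).
- apply: measurable_funM; last exact: measurable_normal_fun.
  apply: measurableT_comp; first exact: (continuous_measurable_fun (@continuous_cos R)).
  apply: measurable_funD => //; apply: measurable_funM => //; exact: measurable_funB.
- move=> x; rewrite normrM (ger0_norm (expR_ge0 _)) ler_piMl ?expR_ge0//.
  exact: cos_max.
- exact: integrable_normal_fun.
Qed.

Let sinmom m s th b x := - (sin (b * (x - m) + th) * (x - m) * normal_fun m s x).

Let integrable_sinmom m s th b : s != 0 -> mu.-integrable setT (EFin \o sinmom m s th b).
Proof.
move=> s0; apply: (@le_integrableR _ _ _ mu _ (fun x => `|x - m| * normal_fun m s x)).
- rewrite /sinmom; apply: measurableT_comp => //.
  apply: measurable_funM; last exact: measurable_normal_fun.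
  apply: measurable_funM; last exact: measurable_funB.
  apply: measurableT_comp; first exact: (continuous_measurable_fun (@continuous_sin R)).
  apply: measurable_funD => //; apply: measurable_funM => //; exact: measurable_funB.
- move=> x; rewrite normrN !normrM (ger0_norm (expR_ge0 _)) ler_wpM2r ?expR_ge0//.
  by rewrite ler_piMl// sin_max.
- exact: integrable_normal_moment.
Qed.

Let cvg_sin_normal_fun m s th b (u : nat -> R) : s != 0 ->
  (u n - m) ^+ 2 @[n --> \oo] --> +oo ->
  (sin (b * (u n - m) + th) * normal_fun m s (u n)) @[n --> \oo] --> (0:R).
Proof.
move=> s0 /(cvg_normal_fun s0) h; apply: norm_cvg0.
apply: squeeze_cvgr; [|exact: (cvg_cst (0:R))|exact: h].
  apply: nearW => n; rewrite normr_ge0 /= normrM (ger0_norm (expR_ge0 _)).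
  by rewrite ler_piMl ?expR_ge0// sin_max.
Qed.

(** As a function of [b] the integral [g] satisfies [g' = - s ^ 2 b g]: differentiation under the
    integral brings down a factor [x - m], and the derivative of [sin (b (x - m) + th)] times the
    kernel, which integrates to 0 over the line, turns the result back into [g]. The phase [th]
    treats sine and cosine together. *)
Lemma normal_fun_cf m s th b : s != 0 ->
  \int[mu]_x (cos (b * (x - m) + th) * normal_fun m s x) =
  cos th * expR (- (s ^+ 2 * b ^+ 2 / 2)) * \int[mu]_x normal_fun m s x.
Proof.
move=> s0.
pose g b := \int[mu]_x cospdf m s th b x.
have dg b0 : is_derive b0 (1:R) (g : R -> R^o) (- (s ^+ 2 * b0 * g b0)).
  have p1 c x : partial1of2 (cospdf m s th) c x = - (sin (c * (x - m) + th) * (x - m) * normal_fun m s x).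
    by rewrite partial1of2E; have := is_derive_cospdf m s th x c => ?; rewrite derive_val.
  have uI : `]b0 - 1, b0 + 1[%classic b0 by rewrite /= in_itv/= gtrBl ltrDl ltr01.
  have G0 x : 0 <= `|x - m| * normal_fun m s x by rewrite mulr_ge0// expR_ge0.
  have c1 x : `]b0 - 1, b0 + 1[%classic x -> mu.-integrable setT (EFin \o cospdf m s th x).
    by move=> _; exact: integrable_cospdf.
  have c2 x y : `]b0 - 1, b0 + 1[%classic x -> setT y -> derivable ((cospdf m s th)^~ y) x 1.
    by move=> _ _; have [] := is_derive_cospdf m s th y x.
  have c3 x y : `]b0 - 1, b0 + 1[%classic x -> setT y ->
     `|partial1of2 (cospdf m s th) x y| <= `|y - m| * normal_fun m s y.
    move=> _ _; rewrite p1 normrN !normrM (ger0_norm (expR_ge0 _)) ler_wpM2r ?expR_ge0//.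
    by rewrite ler_piMl// sin_max.
  have mT := @measurableT _ (measurableTypeR R).
  have ig := integrable_normal_moment m s0.
  have h1 := derivable_under_integral mT uI c1 c2 G0 ig c3.
  have h2 := differentiation_under_integral mT uI c1 c2 G0 ig c3.
  apply: (DeriveDef h1); rewrite -derive1E h2.
  have -> : partial1of2 (cospdf m s th) b0 =
     sinmom m s th b0.
    by apply/funext => x; rewrite p1.
  have z : \int[mu]_x (b0 * cospdf m s th b0 x +
     s ^- 2 * sinmom m s th b0 x) = 0.
    have hF x : is_derive x (1:R) ((fun x => sin (b0 * (x - m) + th) * normal_fun m s x) : R -> R^o)
       (b0 * cospdf m s th b0 x +
     s ^- 2 * sinmom m s th b0 x).
      have k := @is_derive1_comp R sin (fun x => b0 * (x - m) + th) _ _ _ (is_derive_sin _) (is_derive_lin m b0 th x).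
      apply: is_derive_eq (is_deriveM k (is_derive_normal_fun m x s0)) _.
      by rewrite /GRing.scale /= /cospdf /sinmom; field.
    apply: (integral_deriv_vanish hF).
    - move=> x; rewrite /cospdf /sinmom.
      have k1 := is_derive_continuous (@is_derive1_comp R cos _ _ _ _ (is_derive_cos _) (is_derive_lin m b0 th x)).
      have k2 := is_derive_continuous (@is_derive1_comp R sin _ _ _ _ (is_derive_sin _) (is_derive_lin m b0 th x)).
      have k3 := @continuous_normal_fun m s s0 x.
      apply: cvgD; first by apply: cvgM; [exact: cvg_cst|exact: cvgM].
      apply: cvgM; [exact: cvg_cst|apply: cvgN; apply: cvgM; last exact: k3].
      by apply: cvgM => //; apply: cvgB; [exact: cvg_id|exact: cvg_cst].
    - have i1 := @integrableZl _ _ _ mu setT measurableT b0 _ (integrable_cospdf m th b0 s0).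
      have i2 := @integrableZl _ _ _ mu setT measurableT (s ^- 2) _ (integrable_sinmom m th b0 s0).
      exact: (@integrableD _ _ _ mu _ measurableT _ _ i1 i2).
    - apply: cvg_sin_normal_fun => //; exact: cvg_sqr_natD.
    - apply: cvg_sin_normal_fun => //.
      rewrite (_ : (fun n => _) = (fun n => (n%:R + m) ^+ 2)); first exact: cvg_sqr_natD.
      by apply/funext => n; rewrite -sqrrN; congr (_ ^+ 2); ring.
  have i1 := @integrableZl _ _ _ mu setT measurableT b0 _ (integrable_cospdf m th b0 s0).
  have i2 := @integrableZl _ _ _ mu setT measurableT (s ^- 2) _ (integrable_sinmom m th b0 s0).
  rewrite (RintegralD _ i1 i2)// !RintegralZl// in z; last 2 first.
  - exact: integrable_sinmom.
  - exact: integrable_cospdf.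
  move: z; rewrite -/(g b0) -/(sinmom m s th b0).
  set I := \int[_]_x _ => z.
  have -> : I = s ^+ 2 * (b0 * g b0 + s ^- 2 * I) - s ^+ 2 * b0 * g b0 by field.
  by rewrite z mulr0 sub0r.
(* Multiplied by the inverse of the expected Gaussian factor, [g] has zero derivative and equals its
   value at 0. *)
pose h b := g b * expR (s ^+ 2 * b ^+ 2 / 2).
have hc : h b = h 0.
  apply: is_derive_0_is_cst => y.
  have k1 : is_derive y (1:R) ((fun b => s ^+ 2 * b ^+ 2 / 2) : R -> R^o) (s ^+ 2 * y).
    by apply: is_derive_eq; rewrite /GRing.scale /=; field.
  have k2 := is_derive1_comp (is_derive_expR _) k1.
  by apply: is_derive_eq (is_deriveM (dg y) k2) _; rewrite /GRing.scale /=; ring.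
rewrite -/(cospdf m s th b) -/(g b).
have g0 : h 0 = cos th * \int[mu]_x normal_fun m s x.
  rewrite /h /g /cospdf expr0n /= mulr0 mul0r expR0 mulr1.
  under eq_Rintegral do rewrite mul0r add0r.
  by rewrite RintegralZl//; exact: integrable_normal_fun.
rewrite [RHS]mulrAC -g0 -hc /h -[RHS]mulrA -expRD subrr expR0 mulr1//.
Qed.

End normal_cf.

Section normal_prob_integral.
Context {R : realType}.
Notation mu := (@lebesgue_measure R).
Implicit Types m s b th x : R.

Lemma Rintegral_normal_pdf m s : \int[mu]_x normal_pdf m s x = 1.
Proof. by rewrite /Rintegral integral_normal_pdf. Qed.

Lemma normal_pdf_cf m s th b : s != 0 ->
  \int[mu]_x (cos (b * (x - m) + th) * normal_pdf m s x) =
  cos th * expR (- (s ^+ 2 * b ^+ 2 / 2)).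
Proof.
move=> s0.
have E f : mu.-integrable setT (EFin \o (fun x => f x * normal_fun m s x)) ->
    \int[mu]_x (f x * normal_pdf m s x) = normal_peak s * \int[mu]_x (f x * normal_fun m s x).
  move=> h; rewrite -RintegralZl//; apply: eq_Rintegral => x _.
  by rewrite normal_pdfE// mulrCA.
rewrite E; last first.
  apply: (@le_integrableR _ _ _ mu _ (normal_fun m s)).
  - apply: measurable_funM; last exact: measurable_normal_fun.
    apply: measurableT_comp; first exact: (continuous_measurable_fun (@continuous_cos R)).
    by apply: measurable_funD => //; apply: measurable_funM => //; exact: measurable_funB.
  - move=> x; rewrite normrM (ger0_norm (expR_ge0 _)) ler_piMl ?expR_ge0//.
    exact: cos_max.
  - exact: integrable_normal_fun.
rewrite normal_fun_cf// mulrCA.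
have := E (fun=> 1).
under eq_fun do rewrite mul1r.
move=> /(_ (integrable_normal_fun m s0)).
under eq_Rintegral do rewrite mul1r.
rewrite Rintegral_normal_pdf.
by move=> <-; rewrite mulr1.
Qed.

(** [normal_peak s] is twice [normal_peak (2 * s)], and the remaining factor [2 * expR (- t)] is at
    most [2 / t] with [t = 3 (x - m) ^ 2 / (8 s ^ 2)]; hence the constant [16 / 3]. Since the bound
    is again a multiple of a density, it integrates at once to a tail estimate. *)
Lemma normal_pdf_tail m s e x : s != 0 -> 0 < e -> e <= `|x - m| ->
  normal_pdf m s x <= (16 / 3 * (s / e) ^+ 2) * normal_pdf m (2 * s) x.
Proof.
move=> s0 e0 ex.
have s20 : 2 * s != 0 by rewrite mulf_neq0.
rewrite !normal_pdfE//.
have -> : normal_peak s = 2 * normal_peak (2 * s).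
  rewrite /normal_peak.
  have -> : (2 * s) ^+ 2 * pi *+ 2 = 2 ^+ 2 * (s ^+ 2 * pi *+ 2) by ring.
  by rewrite (@sqrtrM _ (2 ^+ 2)) ?sqr_ge0// sqrtr_sqr ger0_norm// invfM mulrA divff// mul1r.
rewrite (normal_fun_tail _ _ s0).
set t := _ * 3 / _; set p2 := normal_peak _; set n2 := normal_fun _ _ _.
rewrite (_ : 2 * p2 * (expR (- t) * n2) = 2 * expR (- t) * (p2 * n2)); last by ring.
rewrite ler_wpM2r//; first by rewrite mulr_ge0 ?expR_ge0// normal_peak_ge0.
have a0 : 0 < `|x - m| by exact: lt_le_trans ex.
have s2 : 0 < s ^+ 2 by rewrite exprn_even_gt0.
have x2 : 0 < (x - m) ^+ 2 by rewrite -real_normK ?num_real// exprn_gt0.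
have t0 : 0 < t by rewrite divr_gt0// mulr_gt0.
apply: (@le_trans _ _ (2 * t^-1)).
  rewrite ler_wpM2l// expRN lef_pV2 ?posrE ?expR_gt0//.
  by apply: le_trans (expR_ge1Dx _); rewrite lerDr.
have -> : 2 * t^-1 = 16 / 3 * (s ^+ 2 / (x - m) ^+ 2).
  by rewrite /t; field; rewrite -sqrf_eq0 gt_eqF//= -sqrf_eq0 gt_eqF.
rewrite ler_wpM2l// expr_div_n ler_wpM2l ?(ltW s2)// lef_pV2 ?posrE// ?exprn_gt0//.
by rewrite -(real_normK (num_real (x - m))) ler_sqr ?nnegrE// ltW.
Qed.

Lemma normal_prob_tail m s e (D : set R) : s != 0 -> 0 < e -> measurable D ->
  (forall x, D x -> e <= `|x - m|) ->
  fine (normal_prob m s D) <= 16 / 3 * (s / e) ^+ 2.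
Proof.
move=> s0 e0 mD De.
have s20 : 2 * s != 0 by rewrite mulf_neq0.
have mT := @measurableT _ (measurableTypeR R).
have i1 m' s' : mu.-integrable D (EFin \o normal_pdf m' s').
  by apply: (integrableS mT) => //; exact: integrable_normal_pdf.
have -> : fine (normal_prob m s D) = \int[mu]_(x in D) normal_pdf m s x by [].
apply: (@le_trans _ _ (\int[mu]_(x in D) (16 / 3 * (s / e) ^+ 2 * normal_pdf m (2 * s) x))).
  apply: le_Rintegral => //.
    exact: (@integrableZl _ _ _ mu D mD _ _ (i1 m (2 * s))).
  by move=> x Dx; apply: normal_pdf_tail => //; exact: De.
rewrite RintegralZl// ler_piMr//.
  by rewrite mulr_ge0// sqr_ge0.
have -> : \int[mu]_(x in D) normal_pdf m (2 * s) x = fine (normal_prob m (2 * s) D) by [].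
rewrite -lee_fin fineK ?probability_le1//.
by rewrite fin_num_measure.
Qed.

End normal_prob_integral.

(** * Orthogonality to a generated sigma-algebra *)

Section rfubini.
Context {d1 d2 : measure_display} {T1 : measurableType d1} {T2 : measurableType d2}.
Context {R : realType}.
Variables (m1 : {sigma_finite_measure set T1 -> \bar R}).
Variables (m2 : {sigma_finite_measure set T2 -> \bar R}).

Lemma Rintegral_swap (f : T1 * T2 -> R) (G : T1 -> R) :
  measurable_fun setT f ->
  (forall x, m2.-integrable setT (EFin \o (fun y => f (x, y)))) ->
  (forall y, m1.-integrable setT (EFin \o (fun x => f (x, y)))) ->
  m1.-integrable setT (EFin \o G) ->
  (forall x, \int[m2]_y `|f (x, y)| <= G x) ->
  m1.-integrable setT (EFin \o (fun x => \int[m2]_y f (x, y))) /\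
  \int[m1]_x (\int[m2]_y f (x, y)) = \int[m2]_y (\int[m1]_x f (x, y)).
Proof.
move=> mf i2 i1 iG fG.
have intf : (m1 \x m2)%E.-integrable setT (EFin \o f).
  apply/integrable12ltyP; first exact/measurable_EFinP.
  apply: (@le_lt_trans _ _ (\int[m1]_x `|(G x)%:E|)%E); last first.
    by have /integrableP[] := iG.
  apply: ge0_le_integral => //.
  - by move=> x _; apply: integral_ge0.
  - apply: (@measurable_fun_fubini_tonelli_F _ _ _ _ _ m2 (fun z => `|(f z)%:E|%E)) => //.
    by apply: measurableT_comp => //; exact/measurable_EFinP.
  - by apply: measurableT_comp => //; exact: measurable_int iG.
  - move=> x _.
    have h : m2.-integrable setT (EFin \o (fun y => `|f (x, y)|)).
      exact: (@integrable_norm _ _ _ m2 setT).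
    rewrite (_ : (\int[m2]_y _)%E = (\int[m2]_y `|f (x, y)|)%:E); last first.
      by rewrite /Rintegral fineK// ; exact: integrable_fin_num h.
    rewrite /= lee_fin; apply: le_trans (fG x) _; exact: ler_norm.
have e1 x : fubini_F m2 (EFin \o f) x = (\int[m2]_y f (x, y))%:E.
  by rewrite /fubini_F /Rintegral fineK//; exact: integrable_fin_num (i2 x).
have e2 y : (\int[m1]_x (f (x, y))%:E)%E = (\int[m1]_x f (x, y))%:E.
  by rewrite /Rintegral fineK//; exact: integrable_fin_num (i1 y).
split.
  rewrite (_ : _ \o _ = fubini_F m2 (EFin \o f)); last by apply/funext => x; rewrite e1.
  exact: integrable_fubini_F.
have := Fubini intf.
under eq_integral do rewrite -/(fubini_F m2 (EFin \o f) _) e1.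
under [X in _ = X -> _]eq_integral do rewrite e2.
by move=> h; congr fine.
Qed.

End rfubini.

Section fourier.
Context {d : measure_display} {T : measurableType d} {R : realType}.
Variable P : probability T R.
Notation mu := (@lebesgue_measure R).
Variables (Z X : T -> R).
Hypothesis iZ : P.-integrable setT (EFin \o Z).
Hypothesis mX : measurable_fun setT X.
Hypothesis ZX : forall b th, \int[P]_w (Z w * cos (b * X w + th)) = 0.

Let mZ : measurable_fun setT Z.
Proof. by apply/measurable_EFinP; exact: measurable_int iZ. Qed.

Let measurable_cosf d' (T' : measurableType d') (h : T' -> R) :
  measurable_fun setT h -> measurable_fun setT (fun x => cos (h x)).
Proof.
move=> mh; apply: measurableT_comp => //.
exact: (continuous_measurable_fun (@continuous_cos R)).
Qed.

(** The kernel of deviation [s] is the Fourier transform of the normal density of deviation [s^-1]: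
    the hypothesis at frequency [- y] and phase [y * c], integrated in [y] against that density,
    produces it. *)
Lemma integral_fourier0_gauss s c : s != 0 ->
  \int[P]_w (Z w * normal_fun (X w) s c) = 0.
Proof.
move=> s0.
have si0 : s^-1 != 0 by rewrite invr_eq0.
pose f (wy : T * R) := Z wy.1 * (cos (wy.2 * (c - X wy.1)) * normal_pdf 0 s^-1 wy.2).
have mpdf : measurable_fun setT (fun wy : T * R => normal_pdf 0 s^-1 wy.2).
  by apply: (measurableT_comp (measurable_normal_pdf 0 s^-1)); exact: measurable_snd.
have mT := @measurableT _ (measurableTypeR R).
have ipdf : mu.-integrable setT (EFin \o normal_pdf 0 s^-1) by exact: integrable_normal_pdf.
have icos x : mu.-integrable setT (EFin \o (fun y => cos (y * (c - X x)) * normal_pdf 0 s^-1 y)).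
  apply: (@le_integrableR _ _ _ mu _ (normal_pdf 0 s^-1)) => //.
  - apply: measurable_funM; last exact: measurable_normal_pdf.
    by apply: measurable_cosf; exact: measurable_funM.
  - by move=> y; rewrite normrM (ger0_norm (normal_pdf_ge0 _ _ _)) ler_piMl ?normal_pdf_ge0// cos_max.
have := @Rintegral_swap _ _ _ _ R P mu f (fun x => `|Z x|).
case.
- apply: measurable_funM; first exact: measurableT_comp mZ measurable_fst.
  apply: measurable_funM => //; apply: measurable_cosf; apply: measurable_funM => //.
  apply: measurable_funB => //; exact: measurableT_comp mX measurable_fst.
- move=> x; exact: (@integrableZl _ _ _ mu setT mT (Z x) _ (icos x)).
- move=> y; rewrite /f /=.
  apply: (@integrable_mulbdd _ _ _ P Z (fun x => cos (y * (c - X x)) * normal_pdf 0 s^-1 y) (normal_pdf 0 s^-1 y) iZ).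
  + apply: measurable_funM => //; apply: measurable_cosf; apply: measurable_funM => //.
    exact: measurable_funB.
  + move=> x; rewrite normrM (ger0_norm (normal_pdf_ge0 _ _ _)) ler_piMl ?normal_pdf_ge0//.
    exact: cos_max.
- exact: (@integrable_norm _ _ _ P setT).
- move=> x; rewrite -[leRHS]mulr1 -(Rintegral_normal_pdf 0 s^-1) -RintegralZl//.
  apply: le_Rintegral => //.
  + exact: (@integrable_norm _ _ _ mu setT _ (@integrableZl _ _ _ mu setT mT (Z x) _ (icos x))).
  + exact: (@integrableZl _ _ _ mu setT mT `|Z x| _ ipdf).
  + move=> y _; rewrite !normrM (ger0_norm (normal_pdf_ge0 _ _ _)) ler_wpM2l//.
    by rewrite ler_piMl ?normal_pdf_ge0// cos_max.
move=> _ E.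
transitivity (\int[P]_x \int[mu]_y f (x, y)).
  apply: eq_Rintegral => x _; rewrite /f /= RintegralZl//; congr (_ * _).
  have := normal_pdf_cf 0 0 (c - X x) si0.
  under eq_Rintegral do rewrite subr0 addr0 mulrC (mulrC (c - X x)) mulrC.
  move=> ->; rewrite cos0 mul1r /normal_fun; congr expR.
  by field.
rewrite E; transitivity (\int[mu]_(y in setT) (fun=> 0) y); last by rewrite Rintegral_cst// mul0r.
apply: eq_Rintegral => y _; rewrite /f /=.
have := ZX (- y) (y * c).
have -> : (fun w => Z w * cos (- y * X w + y * c)) = (fun w => Z w * cos (y * (c - X w))).
  by apply/funext => w; congr (_ * cos _); ring.
move=> h.
rewrite -[RHS](mul0r (normal_pdf 0 s^-1 y)) -h -RintegralZr//.
  by apply: eq_Rintegral => x _; rewrite mulrA.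
apply: (@integrable_mulbdd _ _ _ P _ _ 1) => //.
  apply: measurable_cosf; apply: measurable_funM => //; exact: measurable_funB.
by move=> x; exact: cos_max.
Qed.

Let normal_cdfE (Y : R) s a : s != 0 ->
  \int[mu]_y (\1_`]-oo, a] y * normal_pdf Y s y) = fine (normal_prob Y s `]-oo, a]).
Proof.
move=> s0; rewrite -[RHS]/(\int[mu]_(y in `]-oo, a]) normal_pdf Y s y) [RHS]Rintegral_mkcond.
apply: eq_Rintegral => y _; rewrite patchE indicE.
by case: (_ \in _); rewrite ?mul1r ?mul0r.
Qed.

Lemma integral_fourier0_normal_cdf s a : s != 0 ->
  P.-integrable setT (EFin \o (fun w => Z w * fine (normal_prob (X w) s `]-oo, a]))) /\
  \int[P]_w (Z w * fine (normal_prob (X w) s `]-oo, a])) = 0.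
Proof.
move=> s0.
pose f (wy : T * R) := Z wy.1 * (\1_`]-oo, a] wy.2 * normal_pdf (X wy.1) s wy.2).
have mT := @measurableT _ (measurableTypeR R).
have mpdf : measurable_fun setT (fun wy : T * R => normal_pdf (X wy.1) s wy.2).
  have mX1 := measurableT_comp mX (@measurable_fst _ _ T (measurableTypeR R)).
  rewrite /normal_pdf (negbTE s0); apply: measurable_funM => //.
  apply: measurableT_comp => //; apply: measurable_funM => //.
  apply: measurableT_comp => //; apply: measurable_funX.
  apply: measurable_funB => //; exact: measurable_snd.
have mind : measurable_fun setT (\1_`]-oo, a] : R -> R) by exact: measurable_indic.
have ind1 (y : R) : 0 <= (\1_`]-oo, a] y : R) <= 1.
  by rewrite indicE; case: (_ \in _); rewrite ?lexx ?ler01.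
have ipdf x : mu.-integrable setT (EFin \o normal_pdf (X x) s) by exact: integrable_normal_pdf.
have i1 x : mu.-integrable setT (EFin \o (fun y => \1_`]-oo, a] y * normal_pdf (X x) s y)).
  apply: (@le_integrableR _ _ _ mu _ (normal_pdf (X x) s)) => //.
  - apply: measurable_funM => //; exact: measurable_normal_pdf.
  - move=> y; have /andP[h0 h1] := ind1 y.
    by rewrite normrM (ger0_norm (normal_pdf_ge0 _ _ _)) ler_piMl ?normal_pdf_ge0// ger0_norm.
have := @Rintegral_swap _ _ _ _ R P mu f (fun x => `|Z x|).
case.
- apply: measurable_funM; first exact: measurableT_comp mZ measurable_fst.
  apply: measurable_funM => //; exact: measurableT_comp mind measurable_snd.
- move=> x; exact: (@integrableZl _ _ _ mu setT mT (Z x) _ (i1 x)).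
- move=> y.
  apply: (@integrable_mulbdd _ _ _ P Z (fun x => \1_`]-oo, a] y * normal_pdf (X x) s y) (normal_peak s) iZ).
  + apply: measurable_funM => //.
    exact: (measurableT_comp mpdf (measurable_pair2 y)).
  + move=> x; have /andP[h0 h1] := ind1 y.
    rewrite ger0_norm ?mulr_ge0 ?normal_pdf_ge0//.
    by apply: le_trans (normal_pdf_ub (X x) y s0); rewrite ler_piMl// normal_pdf_ge0.
- exact: (@integrable_norm _ _ _ P setT).
- move=> x; rewrite -[leRHS]mulr1 -(Rintegral_normal_pdf (X x) s) -RintegralZl//.
  apply: le_Rintegral => //.
  + exact: (@integrable_norm _ _ _ mu setT _ (@integrableZl _ _ _ mu setT mT (Z x) _ (i1 x))).
  + exact: (@integrableZl _ _ _ mu setT mT `|Z x| _ (ipdf x)).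
  + move=> y _; have /andP[h0 h1] := ind1 y.
    rewrite !normrM (ger0_norm (normal_pdf_ge0 _ _ _)) ler_wpM2l//.
    by rewrite ler_piMl ?normal_pdf_ge0// ger0_norm.
have E0 x : \int[mu]_y f (x, y) = Z x * fine (normal_prob (X x) s `]-oo, a]).
  by rewrite -normal_cdfE// -RintegralZl.
under eq_fun do rewrite E0.
move=> h ->; split => //.
transitivity (\int[mu]_(y in setT) (fun=> 0) y); last by rewrite Rintegral_cst// mul0r.
apply: eq_Rintegral => y _; rewrite /f /=.
have := integral_fourier0_gauss y s0 => h0.
transitivity (\int[P]_x ((\1_`]-oo, a] y * normal_peak s) * (Z x * normal_fun (X x) s y))).
  apply: eq_Rintegral => x _; rewrite normal_pdfE//; ring.
rewrite RintegralZl//; first by rewrite h0 mulr0.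
apply: (@integrable_mulbdd _ _ _ P _ _ 1) => //.
- have := measurableT_comp mpdf (measurable_pair2 y).
  move=> /(measurable_funM (@measurable_cst _ _ _ _ setT (normal_peak s)^-1)).
  apply: eq_measurable_fun => x _ /=; rewrite normal_pdfE// mulKf//.
  by rewrite gt_eqF// normal_peak_gt0.
- move=> x; rewrite ger0_norm ?expR_ge0// -[leRHS]expR0 ler_expR.
  by rewrite mulNr oppr_le0 divr_ge0// ?mulrn_wge0// sqr_ge0.
Qed.

(** Width of the kernel and shift of the ray: [sn n = en n ^ 2] is negligible compared with [en n].
    The shift serves the endpoint [x = a], where an unshifted ray would keep mass one half; the tail
    bound at distance [en n] is of order [(sn n / en n) ^ 2 = en n ^ 2]. *)
Let sn (n : nat) : R := n.+1%:R^-1 ^+ 2.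
Let en (n : nat) : R := n.+1%:R^-1.

Lemma cvg_normal_cdf a x :
  fine (normal_prob x (sn n) `]-oo, a + en n]) @[n --> \oo] --> (\1_`]-oo, a] x : R).
Proof.
have sn0 n : sn n != 0 by rewrite /sn expf_neq0// invr_eq0 pnatr_eq0.
have en0 n : 0 < en n by rewrite /en invr_gt0.
have en_0 : en n @[n --> \oo] --> (0:R) by exact: cvg_harmonic.
have sqr0 (c : R) : c * en n ^+ 2 @[n --> \oo] --> (0:R).
  rewrite -[X in _ --> X](mulr0 c); apply: cvgM; first exact: cvg_cst.
  by rewrite -[X in _ --> X](mulr0 0); apply: cvgM.
rewrite indicE; have [xa|xa] := leP x a.
  rewrite mem_set/=; last by rewrite in_itv.
  have h n : 1 - 16 / 3 * en n ^+ 2 <= fine (normal_prob x (sn n) `]-oo, a + en n]) <= 1.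
    have -> : fine (normal_prob x (sn n) `]-oo, a + en n]) =
        1 - fine (normal_prob x (sn n) (~` `]-oo, a + en n])).
      have mD : measurable (`]-oo, a + en n]%classic : set R) by [].
      have := probability_setC (normal_prob x (sn n)) mD => ->.
      have fE (q : \bar R) : q \is a fin_num -> fine q = 1 - fine (1 - q)%E.
        by case: q => //= r _; rewrite subKr.
      by apply: fE; exact: fin_num_measure.
    rewrite gerBl fine_ge0// andbT lerD2l lerN2.
    rewrite [X in X ^+ 2](_ : en n = sn n / en n); last by rewrite /sn expr2 mulfK// gt_eqF.
    apply: normal_prob_tail => //.
    - exact: measurableC.
    - move=> y /=; rewrite in_itv/= => /negP; rewrite -ltNge => y1.
      by apply: le_trans (ler_norm _); rewrite lerBrDr (le_trans _ (ltW y1))// addrC lerD2r.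
  apply: squeeze_cvgr; [exact: nearW h| |exact: cvg_cst].
  by rewrite -[X in _ --> X]subr0; apply: cvgB; [exact: cvg_cst|exact: sqr0].
rewrite memNset/=; last by rewrite in_itv/= leNgt xa.
(* Once [en n] is below half the gap between [a] and [x], the shifted ray stays at least half the
   gap away from [x]. *)
have e0 : 0 < (x - a) / 2 by rewrite divr_gt0 // subr_gt0.
have h : \forall n \near \oo, 0 <= fine (normal_prob x (sn n) `]-oo, a + en n])
   <= 16 / 3 * (((x - a) / 2)^-1) ^+ 2 * en n ^+ 2.
  have /cvgr0_norm_lt/(_ _ e0) := en_0; apply: filterS => n.
  rewrite gtr0_norm// => en1; rewrite fine_ge0//=.
  apply: (@le_trans _ _ (16 / 3 * (sn n / ((x - a) / 2)) ^+ 2)).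
    apply: normal_prob_tail => //.
    by move=> y /=; rewrite in_itv/= => y1; rewrite distrC ger0_norm; lra.
  set r := ((x - a) / 2)^-1.
  rewrite (_ : 16 / 3 * (sn n * r) ^+ 2 = 16 / 3 * r ^+ 2 * sn n ^+ 2); last by ring.
  apply: ler_wpM2l; first by rewrite mulr_ge0// sqr_ge0.
  rewrite /sn -/(en n) -exprM [leRHS]expr2 exprSr exprSr expr2.
  have en1' : en n <= 1 by rewrite /en invf_le1// ler1n.
  have en2 : 0 <= en n by exact: ltW.
  have : en n * en n <= 1 by rewrite mulr_ile1.
  by move=> ?; rewrite -mulrA ler_piMl// mulr_ge0.
apply: squeeze_cvgr; [exact: h|exact: cvg_cst|exact: sqr0].
Qed.

(* Averaging the hypothesis over [b] with a Gaussian weight replaces the cosine by a Gaussian kernel, and integrating the kernel over a ray gives the indicator in the limit of a small deviation. *)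
Lemma integral_fourier0_le a : \int[P]_w (Z w * \1_`]-oo, a] (X w)) = 0.
Proof.
have sn0 n : sn n != 0 by rewrite /sn expf_neq0// invr_eq0 pnatr_eq0.
have : (\int[P]_w (Z w * fine (normal_prob (X w) (sn n) `]-oo, a + en n]))) @[n --> \oo]
    --> \int[P]_w (Z w * \1_`]-oo, a] (X w)).
  apply: (@dominated_cvgR _ _ _ P _ _ (fun w => `|Z w|)).
  - move=> n; apply/measurable_EFinP.
    exact: measurable_int (integral_fourier0_normal_cdf _ (sn0 n)).1.
  - by move=> w; apply: cvgM; [exact: cvg_cst|exact: cvg_normal_cdf].
  - exact: (@integrable_norm _ _ _ P setT).
  - move=> n w; rewrite normrM ler_piMr// ger0_norm.
      by rewrite -lee_fin fineK ?probability_le1// fin_num_measure.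
    by rewrite fine_ge0.
under eq_fun do rewrite (integral_fourier0_normal_cdf _ (sn0 _)).2.
by move=> h; exact: (cvg_unique (@Rhausdorff R) h (cvg_cst (0:R))).
Qed.

End fourier.

Section sigma_rays.
Context {R : realType} {T : Type}.

Lemma sigma_algebra_rays (F : set (set T)) (g : T -> R) :
  sigma_algebra setT F -> (forall a, F [set w | g w <= a]) ->
  forall D, measurable D -> F (g @^-1` D).
Proof.
move=> sF Fg D mD.
have [F0 FC FU] := sF.
have h : <<s @RGenOInfty.G R >> `<=` image_set_system setT g F.
  apply: smallest_sub; first exact: sigma_algebra_image.
  move=> _ [x ->]; rewrite /image_set_system /= setTI.
  rewrite (_ : g @^-1` _ = setT `\` [set w | g w <= x]); first exact: FC.
  apply/seteqP; split=> w /=; rewrite in_itv/= andbT.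
    by move=> xw; split=> //; apply/negP; rewrite -ltNge.
  by move=> [_ /negP]; rewrite -ltNge.
have := h D; rewrite /image_set_system /= setTI; apply.
have := @RGenOInfty.measurableE R => E; move: mD; rewrite /measurable /= => mD.
suff : (@RGenOInfty.G R).-sigma.-measurable D by [].
by rewrite -E.
Qed.

End sigma_rays.

Section orthogonality.
Context {d : measure_display} {T : measurableType d} {R : realType}.
Variable P : probability T R.
Implicit Types (Z : T -> R) (E : set T).

Lemma Rintegral_indic_eq0 Z E : P.-integrable setT (EFin \o Z) -> measurable E ->
  (\int[P]_(w in E) (Z w)%:E = 0)%E <-> \int[P]_w (Z w * \1_E w) = 0.
Proof.
move=> iZ mE.
have iE : P.-integrable E (EFin \o Z) by exact: (integrableS measurableT).
have -> : \int[P]_w (Z w * \1_E w) = \int[P]_(w in E) Z w.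
  rewrite [RHS]Rintegral_mkcond; apply: eq_Rintegral => w _.
  by rewrite patchE indicE; case: (_ \in _); rewrite ?mulr1 ?mulr0.
split=> h; first by rewrite /Rintegral h.
rewrite -[LHS]fineK; last exact: integrable_fin_num iE.
by move: h; rewrite /Rintegral => ->.
Qed.

Variables (Z : T -> R) (G : set (T -> R)).
Hypothesis iZ : P.-integrable setT (EFin \o Z).
Hypothesis mG : forall g, G g -> measurable_fun setT g.
Hypothesis G0 : G (fun=> 0).
Hypothesis GD : forall g h b, G g -> G h -> G (fun w => g w + b * h w).
Hypothesis ZG : forall g th, G g -> \int[P]_w (Z w * cos (g w + th)) = 0.

Let mZ : measurable_fun setT Z.
Proof. by apply/measurable_EFinP; exact: measurable_int iZ. Qed.

(** Finite intersections of half-spaces cut out by members of [G]. Concatenation of lists makes them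
    a pi-system, and recursion on the list adds one half-space at a time. *)
Let orthant (l : seq ((T -> R) * R)) : set T :=
  foldr (fun ga S => [set w | ga.1 w <= ga.2] `&` S) setT l.

Let valid (l : seq ((T -> R) * R)) : Prop :=
  foldr (fun ga Q => G ga.1 /\ Q) True l.

Let ray_preimage (g : T -> R) a : [set w | g w <= a] = g @^-1` `]-oo, a].
Proof. by apply/seteqP; split=> w; rewrite /= in_itv. Qed.

Let measurable_orthant l : valid l -> measurable (orthant l).
Proof.
elim: l => [_|[g a] l IH /= [Gg vl]] /=; first exact: measurableT.
apply: measurableI; last exact: IH.
by rewrite ray_preimage -[X in measurable X]setTI; exact: mG.
Qed.

Let measurable_cosf (h : T -> R) :
  measurable_fun setT h -> measurable_fun setT (fun x => cos (h x)).
Proof.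
move=> mh; apply: measurableT_comp => //.
exact: (continuous_measurable_fun (@continuous_cos R)).
Qed.

Let integrable_orth l g th : valid l -> G g ->
  P.-integrable setT (EFin \o (fun w => Z w * (\1_(orthant l) w * cos (g w + th)))).
Proof.
move=> vl Gg; apply: (@integrable_mulbdd _ _ _ P _ _ 1) => //.
  apply: measurable_funM; first exact: measurable_indic (measurable_orthant vl).
  by apply: measurable_cosf; apply: measurable_funD => //; exact: mG.
move=> w; rewrite normrM mulr_ile1// ?cos_max// indicE.
by case: (_ \in _); rewrite ?normr1 ?normr0.
Qed.

(* The rays are added one at a time by [integral_fourier0_le], whose hypothesis is kept up by the product-to-sum formula for cosines. *)
Let orthant_cos l g th : valid l -> G g ->
  \int[P]_w (Z w * (\1_(orthant l) w * cos (g w + th))) = 0.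
Proof.
elim: l g th => [|[h a] l IH] g th.
  move=> _ Gg; under eq_Rintegral do rewrite /= indicT mul1r.
  exact: ZG.
move=> /= [Gh vl] Gg.
transitivity (\int[P]_w ((Z w * (\1_(orthant l) w * cos (g w + th))) * \1_`]-oo, a] (h w))).
  apply: eq_Rintegral => w _; rewrite indicI /=.
  have -> : \1_[set w | h w <= a] w = (\1_`]-oo, a] (h w) : R).
    by rewrite !indicE; congr (_%:R); congr nat_of_bool; apply/idP/idP; rewrite !inE /= in_itv.
  ring.
apply: integral_fourier0_le => //.
- exact: integrable_orth.
- exact: mG.
move=> b th'.
transitivity (\int[P]_w (2^-1 * (Z w * (\1_(orthant l) w * cos ((g w + b * h w) + (th + th')))) +
    2^-1 * (Z w * (\1_(orthant l) w * cos ((g w + - b * h w) + (th - th')))))).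
  apply: eq_Rintegral => w _.
  have -> : g w + b * h w + (th + th') = (g w + th) + (b * h w + th') by ring.
  have -> : g w + - b * h w + (th - th') = (g w + th) - (b * h w + th') by ring.
  by rewrite (cosD (g w + th)) (cosB (g w + th)); field.
have i1 := integrable_orth (th + th') vl (GD b Gg Gh).
have i2 := integrable_orth (th - th') vl (GD (- b) Gg Gh).
rewrite RintegralD//.
- rewrite !RintegralZl// !IH ?mulr0 ?addr0//; exact: GD.
- exact: (@integrableZl _ _ _ P setT measurableT _ _ i1).
- exact: (@integrableZl _ _ _ P setT measurableT _ _ i2).
Qed.

(** The events over which [Z] integrates to 0 form a Dynkin system containing the orthants, and the
    orthants generate [sigma_gen G]. Measurability is proved in the same argument, the complement
    and union steps relying on it. *)
Lemma orthogonal_sigma_gen E : sigma_gen G E ->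
  measurable E /\ (\int[P]_(w in E) (Z w)%:E = 0)%E.
Proof.
pose S := [set E | exists2 l, valid l & E = orthant l].
pose H := [set E | measurable E /\ (\int[P]_(w in E) (Z w)%:E = 0)%E].
have SI : setI_closed S.
  move=> _ _ [l1 v1 ->] [l2 v2 ->]; exists (l1 ++ l2).
    by elim: l1 v1 => //= ga l IH [Gg v]; split=> //; exact: IH.
  by elim: l1 {v1} => /= [|ga l IH]; [rewrite setTI|rewrite -setIA IH].
have SH : S `<=` H.
  move=> _ [l vl ->]; split; first exact: measurable_orthant.
  apply/Rintegral_indic_eq0 => //; first exact: measurable_orthant.
  (* The member 0 of [G] with phase 0 turns the cosine into 1. *)
  rewrite -[RHS](@orthant_cos l _ 0 vl G0); apply: eq_Rintegral => w _.
  by rewrite addr0 cos0 mulr1.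
have dH : dynkin H.
  split.
  - by apply: SH; exists nil.
  - move=> A [mA A0]; split; first exact: measurableC.
    have mC := measurableC mA.
    apply/Rintegral_indic_eq0 => //.
    have [_ zT] : H setT by apply: SH; exists nil.
    have iA : P.-integrable setT (EFin \o (fun w => Z w * \1_A w)).
      apply: (@integrable_mulbdd _ _ _ P _ _ 1) => //.
      by move=> w; rewrite indicE; case: (_ \in _); rewrite ?normr1 ?normr0.
    transitivity (\int[P]_w (Z w - Z w * \1_A w)).
      by apply: eq_Rintegral => w _; rewrite !indicE in_setC; case: (w \in A); rewrite /= ?mulr0 ?mulr1 ?subrr ?subr0.
    rewrite RintegralB//; have /(Rintegral_indic_eq0 iZ mA) -> := A0.
    by rewrite /Rintegral zT subr0.
  - move=> F tF FH.
    have mF k : measurable (F k) by have [] := FH k.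
    split; first exact: bigcup_measurable.
    rewrite integral_bigcup//; last first.
      by apply: (integrableS measurableT) => //; exact: bigcup_measurable.
    by rewrite eseries0// => k _ _; have [] := FH k.
have GS : sigma_gen G `<=` <<s S >>.
  apply: smallest_sub; first exact: smallest_sigma_algebra.
  move=> _ [g Gg [D mD ->]]; apply: sigma_algebra_rays => //.
  move=> a; apply: sub_sigma_algebra; exists [:: (g, a)] => //=.
  by rewrite setIT.
move=> /GS; apply: (@lambda_system_subset T S SI setT H) => //.
exact/dynkin_lambda_system.
Qed.

End orthogonality.

(** * Laws and characteristic functions of Gaussian variables *)

Lemma eq_indic {R : realType} {T1 T2 : Type} (A : set T1) (B : set T2) x y :
  (A x <-> B y) -> \1_A x = \1_B y :> R.
Proof.
move=> AB; rewrite !indicE; have [Ax|Ax] := pselect (A x).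
  by rewrite !mem_set//; apply/AB.
by rewrite !memNset// => /AB.
Qed.

Section layer_cake.
Context {d : measure_display} {T : measurableType d} {R : realType}.
Notation mu := (@lebesgue_measure R).

Lemma integrable_cos_mul (m : {measure set T -> \bar R}) (Z X : T -> R) b th :
  m.-integrable setT (EFin \o Z) -> measurable_fun setT X ->
  m.-integrable setT (EFin \o (fun w => Z w * cos (b * X w + th))).
Proof.
move=> iZ mX; apply: (@integrable_mulbdd _ _ _ m _ _ 1) => //.
  apply: measurableT_comp; first exact: (continuous_measurable_fun (@continuous_cos R)).
  by apply: measurable_funD => //; exact: measurable_funM.
by move=> w; exact: cos_max.
Qed.

(* [cos u + 1] is the length of the interval [[0, cos u + 1[]. *)
Lemma integral_layer_cake (m : {sigma_finite_measure set T -> \bar R}) (Z X : T -> R) b th :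
  m.-integrable setT (EFin \o Z) -> measurable_fun setT X ->
  \int[m]_w (Z w * cos (b * X w + th)) =
  \int[mu]_t (\int[m]_w (Z w * \1_[set x | 0 <= t < cos (b * x + th) + 1] (X w)))
   - \int[m]_w Z w.
Proof.
move=> iZ mX.
pose h w := cos (b * X w + th) + 1.
have h02 w : 0 <= h w <= 2.
  have := cos_le1 (b * X w + th); have := cos_geN1 (b * X w + th).
  by rewrite /h => ? ?; apply/andP; split; lra.
have mh : measurable_fun setT h.
  apply: measurable_funD => //.
  apply: measurableT_comp; first exact: (continuous_measurable_fun (@continuous_cos R)).
  by apply: measurable_funD => //; exact: measurable_funM.
have mZ : measurable_fun setT Z by apply/measurable_EFinP; exact: measurable_int iZ.
pose S := [set p : T * R | 0 <= p.2 < h p.1].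
have mT := @measurableT _ (measurableTypeR R).
have mS : measurable S.
  have : measurable_fun setT (fun p : T * R => (0 <= p.2) && (p.2 < h p.1)).
    apply: measurable_and.
      by apply: measurable_fun_ler => //; exact: measurable_snd.
    apply: measurable_fun_ltr; first exact: measurable_snd.
    exact: measurableT_comp mh measurable_fst.
  move=> /(_ measurableT [set true] I); rewrite setTI.
  by congr measurable; apply/seteqP; split=> p.
pose f (p : T * R) := Z p.1 * \1_S p.
have Sx w : (fun t => \1_S (w, t) : R) = \1_`[0, h w[.
  by apply/funext => t; apply: eq_indic; rewrite /S /= in_itv.
have fin_h w : (mu `[0%R, h w[%classic = (h w)%:E)%E.
  rewrite lebesgue_measure_itv/= lte_fin; have /andP[h0 _] := h02 w.
  case: ltP => hw; first by rewrite -EFinB subr0.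
  by congr EFin; apply/eqP; rewrite eq_le h0 hw.
have ind_int w : mu.-integrable setT (EFin \o (\1_`[0%R, h w[ : R -> R)).
  apply/integrableP; split; first by apply/measurable_EFinP; exact: measurable_indic.
  under eq_integral do rewrite /= ger0_norm//.
  rewrite integral_indic// setIT.
  by apply: le_lt_trans (ltry (h w)); rewrite -fin_h.
have E1 w : \int[mu]_t \1_`[0%R, h w[ t = h w.
  rewrite /Rintegral integral_indic// setIT.
  by rewrite -[RHS]/(fine (h w)%:E) -fin_h.
have := @Rintegral_swap _ _ _ _ R m mu f (fun w => 2 * `|Z w|).
case.
- apply: measurable_funM; first exact: measurableT_comp mZ measurable_fst.
  exact: measurable_indic.
- move=> w; rewrite /f /=.
  have -> : (fun y => Z w * \1_S (w, y)) = (fun y => Z w * \1_`[0%R, h w[ y).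
    by apply/funext => y; have /(congr1 (fun F => F y)) /= -> := Sx w.
  exact: (@integrableZl _ _ _ mu setT mT (Z w) _ (ind_int w)).
- move=> t; apply: (@integrable_mulbdd _ _ _ m _ _ 1) => //=.
    have := measurableT_comp (measurable_indic mS : measurable_fun setT (\1_S : T * R -> R)) (measurable_pair2 t).
    exact.
  by move=> w; rewrite indicE; case: (_ \in _); rewrite ?normr1 ?normr0.
- exact: (@integrableZl _ _ _ m setT measurableT 2 _ (@integrable_norm _ _ _ m setT _ iZ)).
- move=> w; apply: (@le_trans _ _ (`|Z w| * h w)); last by rewrite mulrC ler_wpM2r//; have /andP[] := h02 w.
  rewrite -E1 -RintegralZl//.
  have -> : (fun y => `|f (w, y)|) = (fun y => `|Z w| * \1_`[0%R, h w[ y).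
    apply/funext => y; rewrite /f /= normrM.
    have /(congr1 (fun F => F y)) /= -> := Sx w.
    by congr (_ * _); rewrite indicE; case: (_ \in _); rewrite ?normr1 ?normr0.
  exact: lexx.
move=> _ E.
have -> : (fun t => \int[m]_w (Z w * \1_[set x | 0 <= t < cos (b * x + th) + 1] (X w))) =
    (fun t => \int[m]_w f (w, t)).
  apply/funext => t; apply: eq_Rintegral => w _; rewrite /f /=.
  by rewrite (@eq_indic R _ _ _ S (X w) (w, t)).
rewrite -E.
have -> : \int[m]_w \int[mu]_t f (w, t) = \int[m]_w (Z w * cos (b * X w + th) + Z w).
  apply: eq_Rintegral => w _; rewrite /f /=.
  have -> : (fun y => Z w * \1_S (w, y)) = (fun y => Z w * \1_`[0%R, h w[ y).
    by apply/funext => y; have /(congr1 (fun F => F y)) /= -> := Sx w.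
  by rewrite RintegralZl// E1 /h mulrDr mulr1.
by rewrite RintegralD ?addrK//; exact: integrable_cos_mul.
Qed.

End layer_cake.

(** Equality on Borel sets passes to cosines through the layer cake formula, whose level sets are
    Borel; the subtracted totals are the case [D = setT]. With signed weights and two unrelated
    measures, the lemma serves both as a change of variables to a density and as a factorization
    rule for independent variables. *)
Lemma eq_integral_cos {R : realType} d1 d2 {T1 : measurableType d1} {T2 : measurableType d2}
  (m1 : {sigma_finite_measure set T1 -> \bar R}) (m2 : {sigma_finite_measure set T2 -> \bar R})
  (Z1 X1 : T1 -> R) (Z2 X2 : T2 -> R) b th :
  m1.-integrable setT (EFin \o Z1) -> measurable_fun setT X1 ->
  m2.-integrable setT (EFin \o Z2) -> measurable_fun setT X2 ->
  (forall D : set R, measurable D ->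
    \int[m1]_w (Z1 w * \1_D (X1 w)) = \int[m2]_w (Z2 w * \1_D (X2 w))) ->
  \int[m1]_w (Z1 w * cos (b * X1 w + th)) = \int[m2]_w (Z2 w * cos (b * X2 w + th)).
Proof.
move=> i1 mX1 i2 mX2 E; rewrite !integral_layer_cake//; congr (_ - _).
  apply: eq_Rintegral => t _; apply: E.
  have : measurable_fun setT (fun x : R => (0 <= t) && (t < cos (b * x + th) + 1)).
    apply: measurable_and; first exact: measurable_cst.
    apply: measurable_fun_ltr => //; apply: measurable_funD => //.
    apply: measurableT_comp; first exact: (continuous_measurable_fun (@continuous_cos R)).
    by apply: measurable_funD => //; exact: measurable_funM.
  move=> /(_ measurableT [set true] I); rewrite setTI.
  by congr measurable; apply/seteqP; split=> p.
have := E setT measurableT.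
by under eq_Rintegral do rewrite indicT mulr1; under [in X in _ = X -> _]eq_Rintegral do rewrite indicT mulr1.
Qed.

Section moments.
Context {d : measure_display} {T : measurableType d} {R : realType}.
Variable P : probability T R.
Notation mu := (@lebesgue_measure R).
Implicit Types (X : T -> R).

Lemma Rintegral_indic_comp X (D : set R) : measurable_fun setT X -> measurable D ->
  \int[P]_w (1 * \1_D (X w)) = fine (P (X @^-1` D)).
Proof.
move=> mX mD; rewrite /Rintegral.
under eq_integral do rewrite mul1r.
have mXD : measurable (X @^-1` D) by rewrite -[X in measurable X]setTI; exact: mX.
by rewrite -(setIT (X @^-1` D)) -integral_indic.
Qed.

Lemma integrable_cstP (c : R) : P.-integrable setT (EFin \o (fun=> c)).
Proof. exact: finite_measure_integrable_cst. Qed.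

Lemma Rintegral_cstP (c : R) : \int[P]_w c = c.
Proof.
have := Rintegral_cst P measurableT c => ->.
by rewrite -[RHS]mulr1; congr (_ * _); exact: (congr1 fine (probability_setT P)).
Qed.

Lemma gaussian_rv_cf X : gaussian_rv P X -> exists m q : R, forall b th,
  \int[P]_w cos (b * X w + th) = cos (b * m + th) * expR (- (q * b ^+ 2 / 2)).
Proof.
move=> [mX [m [s XP]]]; exists m, (s ^+ 2) => b th.
have i1 := integrable_cstP 1.
transitivity (\int[P]_w (1 * cos (b * X w + th))).
  by apply: eq_Rintegral => w _; rewrite mul1r.
have [s0|s0] := eqVneq s 0.
  (* Zero deviation: [X] is compared with the constant [m] on the same space. *)
  rewrite (@eq_integral_cos R _ _ _ _ P P (fun=> 1) X (fun=> 1) (fun=> m)) //.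
    rewrite Rintegral_cstP mul1r s0.
    by rewrite expr0n/= !mul0r oppr0 expR0 mulr1.
  move=> D mD; rewrite !Rintegral_indic_comp// XP// s0 eqxx.
  rewrite diracE; have [Dm|Dm] := pselect (D m).
    rewrite mem_set// (_ : _ @^-1` _ = setT) ?probability_setT//.
    by apply/seteqP; split.
  rewrite memNset// (_ : _ @^-1` _ = set0) ?measure0//.
  by apply/seteqP; split.
(* Nonzero deviation: [X] under [P] is compared with the identity under Lebesgue measure weighted by
   the density. *)
rewrite (@eq_integral_cos R _ _ _ _ P mu (fun=> 1) X (normal_pdf m s) (fun x => x)) //.
- transitivity (\int[mu]_x (cos (b * (x - m) + (b * m + th)) * normal_pdf m s x)).
    by apply: eq_Rintegral => x _; rewrite mulrC; congr (cos _ * _); ring.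
  by rewrite normal_pdf_cf.
- exact: integrable_normal_pdf.
- move=> D mD; rewrite Rintegral_indic_comp// XP// (negbTE s0).
  rewrite -[LHS]/(\int[mu]_(y in D) normal_pdf m s y) Rintegral_mkcond.
  apply: eq_Rintegral => y _; rewrite patchE indicE.
  by case: (_ \in _); rewrite ?mulr1 ?mulr0.
Qed.

Lemma cvg_derive_seq (f : R -> R) a (u : nat -> R) :
  is_derive (0:R) (1:R) (f : R -> R^o) a -> (forall n, u n != 0) -> u n @[n --> \oo] --> (0:R) ->
  ((u n)^-1 * (f (u n) - f 0)) @[n --> \oo] --> a.
Proof.
move=> [df fa] u0 uc.
have : (fun h : R => h^-1 *: ((f : R -> R^o) (h *: (1:R) + 0) - f 0)) @ 0^' --> a.
  by rewrite -fa; exact: df.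
move=> /cvgr_dnbhsP /(_ u (conj u0 uc)).
by under eq_fun do rewrite addr0 scaler1.
Qed.

Lemma norm_sin_le (t : R) : `|sin t| <= `|t|.
Proof.
wlog t0 : t / 0 <= t.
  move=> h; have [/h//|t0] := leP 0 t.
  by rewrite -normrN -sinN -(normrN t) h// oppr_ge0 ltW.
have [c _] : exists2 c, c \in `[0, t] & sin t - sin 0 = cos c * (t - 0).
  apply: (@MVT_segment R sin cos) => //.
  by apply: continuous_subspaceT; exact: continuous_sin.
by rewrite sin0 !subr0 => ->; rewrite normrM ler_piMl// cos_max.
Qed.

Let vn (n : nat) : R := n.+1%:R^-1.
Let vn0 n : vn n != 0. Proof. by rewrite invr_eq0 pnatr_eq0. Qed.
Let cvg_vn : vn n @[n --> \oo] --> (0:R). Proof. exact: cvg_harmonic. Qed.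

(** As [v] tends to 0, [sin (v X) / v] tends to [X] and stays dominated by [|X|], while its
    expectation is given by the characteristic function: moments are extracted in this way. *)
Lemma cvg_sinv x : ((vn n)^-1 * sin (vn n * x)) @[n --> \oo] --> x.
Proof.
have h : is_derive (0:R) (1:R) ((fun b : R => sin (b * x)) : R -> R^o) x.
  have k : is_derive (0:R) (1:R) ((fun b : R => b * x) : R -> R^o) x.
    by apply: is_derive_eq; rewrite /GRing.scale /=; ring.
  apply: is_derive_eq (@is_derive1_comp R sin _ _ _ _ (is_derive_sin _) k) _.
  by rewrite mul0r cos0 mul1r.
have := cvg_derive_seq h vn0 cvg_vn.
by under eq_fun do rewrite mul0r sin0 subr0.
Qed.

Lemma measurable_sinv X n : measurable_fun setT X ->
  measurable_fun setT (fun w => (vn n)^-1 * sin (vn n * X w)).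
Proof.
move=> mX; apply: measurable_funM => //.
apply: measurableT_comp; first exact: (continuous_measurable_fun (@continuous_sin R)).
exact: measurable_funM.
Qed.

Lemma norm_sinv n x : `|(vn n)^-1 * sin (vn n * x)| <= `|x|.
Proof.
rewrite normrM normfV ler_pdivrMl ?normr_gt0// -normrM; exact: norm_sin_le.
Qed.

Lemma mean_of_cf X m q : P.-integrable setT (EFin \o X) ->
  (forall b th, \int[P]_w cos (b * X w + th) = cos (b * m + th) * expR (- (q * b ^+ 2 / 2))) ->
  \int[P]_w X w = m.
Proof.
move=> iX cf.
have mX : measurable_fun setT X by apply/measurable_EFinP; exact: measurable_int iX.
have h1 : (\int[P]_w ((vn n)^-1 * sin (vn n * X w))) @[n --> \oo] --> \int[P]_w X w.
  apply: (@dominated_cvgR _ _ _ P _ _ (fun w => `|X w|)) => //.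
  - by move=> n; exact: measurable_sinv.
  - by move=> w; exact: cvg_sinv.
  - exact: (@integrable_norm _ _ _ P setT).
  - by move=> n w; exact: norm_sinv.
pose f := fun b : R => sin (b * m) * expR (- (q * b ^+ 2 / 2)).
have h2 : (\int[P]_w ((vn n)^-1 * sin (vn n * X w))) @[n --> \oo] --> m.
  have df : is_derive (0:R) (1:R) (f : R -> R^o) m.
    have k : is_derive (0:R) (1:R) ((fun b : R => b * m) : R -> R^o) m.
      by apply: is_derive_eq; rewrite /GRing.scale /=; ring.
    have k1 := @is_derive1_comp R sin _ _ _ _ (is_derive_sin _) k.
    have k2 : is_derive (0:R) (1:R) ((fun b : R => - (q * b ^+ 2 / 2)) : R -> R^o) 0.
      by apply: is_derive_eq; rewrite /GRing.scale /=; ring.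
    have k3 := @is_derive1_comp R expR _ _ _ _ (is_derive_expR _) k2.
    apply: is_derive_eq (is_deriveM k1 k3) _.
    by rewrite /GRing.scale /= expr0n /= !(mulr0, mul0r, oppr0) expR0 cos0 !(mul1r, add0r).
  have := cvg_derive_seq df vn0 cvg_vn.
  rewrite {2}/f mul0r sin0 mul0r.
  have E n : \int[P]_w ((vn n)^-1 * sin (vn n * X w)) = (vn n)^-1 * (f (vn n) - 0).
    rewrite RintegralZl//; last first.
      apply: (@le_integrableR _ _ _ P _ (fun=> 1)); last exact: integrable_cstP.
        apply: measurableT_comp; first exact: (continuous_measurable_fun (@continuous_sin R)).
        exact: measurable_funM.
      by move=> w; exact: sin_max.
    rewrite subr0 /f; congr (_ * _).
    (* A phase of [- pi / 2] turns the cosine of the hypothesis into a sine. *)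
    have := cf (vn n) (- (pi / 2)); rewrite cosBpihalf => <-.
    by apply: eq_Rintegral => w _; rewrite cosBpihalf.
  by under [X in _ -> X @ _ --> _]eq_fun do rewrite E.
exact: (cvg_unique (@Rhausdorff R) h1 h2).
Qed.

Lemma variance_of_cf X q : measurable_fun setT X -> P.-integrable setT (EFin \o (fun w => X w ^+ 2)) ->
  (forall b th, \int[P]_w cos (b * X w + th) = cos th * expR (- (q * b ^+ 2 / 2))) ->
  \int[P]_w (X w ^+ 2) = q.
Proof.
move=> mX iX cf.
have h1 : (\int[P]_w (((vn n)^-1 * sin (vn n * X w)) ^+ 2)) @[n --> \oo] --> \int[P]_w (X w ^+ 2).
  apply: (@dominated_cvgR _ _ _ P _ _ (fun w => X w ^+ 2)) => //.
  - by move=> n; apply: measurable_funX; exact: measurable_sinv.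
  - by move=> w; rewrite expr2; under eq_fun do rewrite expr2; apply: cvgM; exact: cvg_sinv.
  - move=> n w; rewrite normrX -[leRHS]real_normK ?num_real// ler_sqr ?nnegrE//; exact: norm_sinv.
(* Since [sin z ^ 2 = (1 - cos (2 z)) / 2], the expectation is [- 1 / 2] times the difference
   quotient of [f] at 0, taken along [t = vn n ^ 2]. *)
pose f := fun t : R => expR (- 2 * q * t).
have h2 : (\int[P]_w (((vn n)^-1 * sin (vn n * X w)) ^+ 2)) @[n --> \oo] --> q.
  have df : is_derive (0:R) (1:R) (f : R -> R^o) (- 2 * q).
    have k2 : is_derive (0:R) (1:R) ((fun t : R => - 2 * q * t) : R -> R^o) (- 2 * q).
      by apply: is_derive_eq; rewrite /GRing.scale /=; ring.
    apply: is_derive_eq (@is_derive1_comp R expR _ _ _ _ (is_derive_expR _) k2) _.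
    by rewrite mulr0 expR0 mul1r.
  have v20 n : vn n ^+ 2 != 0 by rewrite expf_neq0.
  have v2c : vn n ^+ 2 @[n --> \oo] --> (0:R).
    by rewrite -[X in _ --> X](mulr0 (0:R)); apply: cvgM.
  have := cvg_derive_seq df v20 v2c.
  rewrite {2}/f mulr0 expR0 => h.
  have E n : \int[P]_w (((vn n)^-1 * sin (vn n * X w)) ^+ 2) =
      - 2^-1 * ((vn n ^+ 2)^-1 * (f (vn n ^+ 2) - 1)).
    transitivity (\int[P]_w ((vn n ^+ 2)^-1 / 2 * (1 - cos ((2 * vn n) * X w + 0)))).
      apply: eq_Rintegral => w _.
      have -> : 2 * vn n * X w + 0 = (vn n * X w) *+ 2 by rewrite mulr2n; ring.
      by rewrite cos_mulr2n exprMn exprVn sin2cos2 mulr2n; field.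
    have ic : P.-integrable setT (EFin \o (fun w => cos ((2 * vn n) * X w + 0))).
      have := integrable_cos_mul (2 * vn n) 0 (integrable_cstP 1) mX.
      by under [X in EFin \o X]eq_fun do rewrite mul1r.
    rewrite RintegralZl//; last by exact: (@integrableB _ _ _ P setT measurableT _ _ (integrable_cstP 1) ic).
    rewrite RintegralB//; last exact: (integrable_cstP 1).
    rewrite Rintegral_cstP cf cos0 /f /=.
    have -> : - (q * (2 * vn n) ^+ 2 / 2) = - 2 * q * vn n ^+ 2 by field.
    field; exact: vn0.
  under eq_fun do rewrite E.
  rewrite (_ : q = - 2^-1 * (- 2 * q)); last by field.
  by apply: cvgM; [exact: cvg_cst|exact: h].
exact: (cvg_unique (@Rhausdorff R) h1 h2).
Qed.

(* The conclusion, for all [b] at once, is the working form of "centered Gaussian with variance [q]". *)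
Lemma centered_gaussian_rv_cf X : gaussian_rv P X ->
  P.-integrable setT (EFin \o (fun w => X w ^+ 2)) ->
  P.-integrable setT (EFin \o X) -> \int[P]_w X w = 0 ->
  forall b th, \int[P]_w cos (b * X w + th) =
    cos th * expR (- ((\int[P]_w (X w ^+ 2)) * b ^+ 2 / 2)).
Proof.
move=> gX iX2 iX EX.
have [m [r cf]] := gaussian_rv_cf gX.
have m0 : m = 0 by rewrite -EX -(mean_of_cf iX cf).
have cf0 b th : \int[P]_w cos (b * X w + th) = cos th * expR (- (r * b ^+ 2 / 2)).
  by rewrite cf m0 mulr0 add0r.
by move=> b th; rewrite (variance_of_cf gX.1 iX2 cf0) cf0.
Qed.

End moments.

Section independent_sum.
Context {d : measure_display} {T : measurableType d} {R : realType}.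
Variable P : probability T R.
Variables (I : finType) (F : I -> set (set T)).
Hypothesis mF : forall i E, F i E -> measurable E.
Hypothesis indF : mutually_independent P F.
Variables (L : I -> T -> R) (q : I -> R).
Hypothesis mL : forall i, measurable_fun setT (L i).
Hypothesis FL : forall i D, measurable D -> F i (L i @^-1` D).
Hypothesis cfL : forall i b th,
  \int[P]_w cos (b * L i w + th) = cos th * expR (- (q i * b ^+ 2 / 2)).

Let cap (J : {set I}) (E : I -> set T) := \bigcap_(i in [set` J]) E i.

Let measurable_cap (J : {set I}) E : (forall i, i \in J -> F i (E i)) -> measurable (cap J E).
Proof.
move=> FE; rewrite -[X in measurable X]setCK setC_bigcap.
apply: measurableC; apply: fin_bigcup_measurable; first exact: finite_finset.
by move=> i /= iJ; apply: measurableC; apply: mF; exact: FE.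
Qed.

Let capU1 (J : {set I}) E k (B : set T) : k \notin J ->
  cap (k |: J) (fun i => if i == k then B else E i) = B `&` cap J E.
Proof.
move=> kJ; apply/seteqP; split=> w.
  move=> h; split; first by have := h k; rewrite /= !inE eqxx => /(_ isT).
  move=> i /= iJ; have := h i; rewrite /= !inE iJ orbT => /(_ isT).
  by case: eqP => // ik; rewrite ik (negbTE kJ) in iJ.
move=> [Bw Ew] i /=; rewrite !inE; case: eqP => //= _ iJ; exact: Ew.
Qed.

Let indic_le1 (A : set T) w : `|\1_A w : R| <= 1.
Proof. by rewrite indicE; case: (_ \in _); rewrite ?normr1 ?normr0. Qed.

Let mS (ks : seq I) th : measurable_fun setT (fun w => cos (\sum_(i <- ks) L i w + th)).
Proof.
apply: measurableT_comp; first exact: (continuous_measurable_fun (@continuous_cos R)).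
by apply: measurable_funD => //; exact: measurable_sum.
Qed.

(** The statement mixes events indexed by [J] with a cosine of the other summands, so that the
    induction can move an index [k] from [ks] to [J]: the induction hypothesis at [k |: J] factors
    out the events that [L k] lies in a Borel set, and [eq_integral_cos] upgrades these events to
    cosines of [L k]. *)
Let partial_cf (ks : seq I) (J : {set I}) E th :
  (forall i, i \in J -> F i (E i)) -> uniq ks -> (forall i, i \in ks -> i \notin J) ->
  \int[P]_w (\1_(cap J E) w * cos (\sum_(i <- ks) L i w + th)) =
  (\prod_(i in J) fine (P (E i))) * (cos th * expR (- ((\sum_(i <- ks) q i) / 2))).
Proof.
elim: ks J E th => [|k ks IH] J E th FE.
  move=> _ _; under eq_Rintegral do rewrite big_nil add0r.
  have mJ := measurable_cap FE.
  have i1 : P.-integrable setT (EFin \o (\1_(cap J E) : T -> R)).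
    apply: (@le_integrableR _ _ _ P _ (fun=> 1)) => //; exact: integrable_cstP.
  rewrite RintegralZr// big_nil mul0r oppr0 expR0 mulr1; congr (_ * _).
  have h := indF FE; rewrite -/(cap J E) in h.
  transitivity (fine (P (cap J E))); first by rewrite /Rintegral integral_indic// setIT.
  rewrite h.
  have E0 i : i \in J -> P (E i) = (fine (P (E i)))%:E.
    by move=> iJ; rewrite fineK// fin_num_measure//; apply: mF; exact: FE.
  by rewrite (eq_bigr _ E0) prodEFin.
move=> /= /andP[kks uks] ksJ.
have kJ : k \notin J by apply: ksJ; rewrite inE eqxx.
have ksJ' i : i \in ks -> i \notin J by move=> ik; apply: ksJ; rewrite inE ik orbT.
pose c th := (\prod_(i in J) fine (P (E i))) * (cos th * expR (- ((\sum_(i <- ks) q i) / 2))).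
have mJ := measurable_cap FE.
pose Y th w := \1_(cap J E) w * cos (\sum_(i <- ks) L i w + th).
have iY th0 : P.-integrable setT (EFin \o Y th0).
  apply: (@le_integrableR _ _ _ P _ (fun=> 1)) => //; last exact: integrable_cstP.
    by apply: measurable_funM.
  by move=> w; rewrite normrM mulr_ile1// cos_max.
have iYc th0 : P.-integrable setT (EFin \o (fun w => Y th0 w - c th0)).
  exact: (@integrableB _ _ _ P setT measurableT _ _ (iY th0) (integrable_cstP P (c th0))).
have step th0 th1 : \int[P]_w (Y th0 w * cos (1 * L k w + th1)) =
    c th0 * (cos th1 * expR (- (q k / 2))).
  (* Subtracting the expected constant [c th0] reduces the factorization to a comparison with the
     weight 0. *)
  have := @eq_integral_cos R _ _ _ _ P P (fun w => Y th0 w - c th0) (L k) (fun=> 0) (L k)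
    1 th1 (iYc th0) (mL k) (integrable_cstP P 0) (mL k).
  have -> : \int[P]_w (0 * cos (1 * L k w + th1)) = 0.
    by under eq_Rintegral do rewrite mul0r; exact: Rintegral_cstP.
  have -> : \int[P]_w ((Y th0 w - c th0) * cos (1 * L k w + th1)) =
      \int[P]_w (Y th0 w * cos (1 * L k w + th1)) - c th0 * (cos th1 * expR (- (q k / 2))).
    have ic := integrable_cos_mul 1 th1 (integrable_cstP P 1) (mL k).
    under eq_Rintegral do rewrite mulrBl.
    rewrite RintegralB//; last 2 first.
    - exact: integrable_cos_mul.
    - exact: integrable_cos_mul (integrable_cstP P _) (mL k).
    congr (_ - _).
    have -> : (fun w => c th0 * cos (1 * L k w + th1)) = (fun w => c th0 * (1 * cos (1 * L k w + th1))).
      by apply/funext => w; rewrite (mul1r (cos _)).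
    rewrite RintegralZl//; congr (_ * _).
    by under eq_Rintegral do rewrite (mul1r (cos _)); rewrite cfL expr1n mulr1.
  move=> h; apply/eqP; rewrite -subr_eq0; apply/eqP; apply: h => D mD.
  under [RHS]eq_Rintegral do rewrite mul0r; rewrite Rintegral_cstP.
  under eq_Rintegral do rewrite mulrBl.
  rewrite RintegralB//; last 2 first.
  - apply: (@integrable_mulbdd _ _ _ P _ _ 1) => //.
      exact: measurableT_comp (measurable_indic mD) (mL k).
    by move=> w; rewrite indicE; case: (_ \in _); rewrite ?normr1 ?normr0.
  - apply: (@integrable_mulbdd _ _ _ P _ _ 1) => //; first exact: integrable_cstP.
      exact: measurableT_comp (measurable_indic mD) (mL k).
    by move=> w; rewrite indicE; case: (_ \in _); rewrite ?normr1 ?normr0.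
  pose E' i := if i == k then L k @^-1` D else E i.
  have FE' i : i \in k |: J -> F i (E' i).
    rewrite !inE /E'; case: eqP => [-> _|_ /= iJ]; [exact: FL|exact: FE].
  have ksJ2 i : i \in ks -> i \notin k |: J.
    move=> ik; rewrite !inE negb_or ksJ'// andbT.
    by apply: contraNneq kks => <-.
  have := IH (k |: J) E' th0 FE' uks ksJ2.
  rewrite capU1// big_setU1//= {1}/E' eqxx.
  have -> : \prod_(i in J) fine (P (E' i)) = \prod_(i in J) fine (P (E i)).
    apply: eq_bigr => i iJ; rewrite /E'; case: eqP => // ik.
    by rewrite -ik iJ in kJ.
  move=> h2; apply/eqP; rewrite subr_eq0; apply/eqP.
  transitivity (\int[P]_w (\1_(L k @^-1` D `&` cap J E) w * cos (\sum_(i <- ks) L i w + th0))).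
    by apply: eq_Rintegral => w _; rewrite indicI /Y /= (@eq_indic R _ _ _ (L k @^-1` D) (L k w) w)//; ring.
  rewrite h2 -mulrA -/(c th0) mulrC.
  have -> : (fun w => c th0 * \1_D (L k w)) = (fun w => c th0 * (1 * \1_D (L k w))).
    by apply/funext => w; rewrite mul1r.
  rewrite RintegralZl//; last first.
    apply: (@integrable_mulbdd _ _ _ P _ _ 1) => //; first exact: integrable_cstP.
      exact: measurableT_comp (measurable_indic mD) (mL k).
    by move=> w; rewrite indicE; case: (_ \in _); rewrite ?normr1 ?normr0.
  by rewrite Rintegral_indic_comp.
(* Addition formula for the cosine, with both sines written as cosines of phase shifted by
   [- pi / 2]; the second product has expectation 0 because [cos (pi / 2) = 0]. *)
transitivity (\int[P]_w (Y th w * cos (1 * L k w + 0) - Y (th - pi / 2) w * cos (1 * L k w + - (pi / 2)))).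
  apply: eq_Rintegral => w _; rewrite big_cons /Y.
  have -> : L k w + \sum_(j <- ks) L j w + th = L k w + (\sum_(j <- ks) L j w + th) by ring.
  rewrite (cosD (L k w)) addrA !cosBpihalf mul1r addr0.
  ring.
rewrite RintegralB//; last 2 first.
- exact: integrable_cos_mul.
- exact: integrable_cos_mul.
rewrite !step cos0 cosN cos_pihalf mul0r mulr0 subr0 mul1r /c.
rewrite big_cons mulrDl opprD expRD.
ring.
Qed.

Lemma independent_sum_cf th : \int[P]_w cos (\sum_i L i w + th) =
  cos th * expR (- ((\sum_i q i) / 2)).
Proof.
have := @partial_cf (index_enum I) finset.set0 (fun=> setT) th.
rewrite big_set0 mul1r => <-.
- apply: eq_Rintegral => w _.
  by rewrite indicE mem_set ?mul1r//= => i /=; rewrite inE.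
- by move=> i; rewrite inE.
- exact: index_enum_uniq.
- by move=> i; rewrite inE.
Qed.

End independent_sum.

(** * Gaussian spaces *)

Section sub_sigma_algebra.
Context {R : realType} {U : Type}.
Variable F : set (set U).
Hypothesis sF : sigma_algebra setT F.

(** Measurability for a sigma-algebra given as a bare set system: several sigma-algebras on the same
    type are compared, so none is attached to the type. *)
Definition adapted (g : U -> R) := forall D, measurable D -> F (g @^-1` D).

Lemma adapted_comp2 (k : R * R -> R) (g h : U -> R) : measurable_fun setT k ->
  adapted g -> adapted h -> adapted (fun w => k (g w, h w)).
Proof.
move=> mk Fg Fh D mD.
have [F0 FC FU] := sF.
pose gh w := (g w, h w).
have FT : F setT by rewrite -(setD0 setT); exact: FC.
have FI A B : F A -> F B -> F (A `&` B).
  move=> FA FB.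
  (* Binary intersection out of complements and one countable union, the operations that
     [sigma_algebra] provides. *)
  have -> : A `&` B = setT `\` (\bigcup_n (if n == 0%N then setT `\` A else setT `\` B)).
    apply/seteqP; split=> w /=.
      by move=> [Aw Bw]; split => // -[[|n] _ /=] [].
    move=> [_ h0]; split; apply: contrapT => nA; apply: h0.
      by exists 0%N.
    by exists 1%N.
  by apply: (FC); apply: FU => -[|n] /=; apply: (FC).
have h1 : <<s [set A `*` B | A in (measurable : set (set R)) & B in (measurable : set (set R))] >>
    `<=` image_set_system setT gh F.
  apply: smallest_sub; first exact: sigma_algebra_image.
  move=> _ [A mA [B mB <-]]; rewrite /image_set_system /= setTI.
  by apply: FI; [exact: Fg|exact: Fh].
have mkD : measurable (k @^-1` D) by rewrite -[X in measurable X]setTI; exact: mk.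
have := h1 (k @^-1` D); rewrite /image_set_system /= setTI; apply.
by rewrite -measurable_prod_measurableType.
Qed.

Lemma adaptedD g h : adapted g -> adapted h -> adapted (fun w => g w + h w).
Proof.
apply: (@adapted_comp2 (fun p => p.1 + p.2)).
by apply: measurable_funD; [exact: measurable_fst|exact: measurable_snd].
Qed.

Lemma adapted_cst c : adapted (fun=> c).
Proof.
move=> D mD; have [F0 FC FU] := sF; have [Dc|Dc] := pselect (D c).
  rewrite (_ : _ @^-1` _ = setT `\` set0); first exact: FC.
  by apply/seteqP; split=> //= w _; split.
rewrite (_ : _ @^-1` _ = set0)//.
by apply/seteqP; split.
Qed.

Lemma adaptedZ c g : adapted g -> adapted (fun w => c * g w).
Proof.
by move=> Fg; apply: (@adapted_comp2 (fun p => p.1 * p.2)) (adapted_cst c) Fg;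
  apply: measurable_funM; [exact: measurable_fst|exact: measurable_snd].
Qed.

End sub_sigma_algebra.

Lemma sigma_gen_sub {R : realType} {U : Type} (X : set (U -> R)) (F : set (set U)) :
  sigma_algebra setT F -> (forall g, X g -> adapted F g) -> sigma_gen X `<=` F.
Proof.
move=> sF XF; apply: smallest_sub => // _ [g Xg [D mD ->]]; exact: XF.
Qed.

Lemma sigma_algebra_sigma_gen {R : realType} {U : Type} (X : set (U -> R)) :
  sigma_algebra setT (sigma_gen X).
Proof. exact: smallest_sigma_algebra. Qed.

Lemma adapted_sigma_gen {R : realType} {U : Type} (X : set (U -> R)) g :
  X g -> adapted (sigma_gen X) g.
Proof. by move=> Xg D mD; apply: sub_sigma_algebra; exists g => //; exists D. Qed.

Section square_integrable.
Context {d : measure_display} {T : measurableType d} {R : realType}.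
Variable P : probability T R.
Implicit Types g h : T -> R.

Definition sqint g := measurable_fun setT g /\ P.-integrable setT (EFin \o (fun w => g w ^+ 2)).

Definition ip g h : R := \int[P]_w (g w * h w).

Lemma ipC g h : ip g h = ip h g.
Proof. by apply: eq_Rintegral => w _; rewrite mulrC. Qed.

Lemma integrable_sqint_mul g h : sqint g -> sqint h ->
  P.-integrable setT (EFin \o (fun w => g w * h w)).
Proof.
move=> [mg ig] [mh ih].
apply: (@le_integrableR _ _ _ P _ (fun w => g w ^+ 2 + h w ^+ 2)).
- exact: measurable_funM.
- move=> w; rewrite normrM -(real_normK (num_real (g w))) -(real_normK (num_real (h w))).
  have := normr_ge0 (g w); have := normr_ge0 (h w).
  move: `|g w| `|h w| => a b a0 b0.
  have : 0 <= (a - b) ^+ 2 by exact: sqr_ge0.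
  have : 0 <= a * b by exact: mulr_ge0.
  rewrite sqrrB mulr2n; lra.
- exact: (@integrableD _ _ _ P setT measurableT _ _ ig ih).
Qed.

Lemma sqint_cst c : sqint (fun=> c).
Proof. by split=> //; exact: integrable_cstP. Qed.

Lemma integrable_sqint g : sqint g -> P.-integrable setT (EFin \o g).
Proof.
move=> sg; have := integrable_sqint_mul sg (sqint_cst 1).
by under [X in EFin \o X]eq_fun do rewrite mulr1.
Qed.

Lemma sqintDZ g h b : sqint g -> sqint h -> sqint (fun w => g w + b * h w).
Proof.
move=> sg sh; split.
  by apply: measurable_funD; [exact: sg.1|apply: measurable_funM => //; exact: sh.1].
have i1 := integrable_sqint_mul sg sh.
have i2 := @integrableZl _ _ _ P setT measurableT (b *+ 2) _ i1.
have i3 := @integrableZl _ _ _ P setT measurableT (b ^+ 2) _ sh.2.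
have := @integrableD _ _ _ P setT measurableT _ _ sg.2 (@integrableD _ _ _ P setT measurableT _ _ i2 i3).
congr (_.-integrable setT _); apply/funext => w /=.
rewrite -!EFinM -!EFinD; congr EFin; ring.
Qed.

Lemma ipDZl g h k b : sqint g -> sqint h -> sqint k ->
  ip (fun w => g w + b * h w) k = ip g k + b * ip h k.
Proof.
move=> sg sh sk; rewrite /ip.
have i1 := integrable_sqint_mul sg sk; have i2 := integrable_sqint_mul sh sk.
rewrite -RintegralZl// -RintegralD//.
  by apply: eq_Rintegral => w _; ring.
exact: (@integrableZl _ _ _ P setT measurableT b _ i2).
Qed.

Lemma ipDZr g h k b : sqint g -> sqint h -> sqint k ->
  ip k (fun w => g w + b * h w) = ip k g + b * ip k h.
Proof. by move=> sg sh sk; rewrite ipC ipDZl// ipC (ipC h). Qed.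

(** A linear space of centered, jointly Gaussian variables. Joint normality is the closure under
    combinations together with the one-dimensional formula, which forces mean 0 and admits
    degenerate members. *)
Definition gaussian_space (L : set (T -> R)) := [/\ L (fun=> 0),
  forall g h b, L g -> L h -> L (fun w => g w + b * h w),
  forall g, L g -> sqint g &
  forall g th, L g -> \int[P]_w cos (g w + th) = cos th * expR (- (ip g g / 2))].

Section orthogonal.
Variables (L : set (T -> R)) (e : T -> R).
Hypothesis gL : gaussian_space L.
Hypothesis Le : L e.

Let vn (n : nat) : R := n.+1%:R^-1.
Let vn0 n : vn n != 0. Proof. by rewrite invr_eq0 pnatr_eq0. Qed.

(* [E (e sin (g + th))] is, up to sign, the derivative at [a = 0] of [E cos (a e + g + th)], which is even in [a]. *)
Let ip_sin g th : L g -> ip e g = 0 -> \int[P]_w (e w * sin (g w + th)) = 0.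
Proof.
have [L0 LD Ls Lc] := gL => Lg eg.
have [mg _] := Ls _ Lg; have [me _] := Ls _ Le.
have ms : measurable_fun setT (fun w => sin (g w + th)).
  apply: measurableT_comp; first exact: (continuous_measurable_fun (@continuous_sin R)).
  exact: measurable_funD.
have h : (\int[P]_w (((vn n)^-1 * sin (vn n * e w)) * sin (g w + th))) @[n --> \oo] -->
    \int[P]_w (e w * sin (g w + th)).
  apply: (@dominated_cvgR _ _ _ P _ _ (fun w => `|e w|)) => //.
  - by move=> n; apply: measurable_funM => //; exact: measurable_sinv.
  - by move=> w; apply: cvgM; [exact: cvg_sinv|exact: cvg_cst].
  - exact: (@integrable_norm _ _ _ P setT _ (integrable_sqint (Ls _ Le))).
  - by move=> n w; rewrite normrM -[leRHS]mulr1 ler_pM// ?norm_sinv// sin_max.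
have h0 n : \int[P]_w (((vn n)^-1 * sin (vn n * e w)) * sin (g w + th)) = 0.
  have ic b : P.-integrable setT (EFin \o (fun w => cos (g w + b * e w + th))).
    apply: (@le_integrableR _ _ _ P _ (fun=> 1)); last exact: integrable_cstP.
      apply: measurableT_comp; first exact: (continuous_measurable_fun (@continuous_cos R)).
      by apply: measurable_funD => //; apply: measurable_funD => //; exact: measurable_funM.
    by move=> w; exact: cos_max.
  have cE b : \int[P]_w cos (g w + b * e w + th) =
      cos th * expR (- ((ip g g + b ^+ 2 * ip e e) / 2)).
    have := Lc _ th (LD _ _ b Lg Le) => ->; congr (_ * expR (- (_ / 2))).
    rewrite ipDZl ?ipDZr//; try exact: Ls; last exact: (Ls _ (LD _ _ b Lg Le)).
    by rewrite (ipC g e) eg; ring.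
  transitivity (\int[P]_w ((vn n)^-1 / 2 * (cos (g w + - vn n * e w + th) - cos (g w + vn n * e w + th)))).
    apply: eq_Rintegral => w _.
    have -> : g w + - vn n * e w + th = (g w + th) - vn n * e w by ring.
    have -> : g w + vn n * e w + th = (g w + th) + vn n * e w by ring.
    by rewrite (cosB (g w + th)) (cosD (g w + th)); field; exact: vn0.
  rewrite RintegralZl//; last exact: (@integrableB _ _ _ P setT measurableT _ _ (ic _) (ic _)).
  by rewrite RintegralB// !cE sqrrN subrr mulr0.
move: h; under eq_fun do rewrite h0; move=> h.
exact: (cvg_unique (@Rhausdorff R) h (cvg_cst (0:R))).
Qed.

(** For jointly Gaussian variables, orthogonality to a subspace gives zero conditional expectation
    on all that the subspace generates. The members of [L] orthogonal to [e] are again closed under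
    combinations, as the Fourier argument requires. *)
Lemma gaussian_orthogonal E : sigma_gen [set g | L g /\ ip e g = 0] E ->
  measurable E /\ (\int[P]_(w in E) (e w)%:E = 0)%E.
Proof.
have [L0 LD Ls Lc] := gL; apply: orthogonal_sigma_gen.
- exact: integrable_sqint (Ls _ Le).
- by move=> g [/Ls[]].
- split=> //; rewrite /ip; under eq_Rintegral do rewrite mulr0.
  exact: Rintegral_cstP.
- move=> g h b [Lg eg] [Lh eh]; split; first exact: LD.
  by rewrite ipDZr ?eg ?eh ?mulr0 ?addr0//; exact: Ls.
- move=> g th [Lg eg]; rewrite -[RHS](ip_sin (th + pi / 2) Lg eg).
  by apply: eq_Rintegral => w _; rewrite addrA sinDpihalf.
Qed.

End orthogonal.
End square_integrable.

Section block_space.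
Context {d : measure_display} {T : measurableType d} {R : realType}.
Variable P : probability T R.
Variables (I : finType) (F : I -> set (set T)) (B : I -> set (T -> R)).
Hypothesis sF : forall i, sigma_algebra setT (F i).
Hypothesis mF : forall i E, F i E -> measurable E.
Hypothesis indF : mutually_independent P F.
Hypothesis B0 : forall i, B i (fun=> 0).
Hypothesis BD : forall i g h b, B i g -> B i h -> B i (fun w => g w + b * h w).
Hypothesis BF : forall i g, B i g -> adapted (F i) g.
Hypothesis Bs : forall i g, B i g -> sqint P g.
Hypothesis Bg : forall i g, B i g -> gaussian_rv P g.
Hypothesis BE : forall i g, B i g -> \int[P]_w g w = 0.

(** One summand from each independent block. A block is a space rather than a single variable
    because the coordinates of one noise vector may be correlated. *)
Definition block_span : set (T -> R) :=
  [set g | exists2 L : I -> T -> R, (forall i, B i (L i)) & g = fun w => \sum_i L i w].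

Let cf1 i g b th : B i g ->
  \int[P]_w cos (b * g w + th) = cos th * expR (- (ip P g g * b ^+ 2 / 2)).
Proof.
move=> Big; rewrite (centered_gaussian_rv_cf (Bg Big) (Bs Big).2)//.
- exact: integrable_sqint (Bs Big).
- exact: BE Big.
Qed.

Let sqint_sum (L : I -> T -> R) (r : seq I) : (forall i, B i (L i)) ->
  sqint P (fun w => \sum_(i <- r) L i w).
Proof.
move=> BL; elim: r => [|i r IH].
  by under eq_fun do rewrite big_nil; exact: sqint_cst.
under eq_fun do rewrite big_cons addrC -(mul1r (L i _)).
apply: sqintDZ => //; exact: Bs (BL i).
Qed.

Let cf_sum (L : I -> T -> R) b th : (forall i, B i (L i)) ->
  \int[P]_w cos (b * (\sum_i L i w) + th) =
    cos th * expR (- ((\sum_i ip P (L i) (L i)) * b ^+ 2 / 2)).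
Proof.
move=> BL.
have BbL i : B i (fun w => b * L i w).
  have := BD b (B0 i) (BL i).
  by under eq_fun do rewrite add0r.
have mbL i : measurable_fun setT (fun w => b * L i w) by exact: (Bs (BbL i)).1.
have := @independent_sum_cf _ _ _ P I F mF indF (fun i w => b * L i w)
  (fun i => ip P (L i) (L i) * b ^+ 2) mbL (fun i D => BF (BbL i) (D := D)) _ th.
rewrite -mulr_suml => <-.
  by apply: eq_Rintegral => w _; rewrite mulr_sumr.
move=> i b' th'.
have -> : (fun w => cos (b' * (b * L i w) + th')) = (fun w => cos ((b' * b) * L i w + th')).
  by apply/funext => w; rewrite mulrA.
rewrite (cf1 _ _ (BL i)); congr (_ * expR (- _)); ring.
Qed.

(** The variance of the sum is read off its characteristic function, and comparing it with the
    direct expansion will give orthogonality of distinct blocks. *)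
Let ip_sum (L : I -> T -> R) : (forall i, B i (L i)) ->
  ip P (fun w => \sum_i L i w) (fun w => \sum_i L i w) = \sum_i ip P (L i) (L i).
Proof.
move=> BL; have [mS iS] := sqint_sum (index_enum I) BL.
rewrite -(variance_of_cf mS iS (fun b th => cf_sum b th BL)).
by apply: eq_Rintegral => w _; rewrite expr2.
Qed.

Lemma block_span_gaussian : gaussian_space P block_span.
Proof.
split.
- by exists (fun _ _ => 0) => //; apply/funext => w; rewrite big1.
- move=> _ _ b [L1 BL1 ->] [L2 BL2 ->].
  exists (fun i w => L1 i w + b * L2 i w); first by move=> i; exact: BD.
  by apply/funext => w; rewrite big_split /= mulr_sumr.
- by move=> _ [L BL ->]; exact: sqint_sum.
- move=> _ th [L BL ->]; rewrite ip_sum//.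
  have := cf_sum 1 th BL; rewrite expr1n mulr1 => <-.
  by under [RHS]eq_Rintegral do rewrite mul1r.
Qed.

Let sum_two (i j : I) (x y : R) : i != j ->
  \sum_k (if k == i then x else if k == j then y else 0) = x + y.
Proof.
move=> ij; rewrite (bigD1 i)//= eqxx; congr (_ + _).
rewrite (bigD1 j) /=; last by rewrite eq_sym.
rewrite [j == i]eq_sym (negbTE ij) eqxx big1 ?addr0//.
by move=> k /andP[/negbTE -> /negbTE ->].
Qed.

Lemma sub_block_span i g : B i g -> block_span g.
Proof.
move=> Bg'; exists (fun k => if k == i then g else (fun=> 0)).
  by move=> k; case: eqP => [->|].
apply/funext => w; rewrite (bigD1 i)//= eqxx big1 ?addr0//.
by move=> k /negbTE ->.
Qed.

(* Read off the variance of [g + h]. *)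
Lemma block_orthogonal i j g h : i != j -> B i g -> B j h -> ip P g h = 0.
Proof.
move=> ij Big Bjh.
pose L k := if k == i then g else if k == j then h else (fun=> 0).
have BL k : B k (L k) by rewrite /L; case: eqP => [->|_]//; case: eqP => [->|].
have E : (fun w => \sum_k L k w) = (fun w => g w + 1 * h w).
  apply/funext => w; rewrite mul1r -(sum_two _ _ ij).
  by apply: eq_bigr => k _; rewrite /L; case: eqP => // _; case: eqP.
have := ip_sum BL; rewrite E.
have sg := Bs Big; have sh := Bs Bjh.
rewrite ipDZl ?ipDZr//; last exact: sqintDZ.
have -> : \sum_k ip P (L k) (L k) = ip P g g + ip P h h.
  rewrite -(sum_two _ _ ij); apply: eq_bigr => k _; rewrite /L.
  case: eqP => // _; case: eqP => // _.
  by rewrite /ip; under eq_Rintegral do rewrite mulr0; exact: Rintegral_cstP.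
rewrite (ipC P h g) !mul1r => /eqP; rewrite -subr_eq0 => /eqP h0.
have : ip P g h *+ 2 = 0 by rewrite -h0; ring.
by move=> /eqP; rewrite mulrn_eq0 /= => /eqP.
Qed.

End block_space.

Section linear_forms.
Context {d : measure_display} {T : measurableType d} {R : realType}.
Variable P : probability T R.
Variables (k : nat) (X : T -> 'cV[R]_k) (V : 'M[R]_k).

Definition linear_forms : set (T -> R) :=
  [set g | exists a : 'cV[R]_k, g = fun w => (a^T *m X w) 0 0].

Lemma linear_forms_coord i : linear_forms (fun w => X w i 0).
Proof.
exists (delta_mx i 0); apply/funext => w.
by rewrite trmx_delta -rowE mxE.
Qed.

Lemma linear_forms0 : linear_forms (fun=> 0).
Proof. by exists 0; apply/funext => w; rewrite trmx0 mul0mx mxE. Qed.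

Lemma linear_formsDZ g h b : linear_forms g -> linear_forms h ->
  linear_forms (fun w => g w + b * h w).
Proof.
move=> [a ->] [c ->]; exists (a + b *: c); apply/funext => w.
by rewrite linearD linearZ /= mulmxDl -scalemxAl [RHS]mxE [X in _ = _ + X]mxE.
Qed.

Lemma linear_forms_ind (Q : (T -> R) -> Prop) : Q (fun=> 0) ->
  (forall g h b, Q g -> Q h -> Q (fun w => g w + b * h w)) ->
  (forall i, Q (fun w => X w i 0)) -> forall g, linear_forms g -> Q g.
Proof.
move=> Q0 QD QX _ [a ->].
have -> : (fun w => (a^T *m X w) 0 0) = (fun w => \sum_i a i 0 * X w i 0).
  by apply/funext => w; rewrite mxE; apply: eq_bigr => i _; rewrite mxE.
elim: (index_enum _) => [|i r IH].
  by under eq_fun do rewrite big_nil.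
by under eq_fun do rewrite big_cons addrC; exact: QD.
Qed.

Hypothesis gX : centered_gaussian P X V.

Let mX i : measurable_fun setT (fun w => X w i 0).
Proof.
have [gv _ _] := gX; have := (gv (delta_mx i 0)).1.
by under eq_fun do rewrite trmx_delta -rowE mxE.
Qed.

Let covX i j : (\int[P]_w (X w i 0 * X w j 0)%:E = (V i j)%:E)%E.
Proof.
have [_ EX cX] := gX; have := cX i j.
rewrite unlock !EX unlock /=.
by move=> <-; apply: eq_integral => z _; congr EFin; rewrite !fctE /= !subr0.
Qed.

(** The covariances are equated with real numbers inside the extended reals; on the diagonal this
    says that the integral of a nonnegative function is finite. *)
Lemma centered_sqint i : sqint P (fun w => X w i 0).
Proof.
split; first exact: mX.
apply/integrableP; split.
  by apply/measurable_EFinP; apply: measurable_funX; exact: mX.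
under eq_integral do rewrite /= ger0_norm ?sqr_ge0// expr2.
by rewrite covX ltry.
Qed.

Lemma centered_ip i j : ip P (fun w => X w i 0) (fun w => X w j 0) = V i j.
Proof. by rewrite /ip /Rintegral covX. Qed.

Lemma centered_mean i : \int[P]_w X w i 0 = 0.
Proof.
have [_ EX _] := gX; have := EX i; rewrite unlock /Rintegral => h.
by rewrite h.
Qed.

Lemma linear_forms_sqint g : linear_forms g -> sqint P g.
Proof.
apply: linear_forms_ind => [|g' h b|i]; [exact: sqint_cst|exact: sqintDZ|exact: centered_sqint].
Qed.

Lemma linear_forms_mean g : linear_forms g -> \int[P]_w g w = 0.
Proof.
move=> Lg; suff [] : P.-integrable setT (EFin \o g) /\ \int[P]_w g w = 0 by [].
move: g Lg; apply: linear_forms_ind => [|g h b [ig g0] [ih h0]|i].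
- by split; [exact: integrable_cstP|exact: Rintegral_cstP].
- have ibh := @integrableZl _ _ _ P setT measurableT b _ ih.
  split; first exact: (@integrableD _ _ _ P setT measurableT _ _ ig ibh).
  by rewrite RintegralD// RintegralZl// g0 h0 mulr0 addr0.
- by split; [exact: integrable_sqint (centered_sqint i)|exact: centered_mean].
Qed.

Lemma linear_forms_gaussian g : linear_forms g -> gaussian_rv P g.
Proof. by move=> [a ->]; have [gv _ _] := gX; exact: gv. Qed.

Lemma linear_forms_adapted g : linear_forms g -> adapted (sigma_gen (coords X)) g.
Proof.
have sX := sigma_algebra_sigma_gen (coords X).
apply: linear_forms_ind => [|g' h b Fg Fh|i].
- exact: adapted_cst.
- by apply: adaptedD => //; exact: adaptedZ.
- by apply: adapted_sigma_gen; exists i.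
Qed.

Lemma sigma_gen_coords_measurable E : sigma_gen (coords X) E -> measurable E.
Proof.
apply: sigma_gen_sub; first exact: sigma_algebra_measurable.
by move=> _ [i ->] D mD; rewrite -[X in measurable X]setTI; exact: mX.
Qed.

End linear_forms.

Section noise_space.
Context {d : measure_display} {T : measurableType d} {R : realType}.
Variable P : probability T R.
Variables (N n p : nat) (X0 V : 'M[R]_n) (W : 'M[R]_p).
Variables (x0 : T -> 'cV[R]_n) (v : nat -> T -> 'cV[R]_n) (w : nat -> T -> 'cV[R]_p).
Hypothesis gx0 : centered_gaussian P x0 X0.
Hypothesis gv : forall t, (t < N)%N -> centered_gaussian P (v t) V.
Hypothesis gw : forall t, (t < N)%N -> centered_gaussian P (w t) W.
Hypothesis ind : independent_noise P N x0 v w.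

Let B (i : option ('I_N + 'I_N)) : set (T -> R) :=
  match i with
  | None => linear_forms x0
  | Some (inl t) => linear_forms (v t)
  | Some (inr t) => linear_forms (w t)
  end.

Let F (i : option ('I_N + 'I_N)) : set (set T) :=
  match i with
  | None => sigma_gen (coords x0)
  | Some (inl t) => sigma_gen (coords (v t))
  | Some (inr t) => sigma_gen (coords (w t))
  end.

(** All linear combinations of the coordinates of [x0], [v t] and [w t] with [t < N]: the ambient
    Gaussian space of the filter. *)
Definition noise_space := block_span B.

Let mF i E : F i E -> measurable E.
Proof.
case: i => [[t|t]|] /=.
- exact: (sigma_gen_coords_measurable (gv (ltn_ord t))).
- exact: (sigma_gen_coords_measurable (gw (ltn_ord t))).
- exact: (sigma_gen_coords_measurable gx0).
Qed.

Let B0 i : B i (fun=> 0).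
Proof. by case: i => [[t|t]|]; exact: linear_forms0. Qed.

Let BD i g h b : B i g -> B i h -> B i (fun w => g w + b * h w).
Proof. by case: i => [[t|t]|]; exact: linear_formsDZ. Qed.

Let BF i g : B i g -> adapted (F i) g.
Proof. by case: i => [[t|t]|]; exact: linear_forms_adapted. Qed.

Let Bs i g : B i g -> sqint P g.
Proof.
case: i => [[t|t]|]; [exact: linear_forms_sqint (gv (ltn_ord t)) _|
  exact: linear_forms_sqint (gw (ltn_ord t)) _|exact: linear_forms_sqint gx0 _].
Qed.

Let Bg i g : B i g -> gaussian_rv P g.
Proof.
case: i => [[t|t]|]; [exact: linear_forms_gaussian (gv (ltn_ord t)) _|
  exact: linear_forms_gaussian (gw (ltn_ord t)) _|exact: linear_forms_gaussian gx0 _].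
Qed.

Let BE i g : B i g -> \int[P]_w g w = 0.
Proof.
case: i => [[t|t]|]; [exact: linear_forms_mean (gv (ltn_ord t)) _|
  exact: linear_forms_mean (gw (ltn_ord t)) _|exact: linear_forms_mean gx0 _].
Qed.

Lemma noise_space_gaussian : gaussian_space P noise_space.
Proof. exact: (block_span_gaussian mF ind B0 BD BF Bs Bg BE). Qed.

Lemma noise_x0 i : noise_space (fun z => x0 z i 0).
Proof. by apply: (sub_block_span B0 (i := None)); exact: linear_forms_coord. Qed.

Lemma noise_v t i : (t < N)%N -> noise_space (fun z => v t z i 0).
Proof.
move=> tN; apply: (sub_block_span B0 (i := Some (inl (Ordinal tN)))).
exact: linear_forms_coord.
Qed.

Lemma noise_w t i : (t < N)%N -> noise_space (fun z => w t z i 0).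
Proof.
move=> tN; apply: (sub_block_span B0 (i := Some (inr (Ordinal tN)))).
exact: linear_forms_coord.
Qed.

Let ortho i j g h : i != j -> B i g -> B j h -> ip P g h = 0.
Proof. exact: (@block_orthogonal _ _ _ P _ F B mF ind B0 BD BF Bs Bg BE). Qed.

Lemma ip_v_x0 t i j : (t < N)%N -> ip P (fun z => v t z i 0) (fun z => x0 z j 0) = 0.
Proof.
by move=> tN; apply: (@ortho (Some (inl (Ordinal tN))) None) => //; exact: linear_forms_coord.
Qed.

Lemma ip_w_x0 t i j : (t < N)%N -> ip P (fun z => w t z i 0) (fun z => x0 z j 0) = 0.
Proof.
by move=> tN; apply: (@ortho (Some (inr (Ordinal tN))) None) => //; exact: linear_forms_coord.
Qed.

Lemma ip_v_w t s i j : (t < N)%N -> (s < N)%N ->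
  ip P (fun z => v t z i 0) (fun z => w s z j 0) = 0.
Proof.
move=> tN sN.
by apply: (@ortho (Some (inl (Ordinal tN))) (Some (inr (Ordinal sN)))) => //; exact: linear_forms_coord.
Qed.

Lemma ip_v_v t s i j : (t < N)%N -> (s < N)%N -> t != s ->
  ip P (fun z => v t z i 0) (fun z => v s z j 0) = 0.
Proof.
move=> tN sN ts.
apply: (@ortho (Some (inl (Ordinal tN))) (Some (inl (Ordinal sN)))) => //; exact: linear_forms_coord.
Qed.

Lemma ip_w_w t s i j : (t < N)%N -> (s < N)%N -> t != s ->
  ip P (fun z => w t z i 0) (fun z => w s z j 0) = 0.
Proof.
move=> tN sN ts.
apply: (@ortho (Some (inr (Ordinal tN))) (Some (inr (Ordinal sN)))) => //; exact: linear_forms_coord.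
Qed.

Lemma ip_w_same t i j : (t < N)%N -> ip P (fun z => w t z i 0) (fun z => w t z j 0) = W i j.
Proof. by move=> tN; exact: (centered_ip (gw tN)). Qed.

End noise_space.

(** * Second moments and the Kalman filter *)

Section linear_set.
Context {R : realType} {U : Type}.
Variable Q : set (U -> R).

(** The filter recursions are linear, so a single closure property serves for membership in the
    noise space, for square integrability and for adaptedness to a sigma-algebra. *)
Definition linear_set := Q (fun=> 0) /\
  forall g h b, Q g -> Q h -> Q (fun w => g w + b * h w).

Definition vin {k} (X : U -> 'cV[R]_k) := forall i, Q (fun w => X w i 0).

Hypothesis lQ : linear_set.

Lemma linear_set_sum (I : Type) (r : seq I) (c : I -> R) (g : I -> U -> R) :
  (forall i, Q (g i)) -> Q (fun w => \sum_(i <- r) c i * g i w).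
Proof.
have [Q0 QD] := lQ; move=> Qg; elim: r => [|i r IH].
  by under eq_fun do rewrite big_nil.
by under eq_fun do rewrite big_cons addrC; exact: QD.
Qed.

Lemma vin0 k : vin (fun=> 0 : 'cV[R]_k).
Proof. by have [Q0 _] := lQ; move=> i; under eq_fun do rewrite mxE. Qed.

Lemma vin_mul k l (M : 'M[R]_(l, k)) X : vin X -> vin (fun w => M *m X w).
Proof. by move=> QX i; under eq_fun do rewrite mxE; exact: linear_set_sum. Qed.

Lemma vinD k (X Y : U -> 'cV[R]_k) : vin X -> vin Y -> vin (fun w => X w + Y w).
Proof.
have [_ QD] := lQ; move=> QX QY i.
by under eq_fun do rewrite mxE -(mul1r (Y _ _ _)); exact: QD.
Qed.

Lemma vinB k (X Y : U -> 'cV[R]_k) : vin X -> vin Y -> vin (fun w => X w - Y w).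
Proof.
have [_ QD] := lQ; move=> QX QY i.
by under eq_fun do rewrite !mxE -(mulN1r (Y _ _ _)); exact: QD.
Qed.

End linear_set.

Lemma linear_set_adapted {R : realType} {U : Type} (F : set (set U)) :
  sigma_algebra setT F -> linear_set (@adapted R U F).
Proof.
move=> sF; split; first exact: adapted_cst.
by move=> g h b Fg Fh; apply: adaptedD => //; exact: adaptedZ.
Qed.

Section second_moments.
Context {d : measure_display} {T : measurableType d} {R : realType}.
Variable P : probability T R.

Lemma linear_set_sqint : linear_set (sqint P).
Proof. by split; [exact: sqint_cst|exact: sqintDZ]. Qed.

Notation sqintv := (vin (sqint P)).

Definition crossmx {a b} (X : T -> 'cV[R]_a) (Y : T -> 'cV[R]_b) : 'M[R]_(a, b) :=
  \matrix_(i, j) ip P (fun w => X w i 0) (fun w => Y w j 0).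

Lemma crossmx_tr a b (X : T -> 'cV[R]_a) (Y : T -> 'cV[R]_b) :
  (crossmx X Y)^T = crossmx Y X.
Proof. by apply/matrixP => i j; rewrite !mxE ipC. Qed.

Lemma crossmx_mull a b c (M : 'M[R]_(c, a)) (X : T -> 'cV[R]_a) (Y : T -> 'cV[R]_b) :
  sqintv X -> sqintv Y -> crossmx (fun w => M *m X w) Y = M *m crossmx X Y.
Proof.
move=> sX sY; apply/matrixP => i j; rewrite !mxE.
under [X in ip P X]eq_fun do rewrite mxE.
under [RHS]eq_bigr do rewrite mxE.
elim: (index_enum _) => [|k r IH].
  under [X in ip P X]eq_fun do rewrite big_nil.
  by rewrite big_nil /ip; under eq_Rintegral do rewrite mul0r; exact: Rintegral_cstP.
under [X in ip P X]eq_fun do rewrite big_cons addrC.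
rewrite ipDZl//; last by apply: (linear_set_sum linear_set_sqint) => l; exact: sX.
by rewrite IH big_cons addrC.
Qed.

Lemma crossmxDl a b (X X' : T -> 'cV[R]_a) (Y : T -> 'cV[R]_b) :
  sqintv X -> sqintv X' -> sqintv Y ->
  crossmx (fun w => X w + X' w) Y = crossmx X Y + crossmx X' Y.
Proof.
move=> sX sX' sY; apply/matrixP => i j; rewrite !mxE.
under [X in ip P X]eq_fun do rewrite mxE -(mul1r (X' _ _ _)).
by rewrite ipDZl// mul1r.
Qed.

Lemma crossmxBl a b (X X' : T -> 'cV[R]_a) (Y : T -> 'cV[R]_b) :
  sqintv X -> sqintv X' -> sqintv Y ->
  crossmx (fun w => X w - X' w) Y = crossmx X Y - crossmx X' Y.
Proof.
move=> sX sX' sY; apply/matrixP => i j; rewrite !mxE.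
under [X in ip P X]eq_fun do rewrite !mxE -(mulN1r (X' _ _ _)).
by rewrite ipDZl// mulN1r.
Qed.

Lemma crossmx_mulr a b c (M : 'M[R]_(c, b)) (X : T -> 'cV[R]_a) (Y : T -> 'cV[R]_b) :
  sqintv X -> sqintv Y -> crossmx X (fun w => M *m Y w) = crossmx X Y *m M^T.
Proof. by move=> sX sY; rewrite -crossmx_tr crossmx_mull// trmx_mul crossmx_tr. Qed.

Lemma crossmxDr a b (X : T -> 'cV[R]_a) (Y Y' : T -> 'cV[R]_b) :
  sqintv X -> sqintv Y -> sqintv Y' ->
  crossmx X (fun w => Y w + Y' w) = crossmx X Y + crossmx X Y'.
Proof. by move=> sX sY sY'; rewrite -crossmx_tr crossmxDl// linearD /= !crossmx_tr. Qed.

Lemma crossmxBr a b (X : T -> 'cV[R]_a) (Y Y' : T -> 'cV[R]_b) :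
  sqintv X -> sqintv Y -> sqintv Y' ->
  crossmx X (fun w => Y w - Y' w) = crossmx X Y - crossmx X Y'.
Proof. by move=> sX sY sY'; rewrite -crossmx_tr crossmxBl// linearB /= !crossmx_tr. Qed.

Lemma crossmx0r a b (X : T -> 'cV[R]_a) : crossmx X (fun=> 0 : 'cV[R]_b) = 0.
Proof.
apply/matrixP => i j; rewrite !mxE /ip.
by under eq_Rintegral do rewrite mulr0; exact: Rintegral_cstP.
Qed.

Lemma quadE k (M : 'M[R]_k) (x : 'cV[R]_k) :
  quad M x = \sum_i \sum_j M j i * (x i 0 * x j 0).
Proof.
rewrite /quad mxE; apply: eq_bigr => i _; rewrite mxE mulr_suml.
by apply: eq_bigr => j _; rewrite mxE; ring.
Qed.

Lemma integrable_sumR (I : Type) (r : seq I) (g : I -> T -> R) :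
  (forall i, P.-integrable setT (EFin \o g i)) ->
  P.-integrable setT (EFin \o (fun w => \sum_(i <- r) g i w)) /\
  \int[P]_w (\sum_(i <- r) g i w) = \sum_(i <- r) \int[P]_w g i w.
Proof.
move=> ig; elim: r => [|i r [IH1 IH2]].
  split; first by under [X in EFin \o X]eq_fun do rewrite big_nil; exact: integrable_cstP.
  by under eq_Rintegral do rewrite big_nil; rewrite big_nil; exact: Rintegral_cstP.
split.
  under [X in EFin \o X]eq_fun do rewrite big_cons.
  exact: (@integrableD _ _ _ P setT measurableT _ _ (ig i) IH1).
under eq_Rintegral do rewrite big_cons.
by rewrite big_cons RintegralD// IH2.
Qed.

Lemma quad_moment k (M : 'M[R]_k) (X : T -> 'cV[R]_k) : sqintv X ->
  P.-integrable setT (EFin \o (fun w => quad M (X w))) /\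
  \int[P]_w quad M (X w) = \tr (M *m crossmx X X).
Proof.
move=> sX.
have iXX i j := integrable_sqint_mul (sX i) (sX j).
have iM i j := @integrableZl _ _ _ P setT measurableT (M j i) _ (iXX i j).
have h1 i := integrable_sumR (index_enum _) (fun j => iM i j).
have [h2 h3] := integrable_sumR (index_enum _) (fun i => (h1 i).1).
split.
  by under [X in EFin \o X]eq_fun do rewrite quadE; exact: h2.
under eq_Rintegral do rewrite quadE.
rewrite h3 /mxtrace.
under [RHS]eq_bigr do rewrite mxE.
rewrite exchange_big /=; apply: eq_bigr => i _.
rewrite (h1 i).2; apply: eq_bigr => j _.
by rewrite RintegralZl// mxE /ip; congr (_ * _); apply: eq_Rintegral => w _; rewrite mulrC.
Qed.

End second_moments.

Section filter.
Context {d : measure_display} {T : measurableType d} {R : realType}.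
Variable P : probability T R.
Variables (N n p : nat) (A : 'M[R]_n) (C : 'M[R]_(p, n)).
Variables (X0 V : 'M[R]_n) (W : 'M[R]_p).
Variables (x0 : T -> 'cV[R]_n) (v : nat -> T -> 'cV[R]_n) (w : nat -> T -> 'cV[R]_p).
Hypothesis gx0 : centered_gaussian P x0 X0.
Hypothesis gv : forall t, (t < N)%N -> centered_gaussian P (v t) V.
Hypothesis gw : forall t, (t < N)%N -> centered_gaussian P (w t) W.
Hypothesis ind : independent_noise P N x0 v w.

Notation L := (noise_space N x0 v w).
Notation cross := (crossmx P).

(* The estimation error does not depend on the law; its covariance, hence the Kalman gain, is read off the error itself instead of solving a Riccati recursion. *)
Fixpoint err (t : nat) : T -> 'cV[R]_n :=
  if t is t'.+1 then
    let e := err t' in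
    let K := kalman_gain A C W (cross e e) in
    fun z => (A - K *m C) *m e z + (v t' z - K *m w t' z)
  else x0.

Definition errcov t := cross (err t) (err t).
Definition gain t := kalman_gain A C W (errcov t).
Definition innov t z := C *m err t z + w t z.
Definition innovcov t := innovation_cov C W (errcov t).

Lemma errS t z : err t.+1 z = (A - gain t *m C) *m err t z + (v t z - gain t *m w t z).
Proof. by []. Qed.

Lemma linear_set_noise : linear_set L.
Proof. by have [L0 LD _ _] := noise_space_gaussian gx0 gv gw ind; split. Qed.

Lemma noise_sqint k (X : T -> 'cV[R]_k) : vin L X -> vin (sqint P) X.
Proof. by have [_ _ Ls _] := noise_space_gaussian gx0 gv gw ind => LX i; exact: Ls. Qed.

Let lL := linear_set_noise.

Let vL t : (t < N)%N -> vin L (v t).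
Proof. by move=> tN i; exact: noise_v. Qed.
Let wL t : (t < N)%N -> vin L (w t).
Proof. by move=> tN i; exact: noise_w. Qed.

Lemma err_noise t : (t <= N)%N -> vin L (err t).
Proof.
elim: t => [_ i|t IH tN]; first exact: noise_x0.
apply: (vinD lL); first exact: (vin_mul lL) (IH (ltnW tN)).
by apply: (vinB lL); [exact: vL|apply: (vin_mul lL); exact: wL].
Qed.

Lemma innov_noise t : (t < N)%N -> vin L (innov t).
Proof.
move=> tN; apply: (vinD lL); last exact: wL.
by apply: (vin_mul lL); apply: err_noise; exact: ltnW.
Qed.

Let sv t : (t < N)%N -> vin (sqint P) (v t). Proof. by move/vL/noise_sqint. Qed.
Let sw t : (t < N)%N -> vin (sqint P) (w t). Proof. by move/wL/noise_sqint. Qed.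
Let serr t : (t <= N)%N -> vin (sqint P) (err t). Proof. by move/err_noise/noise_sqint. Qed.
Let sinnov t : (t < N)%N -> vin (sqint P) (innov t). Proof. by move/innov_noise/noise_sqint. Qed.
Let lS := linear_set_sqint P.

Lemma cross_errSr k (X : T -> 'cV[R]_k) t : (t < N)%N -> vin (sqint P) X ->
  cross X (err t.+1) = cross X (err t) *m (A - gain t *m C)^T
    + (cross X (v t) - cross X (w t) *m (gain t)^T).
Proof.
move=> tN sX; have se := serr (ltnW tN); have sv' := sv tN; have sw' := sw tN.
rewrite crossmxDr//; last 2 first.
- exact: (vin_mul lS).
- by apply: (vinB lS) => //; exact: (vin_mul lS).
rewrite crossmxBr//; last exact: (vin_mul lS).
by rewrite !crossmx_mulr.
Qed.

Let cross_v_x0 t : (t < N)%N -> cross (v t) x0 = 0.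
Proof. by move=> tN; apply/matrixP => i j; rewrite !mxE; exact: (ip_v_x0 gx0 gv gw ind). Qed.
Let cross_w_x0 t : (t < N)%N -> cross (w t) x0 = 0.
Proof. by move=> tN; apply/matrixP => i j; rewrite !mxE; exact: (ip_w_x0 gx0 gv gw ind). Qed.
Let cross_v_w t s : (t < N)%N -> (s < N)%N -> cross (v t) (w s) = 0.
Proof. by move=> tN sN; apply/matrixP => i j; rewrite !mxE; exact: (ip_v_w gx0 gv gw ind). Qed.
Let cross_w_v t s : (t < N)%N -> (s < N)%N -> cross (w t) (v s) = 0.
Proof. by move=> tN sN; rewrite -crossmx_tr cross_v_w// trmx0. Qed.
Let cross_v_v t s : (t < N)%N -> (s < N)%N -> t != s -> cross (v t) (v s) = 0.
Proof. by move=> tN sN ts; apply/matrixP => i j; rewrite !mxE; exact: (ip_v_v gx0 gv gw ind). Qed.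
Let cross_w_w t s : (t < N)%N -> (s < N)%N -> t != s -> cross (w t) (w s) = 0.
Proof. by move=> tN sN ts; apply/matrixP => i j; rewrite !mxE; exact: (ip_w_w gx0 gv gw ind). Qed.
Let cross_ww t : (t < N)%N -> cross (w t) (w t) = W.
Proof. by move=> tN; apply/matrixP => i j; rewrite !mxE; exact: (ip_w_same gw). Qed.

Let cross_v_err t s : (t < N)%N -> (s <= t)%N -> cross (v t) (err s) = 0.
Proof.
move=> tN; elim: s => [_|s IH st]; first exact: cross_v_x0.
have sN := ltn_trans st tN.
rewrite cross_errSr//; last exact: sv.
rewrite (IH (ltnW st)).
by rewrite mul0mx cross_v_v ?gtn_eqF// cross_v_w// mul0mx subr0 addr0.
Qed.

Let cross_w_err t s : (t < N)%N -> (s <= t)%N -> cross (w t) (err s) = 0.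
Proof.
move=> tN; elim: s => [_|s IH st]; first exact: cross_w_x0.
have sN := ltn_trans st tN.
rewrite cross_errSr//; last exact: sw.
rewrite (IH (ltnW st)).
by rewrite mul0mx cross_w_w ?gtn_eqF// cross_w_v// mul0mx subr0 addr0.
Qed.

Lemma cross_innovr k (X : T -> 'cV[R]_k) t : (t < N)%N -> vin (sqint P) X ->
  cross X (innov t) = cross X (err t) *m C^T + cross X (w t).
Proof.
move=> tN sX; have se := serr (ltnW tN); have sw' := sw tN.
by rewrite crossmxDr ?crossmx_mulr//; exact: (vin_mul lS).
Qed.

Let cross_v_innov t s : (t < N)%N -> (s <= t)%N -> cross (v t) (innov s) = 0.
Proof.
move=> tN st; have sN := leq_ltn_trans st tN.
by rewrite cross_innovr ?cross_v_err ?cross_v_w ?mul0mx ?addr0//; exact: sv.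
Qed.

Lemma cross_w_innov t s : (t < N)%N -> (s < t)%N -> cross (w t) (innov s) = 0.
Proof.
move=> tN st; have sN := ltn_trans st tN.
rewrite cross_innovr ?cross_w_err ?cross_w_w ?mul0mx ?addr0 ?gtn_eqF//; [exact: ltnW|exact: sw].
Qed.

Lemma cross_err_innov t : (t < N)%N -> cross (err t) (innov t) = errcov t *m C^T.
Proof.
move=> tN; rewrite cross_innovr//; last exact: serr (ltnW tN).
by rewrite -(crossmx_tr P (w t)) cross_w_err// trmx0 addr0.
Qed.

Lemma cross_innov t : (t < N)%N -> cross (innov t) (innov t) = innovcov t.
Proof.
move=> tN; rewrite cross_innovr//; last exact: sinnov.
have se := serr (ltnW tN); have sw' := sw tN.
have -> : cross (innov t) (err t) = C *m errcov t.
  by rewrite -crossmx_tr cross_err_innov// trmx_mul trmxK crossmx_tr.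
have -> : cross (innov t) (w t) = W.
  by rewrite -crossmx_tr cross_innovr// cross_w_err// mul0mx add0r cross_ww// -(cross_ww tN) crossmx_tr.
by [].
Qed.

Lemma cross_errSl k (X : T -> 'cV[R]_k) t : (t < N)%N -> vin (sqint P) X ->
  cross (err t.+1) X = (A - gain t *m C) *m cross (err t) X
    + (cross (v t) X - gain t *m cross (w t) X).
Proof.
move=> tN sX; rewrite -crossmx_tr cross_errSr//.
rewrite [LHS]linearD [X in _ + X]linearB /=.
by rewrite !trmx_mul !trmxK !crossmx_tr.
Qed.

Lemma gain_innovcov t : innovcov t \in unitmx -> gain t *m innovcov t = A *m errcov t *m C^T.
Proof. by move=> u; rewrite /gain /kalman_gain -mulmxA (mulVmx u) mulmx1. Qed.

(** The Kalman gain is the choice that makes the new error orthogonal to the newest innovation;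
    orthogonality to older innovations is inherited through the recursion. *)
Lemma cross_err_innov_past t s : (t <= N)%N -> (s < t)%N ->
  (forall r, (r < t)%N -> innovcov r \in unitmx) -> cross (err t) (innov s) = 0.
Proof.
elim: t => // t IH tN st uni.
have sN := leq_trans st tN.
rewrite cross_errSl//; last exact: sinnov.
rewrite cross_v_innov// sub0r.
have [->|ts] := eqVneq s t.
  (* Newest innovation: the covariance is [A T C' - K (C T C' + W)], which is 0 by
     [gain_innovcov]. *)
  rewrite cross_err_innov// cross_innovr//; last exact: sw.
  rewrite cross_w_err// mul0mx add0r cross_ww//.
  rewrite mulmxBl -addrA -opprD -!(mulmxA (gain t)) -mulmxDr (mulmxA C).
  by rewrite gain_innovcov ?uni// mulmxA subrr.
have st' : (s < t)%N by rewrite ltn_neqAle ts -ltnS.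
rewrite IH//; last 2 first.
- exact: ltnW.
- by move=> r rt; apply: uni; exact: ltnW.
by rewrite mulmx0 cross_w_innov// mulmx0 oppr0 addr0.
Qed.

End filter.

(** * Conditional expectation of the state *)

(** Carries the measurability of a law, a condition on the space of trajectories, to the sample
    space along the map [h] that sends an outcome to its trajectory. *)
Lemma adapted_pullback {R : realType} {U U' : Type} (F : set (set U)) (G : set (U' -> R))
    (phi : U' -> R) (h : U -> U') : sigma_algebra setT F ->
  sigma_measurable G phi -> (forall c, G c -> adapted F (fun z => c (h z))) ->
  adapted F (fun z => phi (h z)).
Proof.
move=> sF mphi Gc D mD.
have : sigma_gen G `<=` image_set_system setT h F.
  apply: sigma_gen_sub; first exact: sigma_algebra_image.
  by move=> c /Gc Fc D' mD'; rewrite /image_set_system /= setTI; exact: Fc.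
by move=> /(_ _ (mphi D mD)); rewrite /image_set_system /= setTI.
Qed.

Section condexp_unique.
Context {d : measure_display} {T : measurableType d} {R : realType}.
Variable P : probability T R.

(** The event that [Y] is at least [Y'] and its complement both lie in the sigma-algebra; the
    difference integrates to 0 over each, hence so does its absolute value over the whole space. *)
Lemma ae_eq_of_integrals (G : set (T -> R)) (Y Y' : T -> R) :
  P.-integrable setT (EFin \o Y) -> P.-integrable setT (EFin \o Y') ->
  sigma_measurable G Y -> sigma_measurable G Y' ->
  (forall E, sigma_gen G E -> (\int[P]_(w in E) (Y w)%:E = \int[P]_(w in E) (Y' w)%:E)%E) ->
  {ae P, forall z, Y z = Y' z}.
Proof.
move=> iY iY' GY GY' E.
have mY : measurable_fun setT Y by apply/measurable_EFinP; exact: measurable_int iY.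
have mY' : measurable_fun setT Y' by apply/measurable_EFinP; exact: measurable_int iY'.
have iD : P.-integrable setT (EFin \o (fun w => Y w - Y' w)).
  exact: (@integrableB _ _ _ P setT measurableT _ _ iY iY').
have sG := sigma_algebra_sigma_gen G.
have GD : adapted (sigma_gen G) (fun w => Y w + -1 * Y' w).
  by apply: adaptedD => //; apply: adaptedZ.
have zero S : sigma_gen G S -> measurable S -> \int[P]_(w in S) (Y w - Y' w) = 0.
  move=> GS mS.
  have iYS : P.-integrable S (EFin \o Y) by exact: (integrableS measurableT).
  have iYS' : P.-integrable S (EFin \o Y') by exact: (integrableS measurableT).
  by rewrite RintegralB// /Rintegral E// subrr.
pose S := [set w | 0 <= Y w - Y' w].
have ES : S = (fun w => Y w + -1 * Y' w) @^-1` `[0, +oo[.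
  by apply/seteqP; split => w; rewrite /S /= in_itv/= andbT mulN1r.
have GS : sigma_gen G S by rewrite ES; exact: GD.
have mS : measurable S.
  rewrite ES -[X in measurable X]setTI.
  have -> : (fun w => Y w + -1 * Y' w) = (fun w => Y w - Y' w).
    by apply/funext => w; rewrite mulN1r.
  by apply: measurable_funB.
have GC : sigma_gen G (~` S).
  by have [_ sC _] := sG; rewrite -setTD; exact: sC.
have mC := measurableC mS.
have : \int[P]_w `|Y w - Y' w| = 0.
  have iN := @integrable_norm _ _ _ P setT _ iD.
  rewrite -(setUv S) Rintegral_setU//; last 2 first.
  - by rewrite setUv.
  - by apply/disj_setPCl.
  have -> : \int[P]_(w in S) `|Y w - Y' w| = \int[P]_(w in S) (Y w - Y' w).
    by apply: eq_Rintegral => w; rewrite inE => h; rewrite ger0_norm.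
  have -> : \int[P]_(w in ~` S) `|Y w - Y' w| = \int[P]_(w in ~` S) (- 1 * (Y w - Y' w)).
    apply: eq_Rintegral => w; rewrite inE /S /= => /negP; rewrite -ltNge => h.
    by rewrite ltr0_norm// mulN1r.
  rewrite RintegralZl//; last exact: (integrableS measurableT mC (@subsetT _ _) iD).
  by rewrite !zero// mulr0 addr0.
have iN := @integrable_norm _ _ _ P setT _ iD.
move=> h0.
have : (\int[P]_w `|(Y w - Y' w)%:E| = 0)%E.
  rewrite -[LHS]fineK; last exact: integrable_fin_num iN.
  by move: h0; rewrite /Rintegral => ->.
move=> h1; have [h2 _] := ae_eq_integral_abs P measurableT (measurable_int P iD).
by move: (h2 h1); apply: filterS => z /(_ I) [/eqP]; rewrite subr_eq0 => /eqP.
Qed.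

End condexp_unique.

Section closed_loops.
Context {d : measure_display} {T : measurableType d} {R : realType}.
Variable P : probability T R.
Variables (N n m1 m2 p1 p2 : nat).
Variables (A : 'M[R]_n) (B : 'M[R]_(n, m1 + m2)) (C : 'M[R]_(p1 + p2, n)).
Variables (X0 V : 'M[R]_n) (W : 'M[R]_(p1 + p2)).
Variables (x0 : T -> 'cV[R]_n) (v : nat -> T -> 'cV[R]_n) (w : nat -> T -> 'cV[R]_(p1 + p2)).
Hypothesis gx0 : centered_gaussian P x0 X0.
Hypothesis gv : forall t, (t < N)%N -> centered_gaussian P (v t) V.
Hypothesis gw : forall t, (t < N)%N -> centered_gaussian P (w t) W.
Hypothesis ind : independent_noise P N x0 v w.

Notation err := (err P A C W x0 v w).
Notation innov := (innov P A C W x0 v w).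
Notation gain := (gain P A C W x0 v w).
Notation errcov := (errcov P A C W x0 v w).
Notation innovcov := (innovcov P A C W x0 v w).

Let Ls k (X : T -> 'cV[R]_k) := @noise_sqint _ _ _ P N n _ X0 V W x0 v w gx0 gv gw ind k X.

Section one_loop.
Variables (f : law R (m1 + m2) (p1 + p2)).
Variables (x : nat -> T -> 'cV[R]_n) (y : nat -> T -> 'cV[R]_(p1 + p2)).
Variables (u : nat -> T -> 'cV[R]_(m1 + m2)).
Hypothesis cf : centralized N f.
Hypothesis cl : closed_loop N A B C x0 v w f x y u.

Definition predicted t z := x t z - err t z.

Lemma predicted0 z : predicted 0 z = 0.
Proof. by rewrite /predicted cl.1 subrr. Qed.

(** The process noise cancels in [x - err], and the rest of the error recursion reassembles into the
    innovation. *)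
Lemma predictedS t z : (t < N)%N ->
  predicted t.+1 z = A *m predicted t z + B *m u t z + gain t *m innov t z.
Proof.
move=> tN; have [_ _ E] := cl.2 t tN z.
rewrite /predicted E errS /innov mulmxBr mulmxBl mulmxDr -!mulmxA.
set a := A *m x t z; set b := B *m u t z; set c := A *m err t z.
set e := gain t *m (C *m err t z); set g := gain t *m w t z.
rewrite opprD opprB !opprD !opprK; apply/matrixP => i j; rewrite !mxE; ring.
Qed.

Lemma obsE t z : (t < N)%N -> y t z = C *m predicted t z + innov t z.
Proof.
by move=> tN; have [-> _ _] := cl.2 t tN z; rewrite /predicted /innov mulmxBr addrA subrK.
Qed.

(** The loop runs forward from the innovations, whatever the law. The sigma-algebra is left general:
    taken as all measurable sets it yields measurability of the signals, and taken as the one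
    generated by the Gaussian variables orthogonal to the error it encloses the history. *)
Lemma adapted_loop (F : set (set T)) t : sigma_algebra setT F -> (t <= N)%N ->
  (forall s, (s < t)%N -> vin (adapted F) (innov s)) ->
  forall s, (s <= t)%N -> vin (adapted F) (predicted s) /\
   forall r, (r < s)%N -> vin (adapted F) (y r) /\ vin (adapted F) (u r).
Proof.
move=> sF tN Fi; have lF := linear_set_adapted (R := R) sF.
elim=> [_|s IH st].
  by split => // i; under eq_fun do rewrite predicted0; exact: (vin0 lF).
have [Fp Fyu] := IH (ltnW st).
have sN := leq_trans st tN.
have Fy : vin (adapted F) (y s).
  move=> i; under eq_fun do rewrite obsE//.
  by apply: (vinD lF); [exact: (vin_mul lF)|exact: Fi].
(* The law may be nonlinear, so its measurability is pulled back along the trajectories; it may use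
   the current observation [y s], which is why that one is treated before. *)
have Fu : vin (adapted F) (u s).
  move=> i.
  have -> : (fun z => u s z i 0) = (fun z => f s (fun r => y r z, fun r => u r z) i 0).
    by apply/funext => z; have [_ -> _] := cl.2 s sN z.
  apply: (adapted_pullback sF (cf sN i)) => c [[[r [k [rs ->]]]|[r [k [rs ->]]]]|[k ->]] /=.
  - exact: (Fyu r rs).1.
  - exact: (Fyu r rs).2.
  - exact: Fy.
split.
  move=> i; under eq_fun do rewrite predictedS//.
  apply: (vinD lF); last by apply: (vin_mul lF); exact: Fi.
  by apply: (vinD lF); exact: (vin_mul lF).
move=> r; rewrite ltnS leq_eqVlt => /orP[/eqP -> //|rs]; exact: Fyu.
Qed.

(** The opposite direction: each innovation in the recursion is rewritten as [y - C *m predicted],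
    so the prediction is computed from observed signals only. *)
Lemma adapted_pred_history t s : (s <= t)%N -> (t <= N)%N ->
  vin (adapted (sigma_gen (history y u t))) (predicted s).
Proof.
have sF := sigma_algebra_sigma_gen (history y u t).
have lF := linear_set_adapted (R := R) sF.
have Hy r : (r < t)%N -> vin (adapted (sigma_gen (history y u t))) (y r).
  move=> rt i; apply: adapted_sigma_gen.
  by exists (fun h : signals R _ _ => h.1 r i 0) => //; left; exists r, i.
have Hu r : (r < t)%N -> vin (adapted (sigma_gen (history y u t))) (u r).
  move=> rt i; apply: adapted_sigma_gen.
  by exists (fun h : signals R _ _ => h.2 r i 0) => //; right; exists r, i.
move=> st tN; elim: s st => [_ i|s IH st i].
  by under eq_fun do rewrite predicted0; exact: (vin0 lF).
have sN := leq_trans st tN; have Fp := IH (ltnW st).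
have -> : (fun z => predicted s.+1 z i 0) =
   (fun z => (A *m predicted s z + B *m u s z + gain s *m (y s z - C *m predicted s z)) i 0).
  by apply/funext => z; rewrite predictedS// obsE// (addrC (C *m _)) addrK.
apply: (vinD lF).
  by apply: (vinD lF); apply: (vin_mul lF) => //; exact: Hu.
by apply: (vin_mul lF); apply: (vinB lF); [exact: Hy|exact: (vin_mul lF)].
Qed.

Lemma measurable_loop t : (t <= N)%N -> vin (measurable_fun setT) (predicted t) /\
  forall r, (r < t)%N -> vin (measurable_fun setT) (y r) /\ vin (measurable_fun setT) (u r).
Proof.
move=> tN.
have aM (g : T -> R) : adapted (measurable : set (set T)) g -> measurable_fun setT g.
  by move=> mg _ D mD; rewrite setTI; exact: mg.
have [] := @adapted_loop measurable t (sigma_algebra_measurable _) tN _ t (leqnn t).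
  move=> s st i D mD; rewrite -[X in measurable X]setTI.
  have sN := leq_trans st tN.
  by have [ms _] := Ls (innov_noise A C gx0 gv gw ind sN) i; exact: ms.
move=> h1 h2; split; first by move=> i; apply: aM; exact: h1.
by move=> r rt; have [h3 h4] := h2 r rt; split=> i; apply: aM; [exact: h3|exact: h4].
Qed.

(** Past signals are measurable functions of past innovations, which belong to the noise space and
    are orthogonal to the error; [gaussian_orthogonal] applies to the sigma-algebra enclosing the
    history. *)
Lemma history_err t i E : (t <= N)%N -> (forall r, (r < t)%N -> innovcov r \in unitmx) ->
  sigma_gen (history y u t) E ->
  measurable E /\ (\int[P]_(z in E) (err t z i 0)%:E = 0)%E.
Proof.
move=> tN uni HE.
have Le := err_noise A C gx0 gv gw ind tN i.
apply: (gaussian_orthogonal (noise_space_gaussian gx0 gv gw ind) Le).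
set G := [set g | _].
have sF := sigma_algebra_sigma_gen G.
have Fi s : (s < t)%N -> vin (adapted (sigma_gen G)) (innov s).
  move=> st k; apply: adapted_sigma_gen; split.
    by apply: (innov_noise A C gx0 gv gw ind); exact: leq_trans st tN.
  have /matrixP/(_ i k) := cross_err_innov_past gx0 gv gw ind tN st uni.
  by rewrite !mxE.
have [_ h] := adapted_loop sF tN Fi (leqnn t).
move: HE; apply: sigma_gen_sub => // _ [c [[r [k [rt ->]]]|[r [k [rt ->]]]] ->] /=.
- exact: (h r rt).1.
- exact: (h r rt).2.
Qed.

Let ierr t i : (t <= N)%N -> P.-integrable setT (EFin \o (fun z => err t z i 0)).
Proof. by move=> tN; apply: integrable_sqint; exact: Ls (err_noise A C gx0 gv gw ind tN) i. Qed.

(** Integrability of the state is a hypothesis because an arbitrary law may destroy it; it is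
    supplied by [estimate] for a given loop and by square integrability for the explicit one. *)
Lemma pred_condexp t i : (t <= N)%N -> (forall r, (r < t)%N -> innovcov r \in unitmx) ->
  P.-integrable setT (EFin \o (fun z => x t z i 0)) ->
  is_condexp P (history y u t) (fun z => x t z i 0) (fun z => predicted t z i 0).
Proof.
move=> tN uni ix; have ie := ierr i tN.
have pE : (fun z => predicted t z i 0) = (fun z => x t z i 0 - err t z i 0).
  by apply/funext => z; rewrite !mxE.
split => //.
- by rewrite pE; exact: (@integrableB _ _ _ P setT measurableT _ _ ix ie).
- exact: adapted_pred_history.
- move=> E HE; have [mE eE] := history_err i tN uni HE.
  under eq_integral do rewrite [predicted t _ i 0]mxE [X in (_ + X)%:E]mxE EFinB.
  rewrite integralB//=; last 2 first.
  - exact: (integrableS measurableT mE (@subsetT _ _) ix).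
  - exact: (integrableS measurableT mE (@subsetT _ _) ie).
  by rewrite eE sube0.
Qed.

Lemma estimate_pred xh t : estimate P N x y u xh -> (t < N)%N ->
  (forall r, (r < t)%N -> innovcov r \in unitmx) ->
  {ae P, forall z, xh t z = predicted t z}.
Proof.
move=> est tN uni.
suff h : \forall z \near almost_everywhere P, forall i, xh t z i 0 = predicted t z i 0.
  by apply: filterS h => z h; apply/matrixP => i j; rewrite (ord1 j).
apply: filter_forall => i.
have [ix ixh Gxh Exh] := est t tN i.
have [_ ip' Gp Ep] := pred_condexp (ltnW tN) uni ix.
apply: (ae_eq_of_integrals ixh ip' Gxh Gp) => E HE.
by rewrite Exh// Ep.
Qed.

Lemma error_cov_errcov xh t : estimate P N x y u xh -> (t < N)%N ->
  (forall r, (r < t)%N -> innovcov r \in unitmx) ->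
  error_cov P (x t) (xh t) = errcov t.
Proof.
move=> est tN uni; apply/matrixP => i j; rewrite !mxE.
rewrite unlock /ip /Rintegral; congr fine.
have mx k : measurable_fun setT (fun z => (x t z - xh t z) k 0).
  have [ix ixh _ _] := est t tN k.
  under eq_fun do rewrite !mxE.
  apply: measurable_funB; apply/measurable_EFinP; [exact: measurable_int ix|exact: measurable_int ixh].
have se k := Ls (err_noise A C gx0 gv gw ind (ltnW tN)) k.
apply: ae_eq_integral => //.
- by apply/measurable_EFinP; apply: measurable_funM; exact: mx.
- by apply/measurable_EFinP; apply: measurable_funM; [exact: (se i).1|exact: (se j).1].
apply: filterS (estimate_pred est tN uni) => z h _.
by rewrite h /predicted subKr.
Qed.

End one_loop.
End closed_loops.

(** * Loops in gain form *)

Section gain_loops.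
Context {d : measure_display} {T : measurableType d} {R : realType}.
Variable P : probability T R.
Variables (N n m1 m2 p1 p2 : nat).
Variables (A : 'M[R]_n) (B : 'M[R]_(n, m1 + m2)) (C : 'M[R]_(p1 + p2, n)).
Variables (Q S : 'M[R]_n) (Ru : 'M[R]_(m1 + m2)).
Variables (X0 V : 'M[R]_n) (W : 'M[R]_(p1 + p2)).
Variables (x0 : T -> 'cV[R]_n) (v : nat -> T -> 'cV[R]_n) (w : nat -> T -> 'cV[R]_(p1 + p2)).
Hypothesis gx0 : centered_gaussian P x0 X0.
Hypothesis gv : forall t, (t < N)%N -> centered_gaussian P (v t) V.
Hypothesis gw : forall t, (t < N)%N -> centered_gaussian P (w t) W.
Hypothesis ind : independent_noise P N x0 v w.

Notation L := (noise_space N x0 v w).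
Notation cross := (crossmx P).
Notation err := (err P A C W x0 v w).
Notation innov := (innov P A C W x0 v w).
Notation gain := (gain P A C W x0 v w).
Notation errcov := (errcov P A C W x0 v w).
Notation innovcov := (innovcov P A C W x0 v w).
Notation sqintv := (vin (sqint P)).

Hypothesis uni : forall t, (t < N)%N -> innovcov t \in unitmx.

Variable H : nat -> 'M[R]_(m1 + m2, n).

Let lL := linear_set_noise gx0 gv gw ind.
Let lS := linear_set_sqint P.
Let Ls k (X : T -> 'cV[R]_k) := @noise_sqint _ _ _ P N n _ X0 V W x0 v w gx0 gv gw ind k X.
Let serr t : (t <= N)%N -> sqintv (err t).
Proof. by move=> tN; apply: Ls; exact: (err_noise A C gx0 gv gw ind). Qed.
Let sinnov t : (t < N)%N -> sqintv (innov t).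
Proof. by move=> tN; apply: Ls; exact: (innov_noise A C gx0 gv gw ind). Qed.

Section one_gain.
Variable F : nat -> 'M[R]_(m1 + m2, p1 + p2).

Fixpoint gain_pred (t : nat) : T -> 'cV[R]_n :=
  if t is t'.+1 then fun z =>
    (A - B *m H t') *m gain_pred t' z + (B *m F t' + gain t') *m innov t' z
  else fun=> 0.

Definition gain_state t z := gain_pred t z + err t z.
Definition gain_obs t z := C *m gain_pred t z + innov t z.
Definition gain_input t z := F t *m innov t z - H t *m gain_pred t z.

Notation signal := (signals R (m1 + m2) (p1 + p2)).

Fixpoint kalman_estimate (t : nat) : signal -> 'cV[R]_n :=
  if t is t'.+1 then fun h =>
    A *m kalman_estimate t' h + B *m h.2 t' + gain t' *m (h.1 t' - C *m kalman_estimate t' h)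
  else fun=> 0.

Definition gain_law : law R (m1 + m2) (p1 + p2) := fun t h =>
  F t *m h.1 t - (F t *m C + H t) *m kalman_estimate t h.

(** The explicit signals feed the filter exactly the innovations that generated them, which is what
    closes the loop between [gain_law] and the processes built from the noise. *)
Lemma kalman_estimate_gain t z :
  kalman_estimate t (fun s => gain_obs s z, fun s => gain_input s z) = gain_pred t z.
Proof.
elim: t => [//|t IH] /=; rewrite IH /gain_obs /gain_input (addrC (C *m _)) addrK.
rewrite mulmxBr mulmxBl mulmxDl !mulmxA; apply/matrixP => i j; rewrite !mxE; ring.
Qed.

Lemma gain_closed_loop :
  closed_loop N A B C x0 v w gain_law gain_state gain_obs gain_input.
Proof.
split=> [z|t tN z]; first by rewrite /gain_state add0r.
split.
- by rewrite /gain_obs /gain_state /innov mulmxDr addrA.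
- rewrite /gain_law kalman_estimate_gain /gain_obs /gain_input /=.
  rewrite mulmxDr mulmxDl !mulmxA; apply/matrixP => i j; rewrite !mxE; ring.
- rewrite /gain_state errS /= /gain_input /innov.
  rewrite !(mulmxBr, mulmxBl, mulmxDr, mulmxDl, mulmxN) !mulmxA.
  apply/matrixP => i j; rewrite !mxE; ring.
Qed.

Lemma kalman_estimate_adapted (E : set (set signal)) t : sigma_algebra setT E ->
  (forall c, info_common t c -> adapted E c) -> vin (adapted E) (kalman_estimate t).
Proof.
move=> sE; have lE := linear_set_adapted (R := R) sE.
elim: t => [_|t IH Ec]; first exact: (vin0 lE).
have Ht : vin (adapted E) (kalman_estimate t).
  apply: IH => c [[s [k [st ->]]]|[s [k [st ->]]]]; apply: Ec; [left|right];
    by exists s, k; split => //; exact: ltnW.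
have Hy : vin (adapted E) (fun h : signal => h.1 t).
  by move=> k; apply: Ec; left; exists t, k.
have Hu : vin (adapted E) (fun h : signal => h.2 t).
  by move=> k; apply: Ec; right; exists t, k.
apply: (vinD lE).
  by apply: (vinD lE); exact: (vin_mul lE).
by apply: (vin_mul lE); apply: (vinB lE) => //; exact: (vin_mul lE).
Qed.

Lemma gain_law_centralized : centralized N gain_law.
Proof.
move=> t tN.
have sE := sigma_algebra_sigma_gen (@info1 R m1 m2 p1 p2 t).
have lE := linear_set_adapted (R := R) sE.
apply: (vinB lE); apply: (vin_mul lE).
  by move=> k; apply: adapted_sigma_gen; right; exists k.
by apply: kalman_estimate_adapted => // c tc; apply: adapted_sigma_gen; left.
Qed.

Lemma gain_law_admissible : (forall t, (t < N)%N -> dlsubmx (F t) = 0) ->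
  admissible N gain_law.
Proof.
move=> F0 t tN; split.
  have h := gain_law_centralized tN => k.
  by under eq_fun do rewrite mxE; exact: h.
have sE := sigma_algebra_sigma_gen (@info2 R m1 m2 p1 p2 t).
have lE := linear_set_adapted (R := R) sE.
suff h : vin (adapted (sigma_gen (@info2 R m1 m2 p1 p2 t))) (fun h : signal => dsubmx (gain_law t h)).
  by move=> k; exact: h.
have -> : (fun h : signal => dsubmx (gain_law t h)) = (fun h : signal =>
    drsubmx (F t) *m dsubmx (h.1 t) - dsubmx (F t *m C + H t) *m kalman_estimate t h).
  apply/funext => h; rewrite /gain_law linearB /= !mul_dsub_mx; congr (_ - _).
  (* A vanishing 21 block leaves in the second player's input only the second block of the current
     observation. *)
  rewrite -[F t]submxK -[h.1 t]vsubmxK mul_block_col col_mxKd F0// mul0mx add0r.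
  by rewrite col_mxKd block_mxKdr.
apply: (vinB lE); apply: (vin_mul lE).
  by move=> k; apply: adapted_sigma_gen; right; exists k.
by apply: kalman_estimate_adapted => // c tc; apply: adapted_sigma_gen; left.
Qed.

Lemma gain_pred_noise t : (t <= N)%N -> vin L (gain_pred t).
Proof.
elim: t => [_|t IH tN]; first exact: (vin0 lL).
apply: (vinD lL); apply: (vin_mul lL); first exact: IH (ltnW tN).
exact: (innov_noise A C gx0 gv gw ind).
Qed.

Let spred t : (t <= N)%N -> sqintv (gain_pred t).
Proof. by move=> tN; apply: Ls; exact: gain_pred_noise. Qed.

Lemma gain_state_sqint t : (t <= N)%N -> sqintv (gain_state t).
Proof. by move=> tN; apply: (vinD lS); [exact: spred|exact: serr]. Qed.

Lemma gain_input_sqint t : (t < N)%N -> sqintv (gain_input t).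
Proof.
by move=> tN; apply: (vinB lS); apply: (vin_mul lS); [exact: sinnov|exact: spred (ltnW tN)].
Qed.

Lemma gain_estimate : estimate P N gain_state gain_obs gain_input gain_pred.
Proof.
move=> t tN i.
have -> : (fun z => gain_pred t z i 0) =
    (fun z => predicted P A C W x0 v w gain_state t z i 0).
  by apply/funext => z; rewrite /predicted /gain_state addrK.
apply: (pred_condexp gx0 gv gw ind gain_law_centralized gain_closed_loop (ltnW tN)).
- by move=> r rt; apply: uni; exact: ltn_trans rt tN.
- by apply: integrable_sqint; exact: gain_state_sqint (ltnW tN) i.
Qed.

Lemma gain_gain_form : gain_form P N C H F gain_obs gain_input gain_pred.
Proof.
move=> t tN; apply: nearW => z; rewrite /gain_obs /gain_input.
rewrite mulmxDr mulmxDl !mulmxA; apply/matrixP => i j; rewrite !mxE; ring.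
Qed.

Lemma cross_gain_pred k (X : T -> 'cV[R]_k) t : (t <= N)%N -> sqintv X ->
  (forall s, (s < t)%N -> cross X (innov s) = 0) -> cross X (gain_pred t) = 0.
Proof.
move=> tN sX; elim: t tN => [_ _|t IH tN Xi]; first exact: crossmx0r.
have sp := spred (ltnW tN); have si := sinnov tN.
rewrite crossmxDr//; try exact: (vin_mul lS).
rewrite !crossmx_mulr// Xi// IH ?mul0mx ?addr0//; first exact: ltnW.
by move=> s st; apply: Xi; exact: ltnW.
Qed.

Fixpoint pred_cov (t : nat) : 'M[R]_n :=
  if t is t'.+1 then
    (A - B *m H t') *m pred_cov t' *m (A - B *m H t')^T
    + (B *m F t' + gain t') *m innovcov t' *m (B *m F t' + gain t')^T
  else 0.

Let uni_lt t : (t <= N)%N -> forall r, (r < t)%N -> innovcov r \in unitmx.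
Proof. by move=> tN r rt; apply: uni; exact: leq_trans rt tN. Qed.

Lemma cross_err_gain_pred t : (t <= N)%N -> cross (err t) (gain_pred t) = 0.
Proof.
move=> tN; apply: cross_gain_pred => //; first exact: serr.
by move=> s st; apply: (cross_err_innov_past gx0 gv gw ind tN st); exact: uni_lt.
Qed.

(** Innovations are white: the current one is [C *m err t + w t], both terms are orthogonal to
    earlier innovations, and the prediction is a combination of those. *)
Lemma cross_innov_gain_pred t : (t < N)%N -> cross (innov t) (gain_pred t) = 0.
Proof.
move=> tN; apply: (cross_gain_pred (ltnW tN)); first exact: sinnov.
move=> s st; have sN := ltn_trans st tN.
rewrite -crossmx_tr (cross_innovr A C gx0 gv gw ind tN); last exact: sinnov.
rewrite -[cross (innov s) (err t)]crossmx_tr.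
rewrite (cross_err_innov_past gx0 gv gw ind (ltnW tN) st); last exact: (uni_lt (ltnW tN)).
rewrite -[cross _ (w t)]crossmx_tr (cross_w_innov A C gx0 gv gw ind tN st).
by rewrite !trmx0 mul0mx addr0 trmx0.
Qed.

Let sandwich {a b c} {X : T -> 'cV[R]_a} {Y : T -> 'cV[R]_b}
    (M1 : 'M[R]_(c, a)) (M2 : 'M[R]_(c, b)) : sqintv X -> sqintv Y -> cross X Y = 0 ->
  cross (fun z => M1 *m X z + M2 *m Y z) (fun z => M1 *m X z + M2 *m Y z) =
  M1 *m cross X X *m M1^T + M2 *m cross Y Y *m M2^T.
Proof.
move=> sX sY XY.
have s1 : sqintv (fun z => M1 *m X z) by exact: (vin_mul lS).
have s2 : sqintv (fun z => M2 *m Y z) by exact: (vin_mul lS).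
have YX : cross Y X = 0 by rewrite -crossmx_tr XY trmx0.
rewrite crossmxDl ?crossmxDr//; try exact: (vinD lS).
by rewrite !crossmx_mull// !crossmx_mulr// XY YX !mul0mx !mulmx0 addr0 add0r !mulmxA.
Qed.

Lemma gain_pred_cov t : (t <= N)%N -> cross (gain_pred t) (gain_pred t) = pred_cov t.
Proof.
elim: t => [_|t IH tN]; first exact: crossmx0r.
rewrite sandwich; [|exact: spred (ltnW tN)|exact: sinnov|]; last first.
  by rewrite -crossmx_tr cross_innov_gain_pred// trmx0.
by rewrite IH ?(ltnW tN)// (cross_innov A C gx0 gv gw ind tN).
Qed.

Lemma gain_state_cov t : (t <= N)%N ->
  cross (gain_state t) (gain_state t) = pred_cov t + errcov t.
Proof.
move=> tN; have := sandwich 1%:M 1%:M (spred tN) (serr tN).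
rewrite -crossmx_tr cross_err_gain_pred// trmx0 => /(_ erefl).
rewrite trmx1 !mulmx1 !mul1mx gain_pred_cov// => <-.
by congr cross; apply/funext => z; rewrite !mul1mx.
Qed.

Lemma gain_input_cov t : (t < N)%N -> cross (gain_input t) (gain_input t) =
  F t *m innovcov t *m (F t)^T + H t *m pred_cov t *m (H t)^T.
Proof.
move=> tN; have := sandwich (F t) (- H t) (sinnov tN) (spred (ltnW tN)).
rewrite cross_innov_gain_pred// => /(_ erefl).
rewrite linearN /= mulmxN !mulNmx opprK gain_pred_cov ?(ltnW tN)//.
rewrite (cross_innov A C gx0 gv gw ind tN) => <-.
by congr cross; apply/funext => z; rewrite /gain_input mulNmx.
Qed.

Definition gain_cost_formula : R :=
  \sum_(t < N) (\tr (Q *m (pred_cov t + errcov t)) +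
    \tr (Ru *m (F t *m innovcov t *m (F t)^T + H t *m pred_cov t *m (H t)^T)))
  + \tr (S *m (pred_cov N + errcov N)).

Lemma cost_gain_loop :
  cost P N Q S Ru gain_state gain_input = gain_cost_formula%:E.
Proof.
have sx (t : 'I_N) := gain_state_sqint (ltnW (ltn_ord t)).
have su (t : 'I_N) := gain_input_sqint (ltn_ord t).
have qx (t : 'I_N) := quad_moment Q (sx t).
have qu (t : 'I_N) := quad_moment Ru (su t).
have qN := quad_moment S (gain_state_sqint (leqnn N)).
have iD (t : 'I_N) := @integrableD _ _ _ P setT measurableT _ _ (qx t).1 (qu t).1.
have [iS eS] := integrable_sumR (index_enum 'I_N) iD.
rewrite /cost unlock /gain_cost_formula.
have iT := @integrableD _ _ _ P setT measurableT _ _ iS qN.1.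
rewrite -[LHS]fineK; last exact: integrable_fin_num iT.
congr EFin; rewrite -/(Rintegral _ _ _) RintegralD//; [congr (_ + _)|exact: qN.1].
  rewrite [LHS]eS; apply: eq_bigr => t _.
  rewrite RintegralD//; [|exact: (qx t).1|exact: (qu t).1].
  rewrite (qx t).2 (qu t).2 gain_input_cov// gain_state_cov//; exact: ltnW.
by rewrite qN.2 gain_state_cov.
Qed.

End one_gain.

(** Outside a null set, a loop in gain form follows the explicit linear loop, whatever law generates
    it; its cost therefore depends on the gains alone. *)
Lemma cost_gain_form F f x y u xh : centralized N f ->
  closed_loop N A B C x0 v w f x y u -> estimate P N x y u xh ->
  gain_form P N C H F y u xh -> cost P N Q S Ru x u = (gain_cost_formula F)%:E.
Proof.
move=> cf cl est gf; rewrite -cost_gain_loop.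
pose pr := predicted P A C W x0 v w x.
(* A single null set for all times, with [xh] replaced by the prediction. *)
have prE : \forall z \near almost_everywhere P, forall t, (t < N)%N ->
    u t z = F t *m innov t z - H t *m pr t z.
  apply/ae_foralln => t.
  have [tN|tN] := ltnP t N; last by apply: nearW => z.
  have uni_t r : (r < t)%N -> innovcov r \in unitmx.
    by move=> rt; apply: uni; exact: ltn_trans rt tN.
  have := estimate_pred gx0 gv gw ind cf cl est tN uni_t.
  move: (gf t tN); apply: filterS2 => z uE xhE _.
  rewrite uE xhE (obsE P W cl z tN) -/pr.
  rewrite mulmxDr mulmxDl !mulmxA; apply/matrixP => i j; rewrite !mxE; ring.
(* Measurability of the signals of the given loop allows its expected cost to be replaced by that of
   an almost everywhere equal integrand. *)
have [mN myu] := measurable_loop gx0 gv gw ind cf cl (leqnn N).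
have mx t : (t <= N)%N -> vin (measurable_fun setT) (x t).
  move=> tN i; have [mp _] := measurable_loop gx0 gv gw ind cf cl tN.
  have [me _] := serr tN i.
  have -> : (fun z => x t z i 0) = (fun z => pr t z i 0 + err t z i 0).
    by apply/funext => z; rewrite /pr /predicted !mxE subrK.
  exact: measurable_funD (mp i) me.
have mquad k (M : 'M[R]_k) (X : T -> 'cV[R]_k) : vin (measurable_fun setT) X ->
    measurable_fun setT (fun z => quad M (X z)).
  move=> mX; under eq_fun do rewrite quadE.
  apply: measurable_sum => i; apply: measurable_sum => j.
  by apply: measurable_funM => //; apply: measurable_funM; exact: mX.
have mcost (x' : nat -> T -> 'cV[R]_n) (u' : nat -> T -> 'cV[R]_(m1 + m2)) :
    (forall t, (t <= N)%N -> vin (measurable_fun setT) (x' t)) ->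
    (forall t, (t < N)%N -> vin (measurable_fun setT) (u' t)) ->
    measurable_fun setT (fun z => \sum_(t < N) (quad Q (x' t z) + quad Ru (u' t z))
      + quad S (x' N z)).
  move=> mx' mu'; apply: measurable_funD; last by apply: mquad; exact: mx'.
  apply: measurable_sum => t; apply: measurable_funD; apply: mquad.
    by apply: mx'; exact: ltnW.
  exact: mu'.
rewrite /cost unlock; apply: ae_eq_integral => //.
- apply/measurable_EFinP; apply: mcost => // t tN; exact: (myu t tN).2.
- apply/measurable_EFinP; apply: mcost => t tN i.
    by have [] := gain_state_sqint F tN i.
  by have [] := gain_input_sqint F tN i.
apply: filterS prE => z uE _; congr EFin.
(* Pathwise induction outside the null set: both predictions start at 0 and are driven by the same
   innovations. *)
have pE t : (t <= N)%N -> pr t z = gain_pred F t z.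
  elim: t => [_|t IH tN]; first by rewrite /pr (predicted0 P W cl).
  rewrite /pr (predictedS P W cl z tN) -/pr uE// IH ?(ltnW tN)//=.
  rewrite !(mulmxBl, mulmxBr, mulmxDl) !mulmxA; apply/matrixP => i j; rewrite !mxE; ring.
have xE t : (t <= N)%N -> x t z = gain_state F t z.
  by move=> tN; rewrite /gain_state -pE// /pr /predicted subrK.
rewrite xE//; congr (_ + _); apply: eq_bigr => t _.
by rewrite xE ?uE ?pE//; exact: ltnW.
Qed.

(** The set in [gain_cost] is a singleton, so [xget] never falls back on its default value. *)
Lemma gain_costE F : gain_cost P N A B C Q S Ru x0 v w H F = gain_cost_formula F.
Proof.
rewrite /gain_cost (xget_unique _ (x := (gain_cost_formula F)%:E))//.
  exists (gain_law F), (gain_state F), (gain_obs F), (gain_input F), (gain_pred F).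
  split; [exact: gain_law_centralized|exact: gain_closed_loop|exact: gain_estimate| |].
    exact: gain_gain_form.
  by rewrite cost_gain_loop.
by move=> _ [f [x [y [u [xh [cf cl est gf ->]]]]]]; 
  exact: (cost_gain_form cf cl est gf).
Qed.

End gain_loops.

(** * Minimization over the gains *)

Lemma posdef_unitmx {R : realType} k (M : 'M[R]_k) : posdef M -> M \in unitmx.
Proof.
move=> [_ Mpos]; rewrite -row_free_unit; apply: inj_row_free => a aM.
apply/eqP/negPn/negP => a0; have := Mpos a^T.
rewrite trmx_eq0 => /(_ a0).
by rewrite /quad trmxK aM mul0mx mxE ltxx.
Qed.

Lemma quad_ge0 {R : realType} k (M : 'M[R]_k) : posdef M -> forall a, 0 <= quad M a.
Proof.
move=> [_ Mpos] a; have [->|a0] := eqVneq a 0; last exact: ltW (Mpos a a0).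
by rewrite /quad mulmx0 mxE.
Qed.

Lemma quad_congr {R : realType} k l (M : 'M[R]_k) (X : 'M[R]_(k, l)) a :
  quad (X^T *m M *m X) a = quad M (X *m a).
Proof. by rewrite /quad trmx_mul !mulmxA. Qed.

Lemma quadD {R : realType} k (M M' : 'M[R]_k) a : quad (M + M') a = quad M a + quad M' a.
Proof. by rewrite /quad mulmxDr mulmxDl mxE. Qed.

Lemma mxtrace_gram {R : realType} a b (D : 'M[R]_(a, b)) :
  \tr (D^T *m D) = \sum_j \sum_i D i j ^+ 2.
Proof. by apply: eq_bigr => j _; rewrite mxE; apply: eq_bigr => i _; rewrite mxE expr2. Qed.

Lemma mxtrace_gram_ge0 {R : realType} a b (D : 'M[R]_(a, b)) : 0 <= \tr (D^T *m D).
Proof. by rewrite mxtrace_gram; apply: sumr_ge0 => j _; apply: sumr_ge0 => i _; exact: sqr_ge0. Qed.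

Lemma mxtrace_gram_eq0 {R : realType} a b (D : 'M[R]_(a, b)) : \tr (D^T *m D) = 0 -> D = 0.
Proof.
rewrite mxtrace_gram => /eqP h; apply/matrixP => i j; rewrite mxE; apply/eqP.
have s0 k : 0 <= \sum_l D l k ^+ 2 by apply: sumr_ge0 => l _; exact: sqr_ge0.
move: h; rewrite psumr_eq0 => [|k _]; last exact: s0.
move=> /allP/(_ j (mem_index_enum _))/=; rewrite psumr_eq0 => [|l _]; last exact: sqr_ge0.
by move=> /allP/(_ i (mem_index_enum _))/=; rewrite sqrf_eq0.
Qed.

(** This identity matches the pairing of a direction with the multiplier matrix to the constraint
    term of the Lagrangian. *)
Lemma mxtrace_block_dl {R : realType} a1 a2 b1 b2
    (D : 'M[R]_(a1 + a2, b1 + b2)) (X : 'M[R]_(a2, b1)) :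
  \tr (D^T *m block_mx 0 0 X 0) = \tr (X^T *m dlsubmx D).
Proof.
rewrite -[D in LHS]submxK tr_block_mx mulmx_block mxtrace_block.
by rewrite !mulmx0 !add0r mxtrace0 addr0 -mxtrace_tr trmx_mul trmxK.
Qed.

Lemma dlsubmxDZ {R : realType} a1 a2 b1 b2 (X Y : 'M[R]_(a1 + a2, b1 + b2)) s :
  dlsubmx (X + s *: Y) = dlsubmx X + s *: dlsubmx Y.
Proof. by apply/matrixP => i j; rewrite !mxE. Qed.

Lemma linear_coef_eq0 {R : realType} (b c : R) : (forall s, 0 <= b * s + c * s ^+ 2) -> b = 0.
Proof.
move=> h; apply/eqP/negPn/negP => b0.
have k0 : 0 < `|c| + 1 by rewrite ltr_wpDl.
(* A test point of sign opposite to [b]; the [+ 1] keeps the denominator positive when [c = 0] and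
   makes the final factor [c - (|c| + 1)] negative. *)
have := h (- b / (`|c| + 1)).
have -> : b * (- b / (`|c| + 1)) + c * (- b / (`|c| + 1)) ^+ 2 =
    (b / (`|c| + 1)) ^+ 2 * (c - (`|c| + 1)) by field; rewrite gt_eqF.
rewrite leNgt => /negP; apply.
rewrite pmulr_rlt0; first by rewrite subr_lt0; apply: (le_lt_trans (ler_norm c)); rewrite ltrDl.
by rewrite exprn_even_gt0//= mulf_neq0// invr_neq0// gt_eqF.
Qed.

Section gain_optimization.
Context {R : realType}.
Variables (N n m p : nat).
Variables (A : 'M[R]_n) (B : 'M[R]_(n, m)) (Q S : 'M[R]_n) (Ru : 'M[R]_m).
Variables (H : nat -> 'M[R]_(m, n)) (K : nat -> 'M[R]_(n, p)).
Variables (Sg : nat -> 'M[R]_p).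
Hypotheses (pQ : posdef Q) (pRu : posdef Ru) (pS : posdef S).
Hypothesis Sg_sym : forall t, (t < N)%N -> (Sg t)^T = Sg t.

Let Acl t := A - B *m H t.

(* [cost_to_go_rev k] is [M (N - k)]. *)
Fixpoint cost_to_go_rev (k : nat) : 'M[R]_n :=
  if k is k'.+1 then
    let t := (N - k)%N in
    Q + (H t)^T *m Ru *m H t + (Acl t)^T *m cost_to_go_rev k' *m Acl t
  else S.

Definition cost_to_go t := cost_to_go_rev (N - t).
Notation M := cost_to_go.

Lemma cost_to_goN : M N = S.
Proof. by rewrite /M subnn. Qed.

Lemma cost_to_goS t : (t < N)%N ->
  M t = Q + (H t)^T *m Ru *m H t + (A - B *m H t)^T *m M t.+1 *m (A - B *m H t).
Proof. by move=> tN; rewrite /M -(subnSK tN) /= subnSK// (subKn (ltnW tN)). Qed.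

Lemma cost_to_go_posdef t : posdef (M t).
Proof.
rewrite /M; elim: (N - t)%N => [//|k [Msym Mpos]] /=.
have [Qsym Qpos] := pQ; have [Rsym _] := pRu.
split.
  rewrite [LHS]linearD [X in X + _]linearD /= !trmx_mul !trmxK Qsym Rsym Msym.
  by rewrite !mulmxA.
move=> a a0; rewrite !quadD !quad_congr -addrA ltr_pwDl ?Qpos// addr_ge0//; exact: quad_ge0.
Qed.

Lemma input_weight_unitmx t : Ru + B^T *m M t *m B \in unitmx.
Proof.
have [Msym _] := cost_to_go_posdef t; have [Rsym Rpos] := pRu.
apply: posdef_unitmx; split; first by rewrite linearD /= !trmx_mul trmxK Rsym Msym mulmxA.
move=> a a0; rewrite quadD quad_congr ltr_pwDl ?Rpos//; apply: quad_ge0.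
exact: cost_to_go_posdef.
Qed.

Definition stage_cost t (F : 'M[R]_(m, p)) : R :=
  \tr (Ru *m (F *m Sg t *m F^T)) +
  \tr (M t.+1 *m ((B *m F + K t) *m Sg t *m (B *m F + K t)^T)).

(** [tr (M k Z k)] is the cost still to be paid for the covariance accumulated by time [k]. The
    recursions of [M] and [Z] are dual under the trace, so adding this term to the cost already paid
    leaves only what the innovations inject. *)
Lemma telescoped_cost (Z E : nat -> 'M[R]_n) (F : nat -> 'M[R]_(m, p)) :
  Z 0%N = 0 ->
  (forall t, Z t.+1 = (A - B *m H t) *m Z t *m (A - B *m H t)^T
      + (B *m F t + K t) *m Sg t *m (B *m F t + K t)^T) ->
  \sum_(t < N) (\tr (Q *m (Z t + E t)) +
      \tr (Ru *m (F t *m Sg t *m (F t)^T + H t *m Z t *m (H t)^T)))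
    + \tr (S *m (Z N + E N)) =
  \sum_(t < N) \tr (Q *m E t) + \tr (S *m E N) + \sum_(t < N) stage_cost t (F t).
Proof.
move=> Z0 ZS.
have h k : (k <= N)%N ->
    \sum_(t < k) (\tr (Q *m Z t) + \tr (Ru *m (H t *m Z t *m (H t)^T))) + \tr (M k *m Z k)
    = \sum_(t < k) \tr (M t.+1 *m ((B *m F t + K t) *m Sg t *m (B *m F t + K t)^T)).
  elim: k => [_|k IH kN]; first by rewrite !big_ord0 Z0 mulmx0 mxtrace0 addr0.
  rewrite !big_ord_recr /= -(IH (ltnW kN)) ZS mulmxDr mxtraceD.
  suff -> : \tr (M k *m Z k) = \tr (Q *m Z k) + \tr (Ru *m (H k *m Z k *m (H k)^T))
      + \tr (M k.+1 *m ((A - B *m H k) *m Z k *m (A - B *m H k)^T)) by ring.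
  rewrite (cost_to_goS kN) (mulmxDl _ _ (Z k)) mxtraceD (mulmxDl _ _ (Z k)) mxtraceD.
  have -> : \tr ((H k)^T *m Ru *m H k *m Z k) = \tr (Ru *m (H k *m Z k *m (H k)^T)).
    by rewrite -!mulmxA mxtrace_mulC !mulmxA.
  have -> : \tr ((A - B *m H k)^T *m M k.+1 *m (A - B *m H k) *m Z k) =
      \tr (M k.+1 *m ((A - B *m H k) *m Z k *m (A - B *m H k)^T)).
    by rewrite -!mulmxA mxtrace_mulC !mulmxA.
  by [].
have hN := h N (leqnn N); rewrite cost_to_goN in hN.
have -> : \sum_(t < N) stage_cost t (F t) = \sum_(t < N) \tr (Ru *m (F t *m Sg t *m (F t)^T))
    + (\sum_(t < N) (\tr (Q *m Z t) + \tr (Ru *m (H t *m Z t *m (H t)^T))) + \tr (S *m Z N)).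
  by rewrite hN -big_split.
under eq_bigr do rewrite 2!mulmxDr 2!mxtraceD.
rewrite !big_split /= mulmxDr mxtraceD; ring.
Qed.

(* Half the gradient of [stage_cost t]. *)
Definition gradient t (F : 'M[R]_(m, p)) : 'M[R]_(m, p) :=
  (Ru *m F + B^T *m M t.+1 *m (B *m F + K t)) *m Sg t.

Definition curvature t (D : 'M[R]_(m, p)) : R :=
  \tr (Ru *m (D *m Sg t *m D^T)) + \tr (M t.+1 *m (B *m D *m Sg t *m (B *m D)^T)).

(** A sum of two quadratic forms along a line; in each of them the two mixed terms agree because
    [Ru], [M] and [Sg t] are symmetric. *)
Lemma stage_cost_expand t (F D : 'M[R]_(m, p)) s : (t < N)%N ->
  stage_cost t (F + s *: D) =
  stage_cost t F + 2 * \tr (D^T *m gradient t F) * s + curvature t D * s ^+ 2.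
Proof.
move=> tN.
have [Msym _] := cost_to_go_posdef t.+1; have [Rsym _] := pRu; have Ssym := Sg_sym tN.
have quadratic k (U : 'M[R]_k) (X Y : 'M[R]_(k, p)) : U^T = U ->
    \tr (U *m ((X + s *: Y) *m Sg t *m (X + s *: Y)^T)) =
    \tr (U *m (X *m Sg t *m X^T)) + 2 * \tr (Y^T *m (U *m X *m Sg t)) * s
    + \tr (U *m (Y *m Sg t *m Y^T)) * s ^+ 2.
  move=> Usym; rewrite [(X + _)^T]linearD /= [(s *: Y)^T]linearZ /=.
  rewrite !(mulmxDl, mulmxDr) -!(scalemxAl, scalemxAr) !mxtraceD !mxtraceZ.
  have -> : \tr (U *m (Y *m Sg t *m X^T)) = \tr (Y^T *m (U *m X *m Sg t)).
    rewrite -mxtrace_tr !trmx_mul trmxK Usym Ssym -!mulmxA [RHS]mxtrace_mulC -!mulmxA.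
    by rewrite [RHS]mxtrace_mulC -!mulmxA.
  have -> : \tr (U *m (X *m Sg t *m Y^T)) = \tr (Y^T *m (U *m X *m Sg t)).
    by rewrite [RHS]mxtrace_mulC -!mulmxA.
  by ring.
rewrite /stage_cost quadratic//.
have -> : B *m (F + s *: D) + K t = (B *m F + K t) + s *: (B *m D).
  by rewrite mulmxDr -scalemxAr addrAC.
rewrite quadratic//.
have -> : \tr (D^T *m gradient t F) = \tr (D^T *m (Ru *m F *m Sg t))
    + \tr (D^T *m (B^T *m M t.+1 *m (B *m F + K t) *m Sg t)).
  by rewrite -mxtraceD -mulmxDr -mulmxDl.
rewrite /curvature.
have -> : \tr ((B *m D)^T *m (M t.+1 *m (B *m F + K t) *m Sg t)) =
    \tr (D^T *m (B^T *m M t.+1 *m (B *m F + K t) *m Sg t)).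
  by rewrite trmx_mul -!mulmxA.
by ring.
Qed.

Lemma sum_stage_cost_expand (F D : nat -> 'M[R]_(m, p)) s :
  \sum_(t < N) stage_cost t (F t + s *: D t) =
  \sum_(t < N) stage_cost t (F t)
  + 2 * (\sum_(t < N) \tr ((D t)^T *m gradient t (F t))) * s
  + (\sum_(t < N) curvature t (D t)) * s ^+ 2.
Proof.
rewrite mulr_sumr !mulr_suml -!big_split /=; apply: eq_bigr => t _.
exact: stage_cost_expand.
Qed.

(** A linear equation in [F]: the covariance [Sg t] is divided out on the right and the weight
    [Ru + B^T *m M t.+1 *m B] on the left. The matrix [X] will be the multiplier. *)
Lemma gain_of_gradient t (F X : 'M[R]_(m, p)) : Sg t \in unitmx ->
  gradient t F = - X ->
  F = - (invmx (Ru + B^T *m M t.+1 *m B) *m (X *m invmx (Sg t) + B^T *m M t.+1 *m K t)).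
Proof.
move=> uS GX; have uW := input_weight_unitmx t.+1.
have : (Ru + B^T *m M t.+1 *m B) *m F + B^T *m M t.+1 *m K t = - X *m invmx (Sg t).
  by rewrite -GX /gradient mulmxK// mulmxDr mulmxDl addrA !mulmxA.
move=> /(congr1 (fun Y => Y - B^T *m M t.+1 *m K t)); rewrite addrK => h.
by rewrite -[LHS](mulKmx uW) h mulNmx -opprD mulmxN.
Qed.

End gain_optimization.

Section constrained_stationarity.
Context {R : realType}.
Variables (N n m1 m2 p1 p2 : nat).
Variables (A : 'M[R]_n) (B : 'M[R]_(n, m1 + m2)) (Q S : 'M[R]_n) (Ru : 'M[R]_(m1 + m2)).
Variables (H : nat -> 'M[R]_(m1 + m2, n)) (K : nat -> 'M[R]_(n, p1 + p2)).
Variables (Sg : nat -> 'M[R]_(p1 + p2)).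
Hypotheses (pQ : posdef Q) (pRu : posdef Ru) (pS : posdef S).
Hypothesis Sg_sym : forall t, (t < N)%N -> (Sg t)^T = Sg t.

Notation stage := (stage_cost N A B Q S Ru H K Sg).
Notation grad := (gradient N A B Q S Ru H K Sg).

(* The gradient with its 21 block erased is itself a feasible direction. *)
Lemma gradient_dl (F : nat -> 'M[R]_(m1 + m2, p1 + p2)) :
  (forall F' : nat -> 'M[R]_(m1 + m2, p1 + p2),
    (forall t, (t < N)%N -> dlsubmx (F' t) = dlsubmx (F t)) ->
    \sum_(t < N) stage t (F t) <= \sum_(t < N) stage t (F' t)) ->
  forall t, (t < N)%N -> grad t (F t) = block_mx 0 0 (dlsubmx (grad t (F t))) 0.
Proof.
move=> Fmin.
pose D t := grad t (F t) - block_mx 0 0 (dlsubmx (grad t (F t))) 0.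
have Ddl t : dlsubmx (D t) = 0.
  by rewrite /D -[X in X - _]submxK opp_block_mx add_block_mx block_mxKdl subrr.
have : 2 * (\sum_(t < N) \tr ((D t)^T *m grad t (F t))) = 0.
  (* The direction [D] keeps the 21 blocks fixed, so the increment of the cost is a nonnegative
     polynomial in [s] of either sign and its linear coefficient vanishes. *)
  apply: (@linear_coef_eq0 _ _ (\sum_(t < N) curvature N A B Q S Ru H Sg t (D t))) => s.
  have := Fmin (fun t => F t + s *: D t).
  rewrite sum_stage_cost_expand// -addrA lerDl; apply => t _.
  by rewrite dlsubmxDZ Ddl scaler0 addr0.
move=> /eqP; rewrite mulf_eq0 pnatr_eq0 /= => /eqP.
(* The erased block is orthogonal to [D] for the trace pairing, which leaves the sum of the squared
   entries of [D]. *)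
have DE t : \tr ((D t)^T *m grad t (F t)) = \tr ((D t)^T *m D t).
  transitivity (\tr ((D t)^T *m grad t (F t))
      - \tr ((D t)^T *m block_mx 0 0 (dlsubmx (grad t (F t))) 0)).
    by rewrite mxtrace_block_dl Ddl mulmx0 mxtrace0 subr0.
  by rewrite -raddfB -mulmxBr.
under eq_bigr do rewrite DE.
move=> /eqP; rewrite psumr_eq0 => [/allP h t tN|t _]; last exact: mxtrace_gram_ge0.
have /eqP/mxtrace_gram_eq0/eqP := h (Ordinal tN) (mem_index_enum _).
by rewrite subr_eq0 => /eqP.
Qed.

End constrained_stationarity.

(** The second player observes less than the first, so the larger sigma-algebra covers both; results
    on centralized laws then apply to the optimal law. *)
Lemma admissible_centralized {R : realType} m1 m2 p1 p2 N (f : law R (m1 + m2) (p1 + p2)) :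
  admissible N f -> centralized N f.
Proof.
move=> af t tN k; have [f1 f2] := af t tN.
have s12 : sigma_gen (@info2 R m1 m2 p1 p2 t) `<=` sigma_gen (@info1 R m1 m2 p1 p2 t).
  apply: sigma_gen_sub; first exact: sigma_algebra_sigma_gen.
  move=> c [tc|[j ->]]; apply: adapted_sigma_gen; [by left|right].
  by exists (rshift p1 j); apply/funext => h; rewrite mxE.
case: (split_ordP k) => i ->.
  by have := f1 i; under eq_fun do rewrite mxE.
by move=> D mD; apply: s12; have := f2 i D mD; under eq_fun do rewrite mxE.
Qed.

Theorem proposition4 (d : measure_display) (T : measurableType d) (R : realType)
    (P : probability T R) (N n m1 m2 p1 p2 : nat)
    (A : 'M[R]_n) (B : 'M[R]_(n, m1 + m2)) (C : 'M[R]_(p1 + p2, n))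
    (Q S : 'M[R]_n) (Ru : 'M[R]_(m1 + m2))
    (X0 V : 'M[R]_n) (W : 'M[R]_(p1 + p2))
    (x0 : T -> 'cV[R]_n) (v : nat -> T -> 'cV[R]_n)
    (w : nat -> T -> 'cV[R]_(p1 + p2))
    (Pm : nat -> 'M[R]_n) (H : nat -> 'M[R]_(m1 + m2, n))
    (f : law R (m1 + m2) (p1 + p2))
    (x xh : nat -> T -> 'cV[R]_n) (y : nat -> T -> 'cV[R]_(p1 + p2))
    (u : nat -> T -> 'cV[R]_(m1 + m2))
    (F : nat -> 'M[R]_(m1 + m2, p1 + p2)) :
  posdef Q -> posdef Ru -> posdef S ->
  centered_gaussian P x0 X0 ->
  (forall t, (t < N)%N -> centered_gaussian P (v t) V) ->
  (forall t, (t < N)%N -> centered_gaussian P (w t) W) ->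
  independent_noise P N x0 v w ->
  lqr N A B Q S Ru Pm H ->
  optimal P N A B C Q S Ru x0 v w f ->
  closed_loop N A B C x0 v w f x y u ->
  estimate P N x y u xh ->
  (forall t, (t < N)%N ->
    innovation_cov C W (error_cov P (x t) (xh t)) \in unitmx) ->
  gain_form P N C H F y u xh ->
  (forall t, (t < N)%N -> dlsubmx (F t) = 0) ->
  exists (M : nat -> 'M[R]_n) (Psi21 : nat -> 'M[R]_(m2, p1)),
    [/\ lagrange_multiplier P N A B C Q S Ru x0 v w H F Psi21,
        M N = S,
        forall t, (t < N)%N ->
          M t = Q + (H t)^T *m Ru *m H t
                + (A - B *m H t)^T *m M t.+1 *m (A - B *m H t)
      & forall t, (t < N)%N ->
          let Tt := error_cov P (x t) (xh t) in
          let Psi : 'M[R]_(m1 + m2, p1 + p2) := block_mx 0 0 (Psi21 t) 0 in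
          F t = - (invmx (Ru + B^T *m M t.+1 *m B)
                   *m (Psi *m invmx (innovation_cov C W Tt)
                       + B^T *m M t.+1 *m kalman_gain A C W Tt))].
Proof.
move=> pQ pRu pS gx0 gv gw ind _ [af opt] cl est uniT gf F21.
have cf := admissible_centralized af.
pose Sg := innovcov P A C W x0 v w.
pose K := gain P A C W x0 v w.
have uni t : (t < N)%N -> Sg t \in unitmx.
  (* Invertibility is assumed for the covariance of the actual error. Identifying that covariance
     with [errcov] at time [t] uses invertibility at all earlier times, hence the strong
     induction. *)
  elim/ltn_ind: t => t IH tN; rewrite /Sg /innovcov.
  rewrite -(error_cov_errcov gx0 gv gw ind cf cl est tN); first exact: uniT.
  by move=> r rt; apply: IH => //; exact: ltn_trans rt tN.
have covE t : (t < N)%N -> error_cov P (x t) (xh t) = errcov P A C W x0 v w t.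
  move=> tN; apply: (error_cov_errcov gx0 gv gw ind cf cl est tN) => r rt.
  by apply: uni; exact: ltn_trans rt tN.
have Ssym t : (t < N)%N -> (Sg t)^T = Sg t.
  by move=> tN; rewrite /Sg -(cross_innov A C gx0 gv gw ind tN) crossmx_tr.
pose stage := stage_cost N A B Q S Ru H K Sg.
pose grad := gradient N A B Q S Ru H K Sg.
pose J := gain_cost_formula P N A B C Q S Ru W x0 v w H.
pose c0 := \sum_(t < N) \tr (Q *m errcov P A C W x0 v w t) + \tr (S *m errcov P A C W x0 v w N).
have JE F' : J F' = c0 + \sum_(t < N) stage t (F' t).
  exact: (@telescoped_cost _ N n _ _ A B Q S Ru H K Sg (pred_cov P A B C W x0 v w H F')
    (errcov P A C W x0 v w)).
have gcE F' : gain_cost P N A B C Q S Ru x0 v w H F' = J F'.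
  exact: (gain_costE B Q S Ru gx0 gv gw ind uni).
have G0 : forall t, (t < N)%N -> grad t (F t) = block_mx 0 0 (dlsubmx (grad t (F t))) 0.
  (* A competitor with the same 21 blocks, all zero, is realized by an admissible law, so the
     optimality of [f] compares the two sums once the constant [c0] has cancelled. *)
  apply: gradient_dl => // F' F'21; rewrite -(lerD2l c0) -!JE -lee_fin.
  rewrite -(cost_gain_form Q S Ru gx0 gv gw ind uni cf cl est gf).
  rewrite -(cost_gain_loop B Q S Ru gx0 gv gw ind uni H F').
  apply: opt cl (gain_closed_loop _ _ _ _ _ _ _ _ _ _ _).
  by apply: gain_law_admissible => t tN; rewrite F'21// F21.
exists (cost_to_go N A B Q S Ru H), (fun t => - dlsubmx (grad t (F t))); split.
- move=> D.
  pose a := lagrangian P N A B C Q S Ru x0 v w H (fun t => - dlsubmx (grad t (F t))) F.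
  pose c := \sum_(t < N) curvature N A B Q S Ru H Sg t (D t).
  (* Since the gradient is supported in its 21 block, the linear term of the cost cancels that of
     the constraint along every direction [D]; only [a + c * s ^+ 2] remains. *)
  have -> : (fun s : R => lagrangian P N A B C Q S Ru x0 v w H
      (fun t => - dlsubmx (grad t (F t))) (fun t => F t + s *: D t)) = (fun s => a + c * s ^+ 2).
    apply/funext => s; rewrite /a /lagrangian !gcE -!/(J _) !JE sum_stage_cost_expand//.
    have -> : \sum_(t < N) \tr ((D t)^T *m gradient N A B Q S Ru H K Sg t (F t)) =
        - \sum_(t < N) \tr ((- dlsubmx (grad t (F t)))^T *m dlsubmx (D t)).
      rewrite -sumrN; apply: eq_bigr => t _.
      rewrite [X in \tr (_ *m X)](G0 t)// mxtrace_block_dl.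
      by rewrite (raddfN (@trmx _ _ _)) mulNmx (raddfN (@mxtrace _ _)) opprK.
    have -> : \sum_(t < N) \tr ((- dlsubmx (grad t (F t)))^T *m dlsubmx (F t + s *: D t)) =
        \sum_(t < N) \tr ((- dlsubmx (grad t (F t)))^T *m dlsubmx (F t)) +
        s * \sum_(t < N) \tr ((- dlsubmx (grad t (F t)))^T *m dlsubmx (D t)).
      rewrite mulr_sumr -big_split; apply: eq_bigr => t _ /=.
      by rewrite dlsubmxDZ mulmxDr -scalemxAr mxtraceD mxtraceZ.
    rewrite /c; ring.
  apply: is_derive_eq.
  by rewrite /= !(scale0r, addr0, scaler0, mulr0).
- exact: cost_to_goN.
- by move=> t tN; exact: cost_to_goS.
- move=> t tN /=; rewrite covE//.
  apply: (gain_of_gradient pQ pRu pS (Sg := Sg) (K := K)); first exact: uni.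
  by rewrite opp_block_mx !oppr0 opprK; exact: G0.
Qed.
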